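(* Let $n\ge 2$ and let $C\in\mathcal{K}_{(0)}(\mathbb{C})$. Then there exists $k_C>0$ such that for every $K\in\mathcal{S}_0(\mathbb{C}^n)$ $$\lim_{p\to -2^+}\left(\frac{1}{\Gamma(p+2)}\right)^{-1/p}\mathrm{I}_{C,p}K = k_C\cdot \mathrm{I}_c\left(K^{\mathbb{S}^1}\right),$$ where $K^{\mathbb{S}^1}\in\mathcal{S}_0(\mathbb{C}^n)$ is the star body with radial function $$\rho_{K^{\mathbb{S}^1}}(u)^{2n-2}=\frac{1}{2\pi}\int_{\mathbb{S}^1}\rho_K(cu)^{2n-2}\,dc,\qquad u\in\mathbb{S}^{2n-1},$$ and convergence is with respect to the radial metric, i.e. uniform convergence of radial functions on $\mathbb{S}^{2n-1}$.
   Context: Identify $\mathbb{C}^n\cong\mathbb{R}^{2n}$; $\langle\cdot,\cdot\rangle$ is the Euclidean inner product on $\mathbb{R}^{2n}$, $\mathbb{S}^{2n-1}$ the Euclidean unit sphere, $\mathbb{S}^1\subseteq\mathbb{C}$ the unit circle (with arc length measure $dc$), and $V_i$ is $i$-dimensional volume. The complex inner product on $\mathbb{C}^n$ is $x\cdot u=\langle x,u\rangle+i\langle -ix,u\rangle$ (linear in $x$, conjugate-linear in $u$). $\mathcal{S}_0(\mathbb{C}^n)$ is the set of star bodies: compact sets $K\subseteq\mathbb{C}^n$, star-shaped with respect to the origin, whose radial function $\rho_K(u)=\sup\{\lambda\ge 0:\lambda u\in K\}$, $u\ne0$, is positive and continuous. $\mathcal{K}_{(0)}(\mathbb{C})$ is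 the set of convex bodies (compact convex sets) in $\mathbb{C}\cong\mathbb{R}^2$ containing the origin in their interior. Complex $L_p$-intersection body: for $C\in\mathcal{K}_{(0)}(\mathbb{C})$, $p>-2$ non-zero and $K\in\mathcal{S}_0(\mathbb{C}^n)$, $\mathrm{I}_{C,p}K$ is the star body with radial function $$\rho_{\mathrm{I}_{C,p}K}(u)^{-p}=\int_K h_{Cu}(x)^p\,dx,\quad u\in\mathbb{S}^{2n-1},$$ where $Cu=\{cu:c\in C\}\subseteq\mathbb{C}^n$ and $h_L(x)=\sup\{\langle x,y\rangle:y\in L\}$ is the support function. Complex intersection body: for an $\mathbb{S}^1$-invariant star body $K$ (i.e. $cK=K$ for all $c\in\mathbb{S}^1$), $\mathrm{I}_cK$ is the unique $\mathbb{S}^1$-invariant star body with $$V_2(\mathrm{I}_cK\cap\mathrm{span}^{\mathbb{C}}\{u\})=V_{2n-2}(K\cap u^{\perp,\mathbb{C}}),\quad u\in\mathbb{S}^{2n-1},$$ where $\mathrm{span}^{\mathbb{C}}\{u\}$ is the complex line spanned by $u$ and $u^{\perp,\mathbb{C}}=\{x:x\cdot u=0\}$. For $t>0$, $t\cdot K$ denotes the dilate of $K$. *)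

(* Defs.v *)
From HB Require Import structures.
From mathcomp Require Import all_boot all_order all_algebra.
From mathcomp Require Import complex.
From mathcomp Require Import all_classical all_reals all_analysis.

Set Implicit Arguments.
Unset Strict Implicit.
Unset Printing Implicit Defensive.
Import Order.TTheory GRing.Theory Num.Theory.
Import numFieldNormedType.Exports.

Local Open Scope classical_set_scope.
Local Open Scope ring_scope.
Local Open Scope complex_scope.

Section measurable_rV.
Context {R : realType} {m : nat}.

(* The product sigma-algebra, generated by the coordinates; it is the Borel
   sigma-algebra of ['rV[R]_m]. *)
Let coords (i : 'I_m) (v : 'rV[R]_m) : measurableTypeR R := v 0 i.

Let rV_set0 : g_sigma_preimage coords set0.
Proof. exact: sigma_algebra0. Qed.

Let rV_setC A : g_sigma_preimage coords A -> g_sigma_preimage coords (~` A).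
Proof. exact: sigma_algebraC. Qed.

Let rV_bigcup (F : _^nat) : (forall i, g_sigma_preimage coords (F i)) ->
  g_sigma_preimage coords (\bigcup_i (F i)).
Proof. exact: sigma_algebra_bigcup. Qed.

HB.instance Definition _ :=
  @isMeasurable.Build (measure_tuple_display (R.-ocitv.-measurable).-sigma)
    'rV[R]_m (g_sigma_preimage coords) rV_set0 rV_setC rV_bigcup.

Lemma measurable_rV_coord (i : 'I_m) :
  measurable_fun [set: 'rV[R]_m] (fun v : 'rV[R]_m => v 0 i : measurableTypeR R).
Proof.
move=> _ Y mY; rewrite setTI; apply: sub_sigma_algebra => /=.
rewrite -bigcup_seq/=; exists i => /=; first by rewrite mem_index_enum.
by exists Y => //; rewrite setTI.
Qed.

Lemma measurable_fun_rV d (T : measurableType d) (f : T -> 'rV[R]_m) :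
  (forall i, measurable_fun [set: T] (fun x => f x 0 i : measurableTypeR R)) ->
  measurable_fun [set: T] f.
Proof.
move=> mf; suff: g_sigma_preimage (fun i => coords i \o f) `<=` measurable.
  rewrite g_sigma_preimage_comp => h _ A mA.
  by rewrite setTI; apply: h; exists A => //; rewrite setTI.
apply: smallest_sub; first exact: sigma_algebra_measurable.
rewrite -bigcup_seq/=; apply: bigcup_sub => i _.
by move=> A [B mB <-]; exact: mf.
Qed.

End measurable_rV.

Section lebesgue_rV.
Context {R : realType}.

Definition consrV m (p : measurableTypeR R * 'rV[R]_m) : 'rV[R]_m.+1 :=
  row_mx (p.1)%:M p.2.

Definition unconsrV m (v : 'rV[R]_m.+1) : measurableTypeR R * 'rV[R]_m :=
  (v 0 0, \row_j v 0 (lift 0 j)).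

Lemma consrVK m : cancel (@consrV m) (@unconsrV m).
Proof.
move=> [x v]; rewrite /consrV /unconsrV; congr pair.
  rewrite (_ : 0 = lshift m (0 : 'I_1)); last exact/val_inj.
  by rewrite (row_mxEl (x%:M : 'M[R]_1)) mxE eqxx mulr1n.
apply/rowP => j; rewrite mxE.
rewrite (_ : lift 0 j = rshift 1 j); last exact/val_inj.
by rewrite (row_mxEr (x%:M : 'M[R]_1)).
Qed.

Lemma measurable_consrV m : measurable_fun setT (@consrV m).
Proof.
apply: measurable_fun_rV => i.
case: (unliftP 0 i) => [j ->|->].
- apply: (eq_measurable_fun (fun p : measurableTypeR R * 'rV[R]_m => p.2 0 j)).
    by move=> p _; rewrite -[in LHS](consrVK p) mxE.
  exact: (measurableT_comp (measurable_rV_coord j) measurable_snd).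
- apply: (eq_measurable_fun fst).
    by move=> p _; rewrite -[in LHS](consrVK p).
  exact: measurable_fst.
Qed.

Lemma measurable_unconsrV m : measurable_fun setT (@unconsrV m).
Proof.
apply: measurable_fun_pair => /=; first exact: measurable_rV_coord.
apply: measurable_fun_rV => i.
apply: (eq_measurable_fun (fun v : 'rV[R]_m.+1 => v 0 (lift 0 i))).
  by move=> v _; rewrite mxE.
exact: measurable_rV_coord.
Qed.

Section succ.
Variables (m : nat) (mu : {sigma_finite_measure set 'rV[R]_m -> \bar R}).

Definition lebS : set 'rV[R]_m.+1 -> \bar R :=
  pushforward (@lebesgue_measure R \x mu)%E (@consrV m).

Let lebS0 : lebS set0 = 0%E.
Proof. by rewrite /lebS /pushforward preimage_set0 measure0. Qed.

Let lebS_ge0 A : (0 <= lebS A)%E.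
Proof. by rewrite /lebS /pushforward; exact: measure_ge0. Qed.

Let lebS_sigma_additive : semi_sigma_additive lebS.
Proof.
move=> F mF tF mUF; rewrite /lebS /pushforward preimage_bigcup.
apply: measure_semi_sigma_additive.
- by move=> k; rewrite -[X in measurable X]setTI; exact: measurable_consrV.
- apply/trivIsetP => /= i j _ _ ij; rewrite -preimage_setI.
  by move/trivIsetP : tF => /(_ _ _ _ _ ij) ->//; rewrite preimage_set0.
- by rewrite -preimage_bigcup -[X in measurable X]setTI; exact: measurable_consrV.
Qed.

HB.instance Definition _ :=
  isMeasure.Build _ _ _ lebS lebS0 lebS_ge0 lebS_sigma_additive.

Let lebS_sigma_finite : sigma_finite setT lebS.
Proof.
have /sigma_finiteP[F [FT ndF Foo]] := sigma_finiteT (@lebesgue_measure R).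
have /sigma_finiteP[G [GT ndG Goo]] := sigma_finiteT mu.
exists (fun k => @unconsrV m @^-1` (F k `*` G k)).
  apply/esym/seteqP; split=> // v _.
  have [i _ Fi] : (\bigcup_i F i) (unconsrV v).1 by rewrite -FT.
  have [j _ Gj] : (\bigcup_i G i) (unconsrV v).2 by rewrite -GT.
  exists (maxn i j) => //; split.
  - by move: Fi; exact/subsetPset/ndF/leq_maxl.
  - by move: Gj; exact/subsetPset/ndG/leq_maxr.
move=> k; have [mF Fk] := Foo k; have [mG Gk] := Goo k; split.
  rewrite -[X in measurable X]setTI; apply: measurable_unconsrV => //.
  exact: measurableX.
rewrite /lebS /pushforward -comp_preimage.
rewrite (_ : _ \o _ = id); last by apply/funext => p; exact: consrVK.
by rewrite preimage_id product_measure1E// lte_mul_pinfty// ge0_fin_numE.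
Qed.

HB.instance Definition _ :=
  Measure_isSigmaFinite.Build _ _ _ lebS lebS_sigma_finite.

End succ.

Fixpoint leb m : {sigma_finite_measure set 'rV[R]_m -> \bar R} :=
  match m with
  | 0 => \d_ (0 : 'rV[R]_0)
  | m'.+1 => lebS (leb m')
  end.

End lebesgue_rV.

Section euclidean.
Context {R : realType}.

Definition dot m (x y : 'rV[R]_m) : R := (x *m y^T) 0 0.

Definition enorm m (x : 'rV[R]_m) : R := Num.sqrt (dot x x).

Definition usphere m : set 'rV[R]_m := [set u | enorm u = 1].

(* [vol i A] is the [i]-dimensional volume of a set [A] that lies in some
   [i]-dimensional linear subspace of [R^m]: the Lebesgue measure of [A] read
   through a linear isometry [t |-> t *m E] of [R^i] onto such a subspace.  The
   value does not depend on [E]; it is a junk value when there is no such [E]. *)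
Definition isom_frame i m (A : set 'rV[R]_m) : set 'M[R]_(i, m) :=
  [set E | E *m E^T = 1%:M /\ forall x, A x -> (x <= E)%MS].

Definition vol i m (A : set 'rV[R]_m) : \bar R :=
  leb i [set t | A (t *m xget 0 (@isom_frame i m A))].

Definition radial m (K : set 'rV[R]_m) (u : 'rV[R]_m) : R :=
  sup [set l : R | 0 <= l /\ K (l *: u)].

Definition star_body m (K : set 'rV[R]_m) : Prop :=
  [/\ compact K,
      forall x (t : R), K x -> 0 <= t <= 1 -> K (t *: x),
      forall u, u != 0 -> 0 < radial K u
    & forall u, u != 0 -> {for u, continuous (radial K)}].

(* Only the values of [r] on the unit sphere matter; when [r] is positive and
   continuous there, this is the star body with radial function [r]. *)
Definition body_of_radial m (r : 'rV[R]_m -> R) : set 'rV[R]_m :=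
  [set x | exists u l, [/\ usphere u, 0 <= l <= r u & x = l *: u]].

Definition dilate m (t : R) (K : set 'rV[R]_m) : set 'rV[R]_m :=
  [set t *: x | x in K].

Definition supportf m (L : set 'rV[R]_m) (x : 'rV[R]_m) : R :=
  sup [set dot x y | y in L].

End euclidean.

Section complex_structure.
Context {R : realType}.

(* [row_mx a b] stands for the complex vector [a + i b]. *)
Definition cmul n (c : R[i]) (x : 'rV[R]_(n + n)) : 'rV[R]_(n + n) :=
  complex.Re c *: x + complex.Im c *: row_mx (- rsubmx x) (lsubmx x).

Definition cdot n (x u : 'rV[R]_(n + n)) : R[i] :=
  dot x u +i* dot (cmul (- 'i%C) x) u.

Definition cspan n (u : 'rV[R]_(n + n)) : set 'rV[R]_(n + n) :=
  [set cmul c u | c in [set: R[i]]].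

Definition cperp n (u : 'rV[R]_(n + n)) : set 'rV[R]_(n + n) :=
  [set x | cdot x u = 0].

Definition circle_invariant n (K : set 'rV[R]_(n + n)) : Prop :=
  forall c : R[i], `|c| = 1 -> [set cmul c x | x in K] = K.

Definition vec_of_complex (c : R[i]) : 'rV[R]_(1 + 1) :=
  row_mx (complex.Re c)%:M (complex.Im c)%:M.

Definition convex_body0 (C : set R[i]) : Prop :=
  let C2 := vec_of_complex @` C in
  [/\ compact C2, convex_set (C2 : set (convex_lmodType 'rV[R]_(1 + 1)))
    & C2° 0].

Definition cexp (t : R) : R[i] := cos t +i* sin t.

End complex_structure.

Section intersection_bodies.
Context {R : realType}.

Definition Gamma (s : R) : R :=
  \int[@lebesgue_measure R]_(t in `]0, +oo[) (t `^ (s - 1) * expR (- t)).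

(* The convention [0 `^ p = 0] for [p != 0] is harmless here: for [u != 0] the
   function [supportf (C u)] vanishes only on the null set [cperp u]. *)
Definition Lp_intersection_body n (C : set R[i]) (p : R)
    (K : set 'rV[R]_(n + n)) : set 'rV[R]_(n + n) :=
  body_of_radial (fun u =>
    (\int[leb (n + n)]_(x in K) (supportf [set cmul c u | c in C] x `^ p))
      `^ (- p^-1)).

Definition is_complex_intersection_body n (K L : set 'rV[R]_(n + n)) : Prop :=
  [/\ star_body L, circle_invariant L
    & forall u, usphere u ->
        vol 2 (L `&` cspan u) = vol (2 * n - 2) (K `&` cperp u)].

(* The star body [L] above is unique.  The default value [set0], taken when there
   is none, has radial function [0]. *)
Definition complex_intersection_body n (K : set 'rV[R]_(n + n)) :
    set 'rV[R]_(n + n) :=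
  xget set0 [set L | is_complex_intersection_body K L].

Definition circle_average n (K : set 'rV[R]_(n + n)) : set 'rV[R]_(n + n) :=
  body_of_radial (fun u =>
    ((2 * pi)^-1 *
       \int[@lebesgue_measure R]_(t in `[0, 2 * pi])
          (radial K (cmul (cexp t) u) ^+ (2 * n - 2)))
      `^ ((2 * n - 2)%:R^-1)).

End intersection_bodies.

(* Main.v *)
(* For [u] on the sphere, the support function of [C u] at [x] is [h (x *m W^T)], where
   [h] is the support function of [C] in the plane and the rows of [W] are an orthonormal
   basis of the complex line through [u].  As [x *m W^T] lies in a plane, the set of
   the [x] in [K] with [h (x *m W^T) <= s] has volume about [s^2 V A(u)] for small [s],
   with [V] the area of [{h <= 1}] and [A(u)] the volume of the section of [K] by the
   complex hyperplane orthogonal to [u].  By the layer cake formula the integral of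
   [h^p] over [K] is about [2 V A(u) / (p + 2)] as [p] tends to [-2]; since [Gamma (p + 2)]
   is about [1 / (p + 2)], the normalized integral tends to [2 V A(u)], and the power
   [-1/p] tends to [1/2].  All errors are relative and uniform in [u], because they
   come from the uniform continuity of the gauge of [K].  Finally, [A(u)] is also the
   volume of the section of the circle average of [K], as its complex hyperplanes are
   circle invariant, and so the limit is a multiple of the radial function of the
   complex intersection body. *)

Require Import Defs.
From HB Require Import structures.
From mathcomp Require Import all_boot all_order all_algebra.
From mathcomp Require Import complex.
From mathcomp Require Import all_classical all_reals all_analysis.
From mathcomp Require Import measurable_realfun ring lra.
Import Order.TTheory GRing.Theory Num.Theory.
Import numFieldNormedType.Exports.
Local Open Scope classical_set_scope.
Local Open Scope ring_scope.
Local Open Scope complex_scope.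

Set Implicit Arguments.
Unset Strict Implicit.
Unset Printing Implicit Defensive.

(** * Measurability in [R^m] *)

(** Star bodies are handled through gauges, and estimates take the form
    [g y <= (1 + e) * g x + D * |x - y|] or of a ratio at most [1 + e]: by homogeneity such errors
    become inclusions between dilates, hence bounds on ratios of volumes. The obstacle is that [vol]
    reads a section through an arbitrary orthonormal frame, and nothing makes these frames depend
    continuously on [u]. Sections at neighbouring [u] are therefore never compared directly; each is
    compared with a thin cylinder, a full-dimensional set that depends on [u] only through the
    explicit basis [u], [i u] of the complex line. The same cylinder estimate serves twice: for the
    asymptotics of the integral, and for the continuity of the section volume, from which the
    existence of the complex intersection body follows. *)

Section measurability.
Context {R : realType}.

(** The sigma-algebra is generated by the coordinates, so an open set is written as a countable
    union of coordinate boxes: those with rational centre and radius [1 / (k + 1)] that it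
    contains. *)
Lemma open_measurable_rV m (U : set 'rV[R]_m) : open U -> measurable U.
Proof.
move=> oU.
pose box (q : 'rV[rat]_m * nat) : set 'rV[R]_m :=
  [set x | forall i, `|x 0 i - ratr (q.1 0 i)| < (q.2.+1%:R)^-1].
have mbox q : measurable (box q).
  rewrite (_ : box q = \bigcap_i
      ((fun x : 'rV[R]_m => x 0 i : measurableTypeR R) @^-1`
        [set y | `|y - ratr (q.1 0 i)| < (q.2.+1%:R)^-1])); last first.
    by apply/seteqP; split=> [x bx i _ //|x bx i]; exact: bx.
  apply: fin_bigcap_measurable => // i _.
  rewrite -[X in measurable X]setTI; apply: measurable_rV_coord => //.
  apply: open_measurable => //.
  rewrite (_ : [set _ | _] = ball (ratr (q.1 0 i) : R) (q.2.+1%:R)^-1).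
    exact: ball_open.
  by apply/seteqP; split=> y /=; rewrite /ball/= distrC.
rewrite (_ : U = \bigcup_q (if `[< box q `<=` U >] then box q else set0)).
  apply: countable_bigcupT_measurable; first exact: countableP.
  by move=> q; case: ifP.
apply/seteqP; split=> [x Ux|x [q _]]; last by case: ifPn => // /asboolP; apply.
have /nbhs_ballP[e/= e0 xeU] : nbhs x U by exact: open_nbhs_nbhs.
(* The box is centred at a rational point near [x], so its points are within twice its radius of
   [x]; hence [e / 2]. *)
have [k ke] : exists k : nat, (k.+1%:R)^-1 < e / 2 :> R.
  have e2 : 0 < e / 2 by rewrite divr_gt0.
  have [N _ /(_ N (leqnn _))] := near_infty_natSinv_lt (PosNum e2).
  by exists N.
have /choice[q qP] (i : 'I_m) : exists q : rat, `|x 0 i - ratr q| < (k.+1%:R)^-1.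
  have : x 0 i - (k.+1%:R)^-1 < x 0 i + (k.+1%:R)^-1.
    by rewrite ltrD2l gtrN ?invr_gt0.
  move=> /rat_in_itvoo[q]; rewrite in_itv/= => /andP[q1 q2]; exists q.
  by rewrite ltr_distlC q1 q2.
exists (\row_i q i, k) => //.
have bx : box (\row_i q i, k) x by move=> i /=; rewrite mxE.
rewrite asboolT// => y by_; apply: xeU; split=> // i j; rewrite (ord1 i).
rewrite /ball/= (le_lt_trans (ler_distD (ratr (q j)) _ _))//.
rewrite (splitr e) ltrD//; first by rewrite (lt_trans _ ke)// qP.
by rewrite distrC (lt_trans _ ke)//; have := by_ j; rewrite mxE.
Qed.

Lemma closed_measurable_rV m (U : set 'rV[R]_m) : closed U -> measurable U.
Proof.
by move=> /closed_openC/open_measurable_rV/measurableC; rewrite setCK.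
Qed.

Lemma continuous_measurable_rV m (f : 'rV[R]_m -> R) :
  continuous f -> measurable_fun setT f.
Proof.
move=> /continuousP cf; apply: (measurability _ (RGenOpens.measurableE R)).
move=> _ [_ [a [b ->] <-]]; rewrite setTI; apply: open_measurable_rV.
exact/cf/interval_open.
Qed.

Lemma measurable_mulmxr m k (M : 'M[R]_(m, k)) :
  measurable_fun setT (fun x : 'rV[R]_m => x *m M).
Proof.
apply: measurable_fun_rV => i.
rewrite (_ : (fun _ => _) = fun x : 'rV[R]_m => \sum_j x 0 j * M j i); last first.
  by apply/funext => x; rewrite mxE.
apply: measurable_sum => j; apply: measurable_funM => //.
exact: measurable_rV_coord.
Qed.

Lemma measurable_addrV d (T : measurableType d) m (f g : T -> 'rV[R]_m) :
  measurable_fun setT f -> measurable_fun setT g ->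
  measurable_fun setT (fun x => f x + g x).
Proof.
move=> mf mg; apply: measurable_fun_rV => i.
rewrite (_ : (fun _ => _) = fun x => f x 0 i + g x 0 i); last first.
  by apply/funext => x; rewrite mxE.
by apply: measurable_funD;
  [exact: (measurableT_comp (measurable_rV_coord i) mf)|
   exact: (measurableT_comp (measurable_rV_coord i) mg)].
Qed.

Lemma measurable_scalerV d (T : measurableType d) m (a : T -> R)
    (f : T -> 'rV[R]_m) :
  measurable_fun setT a -> measurable_fun setT f ->
  measurable_fun setT (fun x => a x *: f x).
Proof.
move=> ma mf; apply: measurable_fun_rV => i.
rewrite (_ : (fun _ => _) = fun x => a x * f x 0 i); last first.
  by apply/funext => x; rewrite mxE.
apply: measurable_funM => //.
exact: (measurableT_comp (measurable_rV_coord i) mf).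
Qed.

End measurability.

(** * Lebesgue measure: affine and orthogonal invariance *)

Section transport.
Local Open Scope ereal_scope.
Context d1 d2 (T1 : measurableType d1) (T2 : measurableType d2) (R : realType).
Variables (m1 : {measure set T1 -> \bar R}) (m2 : {measure set T2 -> \bar R}).

(** Change of variables reduced to sets. The one-dimensional affine substitution, the orthogonal one
    and the splitting off of a coordinate are instances, with [c] the Jacobian. *)
Lemma integral_transport (phi : T1 -> T2) (c : R) : (0 <= c)%R ->
  measurable_fun setT phi ->
  (forall A, measurable A -> c%:E * m1 (phi @^-1` A) = m2 A) ->
  forall f : T2 -> \bar R, measurable_fun setT f -> (forall x, 0 <= f x) ->
  c%:E * \int[m1]_x f (phi x) = \int[m2]_x f x.
Proof.
move=> c0 mphi m12 f mf f0.
have [nu nuE] : exists nu : {measure set T2 -> \bar R},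
    nu = pushforward m1 phi :> (set T2 -> \bar R).
  by unshelve (eexists (pushforward m1 phi)).
rewrite [RHS](eq_measure_integral (mscale (NngNum c0) nu)).
  by rewrite ge0_integral_mscale//= nuE ge0_integral_pushforward.
by move=> A mA _; rewrite -m12// -/(pushforward m1 phi A) -nuE.
Qed.

End transport.

Section leb_basic.
Context {R : realType}.
Local Notation mu := (@lebesgue_measure R).

Lemma unconsrVK m : cancel (@unconsrV R m) (@consrV R m).
Proof.
move=> b; apply/rowP => i; rewrite /consrV/=; case: (unliftP 0 i) => [j ->|->].
  rewrite (_ : lift 0 j = rshift 1 j); last exact/val_inj.
  by rewrite (row_mxEr (_%:M : 'M[R]_1)) mxE; congr (b 0 _); exact/val_inj.
rewrite (_ : 0 = lshift m (0 : 'I_1)); last exact/val_inj.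
rewrite (row_mxEl (_%:M : 'M[R]_1)) mxE eqxx mulr1n; congr (b _ _); exact/val_inj.
Qed.

Lemma consrV_affine m (a : R) (b : 'rV[R]_m.+1) x v :
  a *: consrV (x, v) + b = consrV (a * x + b 0 0, a *: v + \row_j b 0 (lift 0 j)).
Proof.
transitivity (a *: row_mx x%:M v + row_mx (b 0 0)%:M (\row_j b 0 (lift 0 j)) :
    'rV[R]_(1 + m)).
  by rewrite -[in LHS](unconsrVK b).
by rewrite scale_row_mx add_row_mx scale_scalar_mx -raddfD.
Qed.

Local Open Scope ereal_scope.

Lemma integral_leb0 (f : 'rV[R]_0 -> \bar R) : measurable_fun setT f ->
  \int[leb 0]_v f v = f 0%R.
Proof. by move=> mf; rewrite integral_dirac// diracT mul1e. Qed.

Lemma measurable_integral_leb d (T : measurableType d) m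
    (f : T -> 'rV[R]_m -> \bar R) :
  measurable_fun setT (fun p : T * 'rV[R]_m => f p.1 p.2) ->
  (forall x v, 0 <= f x v) ->
  measurable_fun setT (fun x => \int[leb m]_v f x v).
Proof.
move=> mf f0.
by apply: (measurable_fun_fubini_tonelli_F (m2 := leb m) (fun p => f p.1 p.2)).
Qed.

Lemma integral_lebS m (f : 'rV[R]_m.+1 -> \bar R) :
  measurable_fun setT f -> (forall v, 0 <= f v) ->
  \int[leb m.+1]_v f v = \int[mu]_x \int[leb m]_v f (consrV (x, v)).
Proof.
move=> mf f0.
transitivity (\int[mu \x leb m]_p f (consrV p)).
  rewrite -(@integral_transport _ _ _ _ _ (mu \x leb m) (leb m.+1)
    (@consrV R m) 1%R)// ?mul1e//; first exact: measurable_consrV.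
  by move=> A mA; rewrite mul1e.
rewrite fubini_tonelli1//.
exact: (measurableT_comp mf (measurable_consrV (m := m))).
Qed.

Lemma leb_integral_indic m (A : set 'rV[R]_m) : measurable A ->
  leb m A = \int[leb m]_v (\1_A v)%:E.
Proof. by move=> mA; rewrite integral_indic// setIT. Qed.

(** The left-hand side is a measure in [A] that agrees with Lebesgue measure on half-open intervals;
    uniqueness does the rest. *)
Lemma lebesgue_affine (a b : R) (A : set (measurableTypeR R)) : (0 < a)%R ->
  measurable A -> a%:E * mu [set x | A (a * x + b)%R] = mu A.
Proof.
move=> a0 mA.
have maff : measurable_fun setT
    (fun x : measurableTypeR R => (a * x + b)%R : measurableTypeR R).
  apply: measurable_funD => //; exact: measurable_funM.
have [nu nuE] : exists nu : {measure set (measurableTypeR R) -> \bar R},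
    nu = pushforward mu (fun x : measurableTypeR R => (a * x + b)%R : measurableTypeR R)
    :> (set (measurableTypeR R) -> \bar R).
  by unshelve (eexists (pushforward mu (fun x : measurableTypeR R => (a * x + b)%R : measurableTypeR R))).
transitivity (a%:E * nu A); first by rewrite nuE.
apply/esym; apply: (@lebesgue_measure_unique _ (mscale (NngNum (ltW a0)) nu)) => //.
move=> _ [[u v] /= uv <-].
transitivity (a%:E * nu `]u, v]%classic); last by [].
rewrite nuE /pushforward.
rewrite (_ : _ @^-1` _ = `]((u - b) / a)%R, ((v - b) / a)%R]%classic); last first.
  apply/seteqP; split=> x /=; rewrite !in_itv/=.
    by rewrite ltr_pdivrMr// ler_pdivlMr// ltrBlDr lerBrDr mulrC.
  by rewrite ltr_pdivrMr// ler_pdivlMr// ltrBlDr lerBrDr mulrC.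
rewrite !lebesgue_measure_itv/= !lte_fin ltr_pM2r ?invr_gt0// ltrD2r.
case: ifPn => _; last by rewrite mule0.
rewrite -EFinM; congr (_%:E); field.
by rewrite gt_eqF.
Qed.

Lemma integral_lebesgue_affine (a b : R) (f : R -> \bar R) : (0 < a)%R ->
  measurable_fun setT f -> (forall x, 0 <= f x) ->
  a%:E * \int[mu]_x f (a * x + b)%R = \int[mu]_x f x.
Proof.
move=> a0 mf f0.
apply: (@integral_transport _ _ _ _ _ mu mu
  (fun x : measurableTypeR R => (a * x + b)%R : measurableTypeR R)) => //.
- exact: ltW.
- by apply: measurable_funD => //; exact: measurable_funM.
- by move=> A mA; exact: lebesgue_affine.
Qed.

Lemma measurable_affine_rV m (a : R) (b : 'rV[R]_m) :
  measurable_fun setT (fun v : 'rV[R]_m => a *: v + b)%R.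
Proof.
apply: measurable_addrV; last exact: measurable_cst.
by apply: measurable_scalerV; [exact: measurable_cst|exact: measurable_id].
Qed.

(** Induction on the dimension: the first coordinate contributes one factor [a], and the remaining
    ones undergo an affine map of the same kind. *)
Lemma integral_leb_affine m (a : R) (b : 'rV[R]_m) (f : 'rV[R]_m -> \bar R) :
  (0 < a)%R -> measurable_fun setT f -> (forall x, 0 <= f x) ->
  (a ^+ m)%:E * \int[leb m]_v f (a *: v + b)%R = \int[leb m]_v f v.
Proof.
move=> a0; elim: m => [|m IH] in b f *.
  move=> mf f0; rewrite expr0 mul1e !integral_leb0//.
    by congr f; apply/rowP; case.
  exact: (measurableT_comp mf (measurable_affine_rV _ _)).
move=> mf f0; rewrite !integral_lebS//; last first.
  exact: (measurableT_comp mf (measurable_affine_rV _ _)).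
have mfc : measurable_fun setT (fun p : measurableTypeR R * 'rV[R]_m => f (consrV p)).
  exact: (measurableT_comp mf (measurable_consrV (m := m))).
have mI : measurable_fun setT (fun x : measurableTypeR R => \int[leb m]_v f (consrV (x, v))).
  apply: (measurable_integral_leb (f := fun x v => f (consrV (x, v)))) => //.
rewrite exprS EFinM -muleA -[RHS](integral_lebesgue_affine (b 0 0)%R a0)//; last first.
  by move=> x; exact: integral_ge0.
congr (_ * _); rewrite -ge0_integralZl//; last 3 first.
- apply: (measurable_integral_leb (f := fun x v => f (a *: consrV (x, v) + b)%R)) => //.
  rewrite (_ : (fun _ => _) = fun p => f (a *: consrV p + b)%R); last first.
    by apply/funext; case.
  apply: (measurableT_comp mf).
  exact: (measurableT_comp (measurable_affine_rV _ _) (measurable_consrV (m := m))).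
- by move=> x _; exact: integral_ge0.
- by rewrite lee_fin exprn_ge0// ltW.
apply: eq_integral => x _.
under eq_integral do rewrite consrV_affine.
rewrite (IH _ (fun v => f (consrV (a * x + b 0 0, v))%R))//.
exact: (measurableT_comp mfc (measurable_pair1 _)).
Qed.

Lemma leb_affine m (a : R) (b : 'rV[R]_m) (A : set 'rV[R]_m) :
  (0 < a)%R -> measurable A ->
  (a ^+ m)%:E * leb m [set v | A (a *: v + b)%R] = leb m A.
Proof.
move=> a0 mA.
have mA' : measurable [set v | A (a *: v + b)%R].
  by rewrite -[X in measurable X]setTI; exact: measurable_affine_rV.
rewrite !leb_integral_indic// -[RHS](integral_leb_affine b a0)//.
by apply/measurable_EFinP; exact: measurable_indic.
Qed.

End leb_basic.

(** * The Euclidean norm and its comparison with the sup norm, which carries the topology *)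

Section euclidean_norm.
Context {R : realType}.

Lemma dotE m (x y : 'rV[R]_m) : dot x y = \sum_i x 0 i * y 0 i.
Proof. by rewrite /dot mxE; apply: eq_bigr => i _; rewrite mxE. Qed.

Lemma dotC m (x y : 'rV[R]_m) : dot x y = dot y x.
Proof. by rewrite !dotE; apply: eq_bigr => i _; rewrite mulrC. Qed.

Lemma dot_ge0 m (x : 'rV[R]_m) : 0 <= dot x x.
Proof. by rewrite dotE sumr_ge0// => i _; rewrite -expr2 sqr_ge0. Qed.

Lemma dotDr m (x y z : 'rV[R]_m) : dot x (y + z) = dot x y + dot x z.
Proof. by rewrite /dot linearD/= mulmxDr mxE. Qed.

Lemma dotDl m (x y z : 'rV[R]_m) : dot (y + z) x = dot y x + dot z x.
Proof. by rewrite /dot mulmxDl mxE. Qed.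

Lemma dotZr m (x y : 'rV[R]_m) a : dot x (a *: y) = a * dot x y.
Proof. by rewrite /dot linearZ/= -scalemxAr mxE. Qed.

Lemma dotZl m (x y : 'rV[R]_m) a : dot (a *: x) y = a * dot x y.
Proof. by rewrite /dot -scalemxAl mxE. Qed.

Lemma dot_mulmx m k (x : 'rV[R]_m) (M : 'M[R]_(m, k)) y :
  dot (x *m M) y = dot x (y *m M^T).
Proof. by rewrite /dot trmx_mul trmxK mulmxA. Qed.

Lemma enorm_ge0 m (x : 'rV[R]_m) : 0 <= enorm x.
Proof. exact: sqrtr_ge0. Qed.

Lemma enorm_sqr m (x : 'rV[R]_m) : enorm x ^+ 2 = dot x x.
Proof. by rewrite sqr_sqrtr// dot_ge0. Qed.

Lemma enormZ m (x : 'rV[R]_m) a : 0 <= a -> enorm (a *: x) = a * enorm x.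
Proof.
move=> a0; rewrite /enorm dotZl dotZr mulrA sqrtrM ?mulr_ge0//.
by rewrite -expr2 sqrtr_sqr ger0_norm.
Qed.

Lemma enorm_isom i m (E : 'M[R]_(i, m)) (x : 'rV[R]_i) :
  E *m E^T = 1%:M -> enorm (x *m E) = enorm x.
Proof. by move=> EE; rewrite /enorm dot_mulmx -mulmxA EE mulmx1. Qed.

Lemma mx_norm_coord m (x : 'rV[R]_m) i : `|x 0 i| <= `|x|.
Proof.
rewrite -[`|x|]/(mx_norm x) mx_normrE.
exact: (le_bigmax _ (fun i : 'I_1 * 'I_m => `|x i.1 i.2|) (0, i)).
Qed.

Lemma mx_norm_leP m (x : 'rV[R]_m) c : 0 <= c ->
  (forall i, `|x 0 i| <= c) -> `|x| <= c.
Proof.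
move=> c0 xc; rewrite -[`|x|]/(mx_norm x) mx_normrE; apply/bigmax_leP; split=> // -[i j] _ /=.
by rewrite (ord1 i).
Qed.

Lemma mx_norm_le_enorm m (x : 'rV[R]_m) : `|x| <= enorm x.
Proof.
apply: mx_norm_leP => [|i]; first exact: enorm_ge0.
rewrite -(@ler_pXn2r _ 2) ?nnegrE ?enorm_ge0// enorm_sqr dotE (bigD1 i)//=.
rewrite real_normK ?num_real// -expr2 lerDl sumr_ge0// => j _.
by rewrite -expr2 sqr_ge0.
Qed.

Lemma norm_dot_le m (x y : 'rV[R]_m) : `|dot x y| <= m%:R * `|x| * `|y|.
Proof.
rewrite dotE (le_trans (ler_norm_sum _ _ _))//.
rewrite (@le_trans _ _ (\sum_(i < m) `|x| * `|y|))//.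
  by apply: ler_sum => i _; rewrite normrM ler_pM// mx_norm_coord.
by rewrite sumr_const card_ord -mulrA mulr_natl.
Qed.

Lemma enorm_le_mx_norm m (x : 'rV[R]_m) : enorm x <= m%:R * `|x|.
Proof.
rewrite -(@ler_pXn2r _ 2) ?nnegrE ?enorm_ge0// ?mulr_ge0// enorm_sqr.
rewrite (le_trans (ler_norm _))// (le_trans (norm_dot_le _ _))//.
rewrite -mulrA -expr2 exprMn ler_wpM2r ?sqr_ge0//.
by rewrite -natrX ler_nat; case: m x => // m _; rewrite expnS expn1 leq_pmulr.
Qed.

Lemma enorm_eq0 m (x : 'rV[R]_m) : (enorm x == 0) = (x == 0).
Proof.
apply/idP/idP => [/eqP x0|/eqP->]; last by rewrite /enorm dotE big1 ?sqrtr0// => i; rewrite mxE mul0r.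
by rewrite -normr_le0 -x0 mx_norm_le_enorm.
Qed.

Lemma enorm0 m : enorm (0 : 'rV[R]_m) = 0.
Proof. by apply/eqP; rewrite enorm_eq0. Qed.

Lemma enorm_gt0 m (x : 'rV[R]_m) : (0 < enorm x) = (x != 0).
Proof. by rewrite lt0r enorm_ge0 andbT enorm_eq0. Qed.

Lemma continuous_enorm m : continuous (@enorm R m).
Proof.
move=> x; apply: continuous_comp; last exact: sqrt_continuous.
rewrite [X in {for _, continuous X}](_ : _ = fun y : 'rV[R]_m => \sum_i y 0 i * y 0 i); last first.
  by apply/funext => y; rewrite dotE.
apply: continuous_big => [|i _ y]; first exact: add_continuous.
by apply: continuousM; exact: coord_continuous.
Qed.

Lemma measurable_enorm m : measurable_fun setT (@enorm R m).
Proof. by apply: continuous_measurable_rV; exact: continuous_enorm. Qed.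

End euclidean_norm.

Section leb_orthogonal.
Context {R : realType}.
Local Notation mu := (@lebesgue_measure R).

Lemma measurable_preimage_mulmxr m k (M : 'M[R]_(m, k)) (A : set 'rV[R]_k) :
  measurable A -> measurable [set y | A (y *m M)].
Proof.
by move=> mA; rewrite -[X in measurable X]setTI; exact: (measurable_mulmxr M measurableT mA).
Qed.

Lemma consrV0 m (p : measurableTypeR R * 'rV[R]_m) : consrV p 0 0 = p.1.
Proof. by rewrite -[in RHS](consrVK p). Qed.

Lemma consrVS m (p : measurableTypeR R * 'rV[R]_m) (j : 'I_m) :
  consrV p 0 (lift 0 j) = p.2 0 j.
Proof. by have /= := congr1 (fun q : measurableTypeR R * 'rV[R]_m => q.2 0 j) (consrVK p); rewrite mxE. Qed.

Lemma measurable_cube m (a b : R) :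
  measurable [set v : 'rV[R]_m | forall i, a <= v 0 i <= b].
Proof.
rewrite (_ : [set _ | _] = \bigcap_(i in setT)
    ((fun v : 'rV[R]_m => v 0 i : measurableTypeR R) @^-1` `[a, b]%classic)).
  apply: fin_bigcap_measurable => // i _.
  by rewrite -[X in measurable X]setTI; apply: measurable_rV_coord => //; exact: measurable_itv.
apply/seteqP; split=> [v vab i _|v vab i]; first by rewrite /= in_itv/=.
by have := vab i Logic.I; rewrite /= in_itv.
Qed.

Lemma leb_cube m (a b : R) : a <= b ->
  leb m [set v | forall i, a <= v 0 i <= b] = ((b - a) ^+ m)%:E.
Proof.
move=> ab; elim: m => [|m IH].
  by rewrite /leb/= diracE mem_set// => -[].
transitivity ((mu \x leb m)%E
    (`[a, b]%classic `*` [set v : 'rV[R]_m | forall i, a <= v 0 i <= b])).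
  rewrite /= /lebS /pushforward; congr ((_ \x _)%E _).
  apply/seteqP; split=> -[x v] /=; rewrite in_itv/=.
    move=> h; split=> [|i]; first by have := h 0; rewrite consrV0.
    by have := h (lift 0 i); rewrite consrVS.
  move=> -[xab vab] i.
  by case: (unliftP 0 i) => [j ->|->]; rewrite ?consrVS ?consrV0.
rewrite product_measure1E//; last exact: measurable_cube.
rewrite [X in (_ * X)%E](IH) exprS EFinM; congr (_ * _)%E.
rewrite -[LHS]/(@lebesgue_measure R `[a, b]%classic) lebesgue_measure_itv/= lte_fin; case: ltgtP ab => // -> .
by move=> _; rewrite subrr.
Qed.

Definition eball m (r : R) : set 'rV[R]_m := [set x | enorm x <= r].

Lemma measurable_eball m r : measurable (eball r : set 'rV[R]_m).
Proof.
rewrite -[eball r]setTI (_ : eball r = @enorm R m @^-1` `]-oo, r]%classic).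
  by apply: measurable_enorm => //; exact: measurable_itv.
by apply/seteqP; split=> x /=; rewrite in_itv.
Qed.

Lemma leb_eball_lty m (r : R) : (leb m (eball r) < +oo)%E.
Proof.
have [r0|r0] := leP 0 r; last first.
  rewrite (_ : eball r = set0) ?measure0 ?ltry//.
  by rewrite -subset0 => x /=; rewrite /eball/= leNgt (lt_le_trans r0)// enorm_ge0.
apply: (@le_lt_trans _ _ (leb m [set v | forall i, - r <= v 0 i <= r])).
  apply: le_measure; rewrite ?inE; [exact: measurable_eball| |].
    exact: measurable_cube.
  move=> x /= xr i; rewrite -ler_norml (le_trans (mx_norm_coord _ _))//.
  exact: le_trans (mx_norm_le_enorm _) xr.
by rewrite leb_cube ?ltry// (le_trans _ r0)// oppr_le0.
Qed.

Lemma leb_eball_gt0 m (r : R) : 0 < r -> (0 < leb m (eball r))%E.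
Proof.
(* A cube of half-side [e] lies in the ball of radius [m * e]; the denominator [m.+1] keeps [e]
   positive in dimension 0. *)
move=> r0; pose e := r / m.+1%:R.
have e0 : 0 < e by rewrite divr_gt0.
have e0' : - e <= e by rewrite (le_trans _ (ltW e0))// oppr_le0 ltW.
apply: (@lt_le_trans _ _ (leb m [set v | forall i, - e <= v 0 i <= e])).
  by rewrite leb_cube// lte_fin exprn_gt0// opprK addr_gt0.
apply: le_measure; rewrite ?inE; [exact: measurable_cube|exact: measurable_eball|].
move=> x /= xe; apply: (le_trans (enorm_le_mx_norm _)).
apply: (@le_trans _ _ (m%:R * e)).
  rewrite ler_wpM2l//; apply: mx_norm_leP; first exact: ltW.
  by move=> i; rewrite ler_norml.
by rewrite /e mulrCA ler_piMr ?(ltW r0)// ler_pdivrMr// mul1r ler_nat.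
Qed.

Local Open Scope ereal_scope.

Lemma measure_sections d1 d2 (T1 : measurableType d1) (T2 : measurableType d2)
  (m1 : {sigma_finite_measure set T1 -> \bar R})
  (m2 : {sigma_finite_measure set T2 -> \bar R}) (S : set (T1 * T2)) :
  measurable S ->
  \int[m1]_x m2 [set y | S (x, y)] = \int[m2]_y m1 [set x | S (x, y)].
Proof.
move=> mS; have := indic_fubini_tonelli m1 m2 mS.
rewrite indic_fubini_tonelli_FE// indic_fubini_tonelli_GE//.
move=> h; transitivity (\int[m1]_x (m2 \o xsection S) x); last rewrite h.
  by apply: eq_integral => x _ /=; congr (m2 _); apply/seteqP; split=> y; rewrite /xsection/= inE.
by apply: eq_integral => y _ /=; congr (m1 _); apply/seteqP; split=> x; rewrite /ysection/= inE.
Qed.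

Lemma leb_translate m (b : 'rV[R]_m) (A : set 'rV[R]_m) : measurable A ->
  leb m [set v | A (v + b)%R] = leb m A.
Proof.
move=> mA; rewrite -[RHS](leb_affine b ltr01 mA) expr1n mul1e; congr (leb m _).
by apply/seteqP; split=> v /=; rewrite scale1r.
Qed.

(* Haar-type argument: the measure of [{(x, y) | x + y Q in A, |y| <= 1}] is
   [|A| |B|] by translation in [x], and, after translating [y] by [- x Q^T], it is
   [|A Q^-1| |B|], because [Q] preserves the unit ball [B]. *)
Lemma leb_mulmx_orthogonal m (Q : 'M[R]_m) (A : set 'rV[R]_m) :
  (Q *m Q^T = 1%:M)%R -> measurable A -> leb m [set y | A (y *m Q)] = leb m A.
Proof.
move=> QQ mA; have QQ' : (Q^T *m Q = 1%:M)%R by exact: mulmx1C.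
pose B := eball 1 : set 'rV[R]_m.
have mB : measurable B by exact: measurable_eball.
have mphi : measurable_fun setT
    (fun p : 'rV[R]_m * 'rV[R]_m => p.1 + p.2 *m Q)%R.
  apply: measurable_addrV; first exact: measurable_fst.
  exact: (measurableT_comp (measurable_mulmxr Q) measurable_snd).
pose S := [set p : 'rV[R]_m * 'rV[R]_m | A (p.1 + p.2 *m Q)%R /\ B p.2].
have mS : measurable S.
  apply: measurableI.
    by rewrite -[X in measurable X]setTI; exact: mphi.
  by rewrite -[X in measurable X]setTI; exact: measurable_snd.
have mphi' : measurable_fun setT
    (fun p : 'rV[R]_m * 'rV[R]_m => p.2 - p.1 *m Q^T)%R.
  apply: measurable_addrV; first exact: measurable_snd.
  rewrite (_ : (fun _ => _) = fun p : 'rV[R]_m * 'rV[R]_m => (p.1 *m - Q^T)%R); last first.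
    by apply/funext => p; rewrite mulmxN.
  exact: (measurableT_comp (measurable_mulmxr (- Q^T)%R) measurable_fst).
pose S' := [set p : 'rV[R]_m * 'rV[R]_m | A (p.2 *m Q)%R /\ B (p.2 - p.1 *m Q^T)%R].
have mS' : measurable S'.
  apply: measurableI.
    rewrite -[X in measurable X]setTI.
    exact: (measurableT_comp (measurable_mulmxr Q) measurable_snd).
  by rewrite -[X in measurable X]setTI; exact: mphi'.
have := measure_sections (leb m) (leb m) mS.
have -> : \int[leb m]_y leb m [set x | S (x, y)] = leb m A * leb m B.
  transitivity (\int[leb m]_(y in B) leb m A).
    rewrite [RHS]integral_mkcond; apply: eq_integral => y _; rewrite patchE.
    case: ifPn => [/set_mem By|/negP nBy].
      rewrite -[RHS](leb_translate (y *m Q)%R mA); congr (leb m _).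
      by apply/seteqP; split=> x /=; rewrite /S/=; tauto.
    rewrite (_ : [set _ | _] = set0) ?measure0//.
    by rewrite -subset0 => x [_ /mem_set].
  by rewrite integral_cst.
have -> : \int[leb m]_x leb m [set y | S (x, y)] =
          \int[leb m]_x leb m [set y | S' (x, y)].
  apply: eq_integral => x _.
  have mSx : measurable [set y | S (x, y)].
    by rewrite -[X in measurable X]setTI; exact: (measurable_pair1 x).
  rewrite -(leb_translate (- (x *m Q^T))%R mSx); congr (leb m _).
  apply/seteqP; split=> y /=; rewrite /S /S'/= mulmxBl -mulmxA QQ' mulmx1 addrCA subrr addr0//.
rewrite (measure_sections (leb m) (leb m) mS').
have -> : \int[leb m]_y leb m [set x | S' (x, y)] = leb m [set y | A (y *m Q)%R] * leb m B.
  transitivity (\int[leb m]_(y in [set y | A (y *m Q)%R]) leb m B).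
    rewrite [RHS]integral_mkcond; apply: eq_integral => y _; rewrite patchE.
    case: ifPn => [/set_mem/= Ay|/negP nAy].
      rewrite -[RHS](leb_translate (- (y *m Q))%R mB); congr (leb m _).
      have enormN (z : 'rV[R]_m) : enorm (- z)%R = enorm z.
        by rewrite /enorm -scaleN1r dotZl dotZr mulrA mulrNN mulr1 mul1r.
      have QE (x : 'rV[R]_m) : enorm (y - x *m Q^T)%R = enorm (x - y *m Q)%R.
        rewrite -[in LHS](enorm_isom (E := Q))// mulmxBl -mulmxA QQ' mulmx1.
        by rewrite -opprB enormN.
      by apply/seteqP; split=> x /=; rewrite /S'/= /B/eball/= QE; tauto.
    rewrite (_ : [set _ | _] = set0) ?measure0//.
    by rewrite -subset0 => x [/mem_set].
  by rewrite integral_cst; [exact: muleC|exact: measurable_preimage_mulmxr].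
have Bfin : leb m B \is a fin_num by rewrite ge0_fin_numE// leb_eball_lty.
have B0 : (0 < fine (leb m B))%R.
  by rewrite fine_gt0// leb_eball_lty leb_eball_gt0.
rewrite -(fineK Bfin) => /esym h.
have := congr1 (fun z => z * ((fine (leb m B))^-1)%:E) h.
by rewrite -!muleA -!EFinM mulfV ?gt_eqF// !mule1 => ->.
Qed.

End leb_orthogonal.

(** * Orthonormal frames and slicing *)

Section frames.
Context {R : realType}.

(** Gram-Schmidt by induction on the number of missing vectors: a rank count gives a nonzero vector
    orthogonal to the rows of [W], which is normalized and appended to [W]. *)
Lemma orthonormal_complement i k N (W : 'M[R]_(k, N)) : (k + i)%N = N ->
  W *m W^T = 1%:M ->
  exists E : 'M[R]_(i, N), E *m E^T = 1%:M /\ W *m E^T = 0.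
Proof.
elim: i => [|i IH] in k W *; move=> kiN WW.
  by exists 0; split; apply/matrixP => -[]//= ? ? [].
have : kermx W^T != 0.
  rewrite -mxrank_eq0 mxrank_ker -lt0n subn_gt0.
  by rewrite (leq_ltn_trans (rank_leq_col _))// -kiN addnS ltnS leq_addr.
move=> /rowV0Pn[v /sub_kermxP vW v0].
pose e := (enorm v)^-1 *: v.
have ee : e *m e^T = 1%:M.
  rewrite [LHS]mx11_scalar -/(dot e e) dotZl dotZr -enorm_sqr mulrA -expr2.
  by rewrite -exprMn mulVf ?expr1n// enorm_eq0.
have eW : e *m W^T = 0 by rewrite -scalemxAl vW scaler0.
have We : W *m e^T = 0 by rewrite -[W]trmxK -trmx_mul eW trmx0.
have kiN' : (k + 1 + i)%N = N by rewrite -kiN addn1 addSnnS.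
have QQ : col_mx W e *m (col_mx W e)^T = 1%:M.
  by rewrite tr_col_mx mul_col_row WW We eW ee -scalar_mx_block.
have [E [EE WE]] := IH _ _ kiN' QQ.
move: WE; rewrite mul_col_mx -[0]vsubmxK => /eq_col_mx[].
rewrite /usubmx /dsubmx => WE eE.
have {}WE : W *m E^T = 0 by rewrite WE; apply/matrixP => a b; rewrite !mxE.
have {}eE : e *m E^T = 0 by rewrite eE; apply/matrixP => a b; rewrite !mxE.
suff : let F := col_mx e E in F *m F^T = 1%:M /\ W *m F^T = 0.
  by move=> h; exists (col_mx e E).
split.
  rewrite tr_col_mx mul_col_row ee EE eE -[E *m _]trmxK trmx_mul trmxK eE trmx0.
  by rewrite -scalar_mx_block.
by rewrite tr_col_mx mul_mx_row We WE row_mx0.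
Qed.

Lemma col_mx_orthogonal k i N (W : 'M[R]_(k, N)) (E : 'M[R]_(i, N)) :
  W *m W^T = 1%:M -> E *m E^T = 1%:M -> W *m E^T = 0 ->
  col_mx W E *m (col_mx W E)^T = 1%:M.
Proof.
move=> WW EE WE.
have EW : E *m W^T = 0 by rewrite -[E]trmxK -trmx_mul WE trmx0.
by rewrite tr_col_mx mul_col_row WW EE WE EW -scalar_mx_block.
Qed.

(** A square matrix with orthonormal rows has orthonormal columns, so [W^T *m W + E^T *m E] is the
    identity. *)
Lemma frame_decomp k i N (W : 'M[R]_(k, N)) (E : 'M[R]_(i, N)) (x : 'rV[R]_N) :
  (k + i)%N = N -> W *m W^T = 1%:M -> E *m E^T = 1%:M -> W *m E^T = 0 ->
  x = x *m W^T *m W + x *m E^T *m E.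
Proof.
move=> kiN; case: N / kiN in W E x * => WW EE WE.
have /mulmx1C QQ := col_mx_orthogonal WW EE WE.
by rewrite -[LHS]mulmx1 -QQ tr_col_mx mul_row_col mulmxDr !mulmxA.
Qed.

(** [E0 = X *m E] for a square matrix [X], which is orthogonal because both frames are
    orthonormal. *)
Lemma leb_frame i m (A : set 'rV[R]_m) (E E0 : 'M[R]_(i, m)) :
  E0 *m E0^T = 1%:M -> E *m E^T = 1%:M -> (E0 <= E)%MS ->
  measurable [set t | A (t *m E0)] ->
  leb i [set t | A (t *m E)] = leb i [set t | A (t *m E0)].
Proof.
move=> EE0 EE /submxP[X XE] mA.
have XX : X *m X^T = 1%:M.
  by rewrite -EE0 XE trmx_mul mulmxA -(mulmxA X) EE mulmx1.
have XX' := mulmx1C XX.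
rewrite -(leb_mulmx_orthogonal (Q := X^T) _ mA) ?trmxK//; congr (leb i _).
by apply/seteqP; split=> t /=; rewrite XE !mulmxA -(mulmxA t) XX' mulmx1.
Qed.

(* [vol] reads [A] through an arbitrary frame whose span contains [A]; since [A]
   is absorbing in the span of [E0], both frames have the same span. *)
Lemma vol_frame i m (A : set 'rV[R]_m) (E0 : 'M[R]_(i, m)) :
  E0 *m E0^T = 1%:M -> (forall x, A x -> (x <= E0)%MS) ->
  (forall x : 'rV[R]_m, (x <= E0)%MS -> exists2 c, c != 0 & A (c *: x)) ->
  measurable [set t | A (t *m E0)] ->
  vol i A = leb i [set t | A (t *m E0)].
Proof.
move=> EE0 AE0 absA mA; rewrite /vol.
have [EE AE] : isom_frame A (xget 0 (@isom_frame _ i m A)).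
  by apply: xgetPex; exists E0.
apply: leb_frame => //; apply/row_subP => j.
have [c c0 Ac] := absA _ (row_sub j E0).
by have := AE _ Ac; rewrite eqmx_scale.
Qed.

End frames.

Section slicing.
Context {R : realType}.
Local Notation mu := (@lebesgue_measure R).
Local Open Scope ereal_scope.

Lemma integral_leb_orthogonal m (Q : 'M[R]_m) (f : 'rV[R]_m -> \bar R) :
  (Q *m Q^T = 1%:M)%R -> measurable_fun setT f -> (forall x, 0 <= f x) ->
  \int[leb m]_x f (x *m Q)%R = \int[leb m]_x f x.
Proof.
move=> QQ mf f0; rewrite -[LHS]mul1e.
apply: (@integral_transport _ _ _ _ _ (leb m) (leb m) (fun x => x *m Q)%R) => //.
  exact: measurable_mulmxr.
by move=> A mA; rewrite mul1e; exact: leb_mulmx_orthogonal.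
Qed.

Lemma measurable_row_mx d i :
  measurable_fun setT (fun p : 'rV[R]_d * 'rV[R]_i => row_mx p.1 p.2).
Proof.
apply: measurable_fun_rV => j; case: (split_ordP j) => a ->.
  rewrite (_ : (fun _ => _) = fun p : 'rV[R]_d * 'rV[R]_i => p.1 0%R a); last first.
    by apply/funext => p; rewrite row_mxEl.
  exact: (measurableT_comp (measurable_rV_coord a) measurable_fst).
rewrite (_ : (fun _ => _) = fun p : 'rV[R]_d * 'rV[R]_i => p.2 0%R a); last first.
  by apply/funext => p; rewrite row_mxEr.
exact: (measurableT_comp (measurable_rV_coord a) measurable_snd).
Qed.

Lemma row_mx_consrV d i (x : R) (z : 'rV[R]_d) (t : 'rV[R]_i) :
  row_mx (consrV (x, z)) t = consrV (x, row_mx z t).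
Proof.
apply/rowP => j; case: (unliftP 0%R j) => [l ->|->].
  rewrite consrVS /=; case: (split_ordP l) => a ->.
    rewrite row_mxEl (_ : lift 0 _ = lshift i (lift 0 a))%R; last exact/val_inj.
    by rewrite row_mxEl consrVS.
  rewrite row_mxEr (_ : lift 0 _ = rshift d.+1 a)%R; last exact/val_inj.
  by rewrite row_mxEr.
rewrite consrV0 (_ : 0 = lshift i 0)%R; last exact/val_inj.
by rewrite row_mxEl consrV0.
Qed.

Lemma integral_leb_add d i (f : 'rV[R]_(d + i) -> \bar R) :
  measurable_fun setT f -> (forall v, 0 <= f v) ->
  \int[leb (d + i)]_v f v = \int[leb d]_z \int[leb i]_t f (row_mx z t).
Proof.
elim: d => [|d IH] in f *; move=> mf f0.
  rewrite integral_leb0.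
    apply: eq_integral => v _; congr f; apply/rowP => j.
    have -> : j = rshift 0 j by exact/val_inj.
    by rewrite row_mxEr; congr (v _ _); exact/val_inj.
  apply: measurable_integral_leb => //.
  exact: (measurableT_comp mf (measurable_row_mx (d := 0) (i := i))).
have mfr : measurable_fun setT (fun p : 'rV[R]_d.+1 * 'rV[R]_i => f (row_mx p.1 p.2)).
  exact: (measurableT_comp mf (measurable_row_mx (d := d.+1) (i := i))).
rewrite integral_lebS//; last 2 first.
- exact: measurable_integral_leb.
- by move=> z; exact: integral_ge0.
rewrite integral_lebS//; apply: eq_integral => x _.
rewrite IH; first last.
- by move=> v; exact: f0.
- exact: (measurableT_comp mf (measurableT_comp (measurable_consrV (m := d + i))
    (measurable_pair1 _))).
apply: eq_integral => z _; apply: eq_integral => t _.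
by rewrite row_mx_consrV.
Qed.

(** The rows of [W] and [E] together form an orthogonal matrix; after rotating by it, this is Fubini
    for the splitting of coordinates. *)
Lemma integral_leb_slice d i N (W : 'M[R]_(d, N)) (E : 'M[R]_(i, N))
    (f : 'rV[R]_N -> \bar R) : (d + i)%N = N ->
  (W *m W^T = 1%:M)%R -> (E *m E^T = 1%:M)%R -> (W *m E^T = 0)%R ->
  measurable_fun setT f -> (forall v, 0 <= f v) ->
  \int[leb N]_x f x = \int[leb d]_z \int[leb i]_t f (z *m W + t *m E)%R.
Proof.
move=> diN; case: N / diN in W E f * => WW EE WE mf f0.
rewrite -(integral_leb_orthogonal (col_mx_orthogonal WW EE WE))//.
rewrite integral_leb_add; first last.
- by move=> v; exact: f0.
- exact: (measurableT_comp mf (measurable_mulmxr _)).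
by under eq_integral do under eq_integral do rewrite mul_row_col.
Qed.

End slicing.

(** * Gauges and star bodies *)

Section gauges.
Context {R : realType}.

(* [g = 1 / radial K], extended by [0] at the origin, is the gauge of [K]. *)
Definition gauge m (g : 'rV[R]_m -> R) : Prop :=
  [/\ continuous g, forall a x, 0 <= a -> g (a *: x) = a * g x
    & forall x, x != 0 -> 0 < g x].

Lemma gauge0 m (g : 'rV[R]_m -> R) : gauge g -> g 0 = 0.
Proof. by case=> _ hom _; rewrite -(scale0r 0) hom// mul0r. Qed.

Lemma gauge_ge0 m (g : 'rV[R]_m -> R) x : gauge g -> 0 <= g x.
Proof.
move=> gg; have [->|x0] := eqVneq x 0; first by rewrite gauge0.
by case: gg => _ _ /(_ _ x0)/ltW.
Qed.

Lemma gauge_enorm m : gauge (@enorm R m).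
Proof.
split=> [|a x|x]; [exact: continuous_enorm|exact: enormZ|].
by rewrite enorm_gt0.
Qed.

Lemma closed_mx_norm_ball m (r : R) : closed [set x : 'rV[R]_m | `|x| <= r].
Proof.
have /continuous_closedP h := @norm_continuous _ 'rV[R]_m.
exact: (h _ (@closed_le _ r)).
Qed.

Lemma compact_mx_norm_ball m (r : R) : compact [set x : 'rV[R]_m | `|x| <= r].
Proof.
apply: bounded_closed_compact; last exact: closed_mx_norm_ball.
exists r; split; first exact: num_real.
by move=> M rM x /= /le_trans; apply; exact: ltW.
Qed.

Lemma compact_mx_norm_sphere m (r : R) : compact [set x : 'rV[R]_m | `|x| = r].
Proof.
apply: (subclosed_compact _ (compact_mx_norm_ball (m := m) (r := r))).
  have /continuous_closedP h := @norm_continuous _ 'rV[R]_m.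
  exact: (h _ (@closed_eq _ r)).
by move=> x /= ->.
Qed.

Lemma hom_normalize m (g : 'rV[R]_m -> R) x :
  (forall a x, 0 <= a -> g (a *: x) = a * g x) ->
  g x = `|x| * g (`|x|^-1 *: x).
Proof.
move=> hom; rewrite -hom// scalerA; have [->|x0] := eqVneq x 0; first by rewrite scaler0.
by rewrite mulfV ?normr_eq0// scale1r.
Qed.

Lemma gauge_norm_le m (g : 'rV[R]_m -> R) : gauge g ->
  exists2 b, 0 < b & forall x, g x <= b * `|x|.
Proof.
move=> gg; have [cg hom pos] := gg.
have [c c1 cmax] : exists2 c, c \in [set x : 'rV[R]_m | `|x| <= 1] &
    forall t, t \in [set x : 'rV[R]_m | `|x| <= 1] -> g t <= g c.
  apply: EVT_max_rV; [by exists 0; rewrite /= normr0|exact: compact_mx_norm_ball|].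
  exact: continuous_subspaceT.
(* The summand 1 keeps the constant positive in dimension 0, where [g] vanishes. *)
exists (g c + 1) => [|x]; first by rewrite ltr_wpDl// gauge_ge0.
have [->|x0] := eqVneq x 0; first by rewrite (gauge0 gg) normr0 mulr0.
rewrite (hom_normalize x hom) mulrC ler_wpM2r//.
rewrite (le_trans (cmax _ _)) ?lerDl// inE/= normrZ normfV normr_id mulVf//.
by rewrite normr_eq0.
Qed.

Lemma gauge_norm_ge m (g : 'rV[R]_m -> R) : gauge g ->
  exists2 a, 0 < a & forall x, a * `|x| <= g x.
Proof.
move=> gg; have [cg hom pos] := gg.
(* In dimension 0 the sphere is empty and there is no minimum to take. *)
have [S0|/nonemptyPn S0] := pselect ([set x : 'rV[R]_m | `|x| = 1] !=set0); last first.
  exists 1 => // x; have [->|x0] := eqVneq x 0; first by rewrite normr0 mulr0 (gauge0 gg).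
  suff : [set x : 'rV[R]_m | `|x| = 1] (`|x|^-1 *: x) by rewrite S0.
  by rewrite /= normrZ normfV normr_id mulVf// normr_eq0.
have [c] : exists2 c, c \in [set x : 'rV[R]_m | `|x| = 1] &
    forall t, t \in [set x : 'rV[R]_m | `|x| = 1] -> g c <= g t.
  apply: EVT_min_rV => //; first exact: compact_mx_norm_sphere.
  exact: continuous_subspaceT.
rewrite inE/= => c1 cmin.
exists (g c) => [|x]; first by rewrite pos// -normr_eq0 c1 oner_eq0.
have [->|x0] := eqVneq x 0; first by rewrite (gauge0 gg) normr0 mulr0.
rewrite (hom_normalize x hom) mulrC ler_wpM2l//.
by rewrite cmin// inE/= normrZ normfV normr_id mulVf// normr_eq0.
Qed.

(** Heine-Cantor with only [x] confined to the compact ball: the property of a radius [d] near 0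
    holds locally at every point, and compactness makes it hold for one [d]. *)
Lemma gauge_uniform m (g : 'rV[R]_m -> R) (M e : R) : continuous g -> 0 < e ->
  exists2 d, 0 < d & forall x y, `|x| <= M -> `|x - y| < d -> `|g x - g y| <= e.
Proof.
move=> cg e0.
have /compact_near_coveringP := compact_mx_norm_ball (m := m) (r := M).
move=> /(_ R 0^'+ (fun d x => forall y, `|x - y| < d -> `|g x - g y| <= e)).
move=> /(_ _)[|d0 /= d00 h].
- move=> x _; have /cvgrPdist_lt/(_ (e / 2)) := cg x.
  rewrite divr_gt0// => /(_ isT)/nbhs_ballP[r/= r0 hr].
  exists (ball x (r / 2), [set d | d < r / 2]) => /=.
    split; first by apply: nbhsx_ballx; rewrite divr_gt0.
    by apply: nbhs_right_lt; rewrite divr_gt0.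
  move=> [z d]/= [xz dr] y zy.
  have {xz}xz : `|x - z| < r / 2 by move: xz; rewrite -ball_normE.
  rewrite (le_trans (ler_distD (g x) _ _))// (splitr e) lerD//.
    rewrite distrC ltW//; apply: hr; rewrite -ball_normE/= (lt_trans xz)//.
    by rewrite ltr_pdivrMr// ltr_pMr// ltr1n.
  apply/ltW/hr; rewrite -ball_normE/= (le_lt_trans (ler_distD z _ _))//.
  by rewrite (splitr r) ltrD// (lt_trans zy).
- exists (d0 / 2); first by rewrite divr_gt0.
  move=> x y xM xy; apply: (h (d0 / 2)) => //=.
  + by rewrite sub0r normrN gtr0_norm ?divr_gt0// ltr_pdivrMr// ltr_pMr// ltr1n.
  + by rewrite divr_gt0.
Qed.

(** If [|x - y|] is small against [|x|], scaling to [|x| = 1] reduces to uniform continuity, and the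
    error is absorbed into [e * g x] because [g x >= a * |x|]. Otherwise [|y|], and with it [g y],
    is at most a multiple of [|x - y|]. *)
Lemma gauge_perturb m (g : 'rV[R]_m -> R) (e : R) : gauge g -> 0 < e ->
  exists2 D, 0 < D & forall x y, g y <= (1 + e) * g x + D * `|x - y|.
Proof.
move=> gg e0; have [cg hom pos] := gg.
have [a a0 ag] := gauge_norm_ge gg; have [b b0 gb] := gauge_norm_le gg.
have [d d0 gd] : exists2 d, 0 < d &
    forall x y, `|x| <= 1 -> `|x - y| < d -> `|g x - g y| <= e * a.
  by apply: gauge_uniform => //; rewrite mulr_gt0.
exists (b * (d^-1 + 1)) => [|x y].
  by rewrite mulr_gt0// ltr_wpDl// invr_ge0 ltW.
have e1 : 0 <= 1 + e by rewrite addr_ge0// ltW.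
have yxy : `|y| <= `|x| + `|x - y|.
  by rewrite distrC -lerBlDl; exact: lerB_dist.
have [xs|xs] := ltP `|x - y| (d * `|x|); last first.
  apply: ler_wpDl; first by rewrite mulr_ge0// gauge_ge0.
  rewrite (le_trans (gb _))// -mulrA ler_pM2l// (le_trans yxy)//.
  by rewrite mulrDl mul1r lerD2r ler_pdivlMl.
have x0 : 0 < `|x|.
  by rewrite -(pmulr_rgt0 _ d0) (le_lt_trans _ xs).
apply: ler_wpDr; first by rewrite !mulr_ge0// ?addr_ge0// ?invr_ge0 ltW.
have h z : g z = `|x| * g (`|x|^-1 *: z).
  by rewrite hom ?invr_ge0// mulrA mulfV ?mul1r// gt_eqF.
have nx1 : `| `|x|^-1 *: x| = 1 by rewrite normrZ normfV normr_id mulVf// gt_eqF.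
rewrite (h y) (h x) mulrCA ler_pM2l//.
have := gd (`|x|^-1 *: x) (`|x|^-1 *: y).
rewrite nx1 -scalerBr normrZ normfV normr_id lexx => /(_ isT).
rewrite mulrC ltr_pdivrMr// => /(_ xs); rewrite distrC => /(le_trans (ler_norm _)).
rewrite lerBlDr => /le_trans; apply.
rewrite mulrDl mul1r addrC lerD2l ler_pM2l// (le_trans _ (ag _))//.
by rewrite nx1 mulr1.
Qed.

(* Closeness is asked in the multiplicative form that comparison of volumes
   provides; on the sphere it amounts to uniform continuity. *)
Lemma gauge_mult m (g : 'rV[R]_m -> R) (M : R) :
  (forall a x, 0 <= a -> g (a *: x) = a * g x) ->
  (forall x, x != 0 -> 0 < g x) ->
  (forall u, enorm u = 1 -> g u <= M) ->
  (forall e, 0 < e -> exists2 d, 0 < d & forall u v, enorm u = 1 -> enorm v = 1 ->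
    `|u - v| < d -> g v <= (1 + e) * g u) ->
  gauge g.
Proof.
move=> hom pos gM gmult; split=> // x.
have hom' (y : 'rV[R]_m) : g y = enorm y * g ((enorm y)^-1 *: y).
  rewrite -hom ?enorm_ge0// scalerA; have [->|y0] := eqVneq y 0; first by rewrite scaler0.
  by rewrite mulfV ?enorm_eq0// scale1r.
have unit (y : 'rV[R]_m) : y != 0 -> enorm ((enorm y)^-1 *: y) = 1.
  by move=> y0; rewrite enormZ ?invr_ge0 ?enorm_ge0// mulVf// enorm_eq0.
have g0 : g 0 = 0 by rewrite -(scale0r 0) hom// mul0r.
have gpos y : 0 <= g y by have [->|/pos/ltW//] := eqVneq y 0; rewrite g0.
(* At the origin continuity comes from homogeneity and the bound on the sphere; elsewhere [g] is the
   norm times its value at the normalized point. *)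
have [->|x0] := eqVneq x 0.
  have M0 : 0 < `|M| + 1 by rewrite ltr_wpDl.
  apply/(@cvgrPdist_lt _ _ _ (nbhs (0 : 'rV[R]_m)) (nbhs_filter _)) => e e0; rewrite g0.
  have : enorm y @[y --> (0 : 'rV[R]_m)] --> enorm (0 : 'rV[R]_m) by exact: continuous_enorm.
  move/cvgrPdist_lt => /(_ (e / (`|M| + 1))); rewrite divr_gt0// => /(_ isT) h.
  near=> y; have : `|enorm (0 : 'rV[R]_m) - enorm y| < e / (`|M| + 1) by near: y.
  rewrite enorm0 !sub0r !normrN (ger0_norm (enorm_ge0 _)) (ger0_norm (gpos _)).
  rewrite ltr_pdivlMr// => /le_lt_trans; apply.
  have [->|y0] := eqVneq y 0; first by rewrite g0 enorm0 mul0r.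
  rewrite hom' ler_wpM2l ?enorm_ge0// (le_trans (gM _ (unit _ y0)))//.
  by rewrite (le_trans (ler_norm M))// lerDl.
have -> : g = fun y => enorm y * g ((enorm y)^-1 *: y) by apply/funext.
apply: continuousM; first exact: continuous_enorm.
have cn : {for x, continuous (fun y : 'rV[R]_m => (enorm y)^-1 *: y)}.
  apply: (@continuousZ _ _ _ (fun y : 'rV[R]_m => (enorm y)^-1) id) => //.
  apply: continuousV; last exact: continuous_enorm.
  by rewrite enorm_eq0.
have ux := unit _ x0; have M0 : 0 < M.
  by rewrite (lt_le_trans _ (gM _ ux))// pos// -enorm_eq0 ux oner_eq0.
apply/(@cvgrPdist_lt _ _ _ (nbhs x) (nbhs_filter _)) => e e0.
(* As [g <= M] on the sphere, a relative error [e / (2 * M)] is an absolute error below [e]; the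
   estimate is used with both orders of the two points. *)
have [d d0 hd] := gmult (e / (2 * M)) ltac:(by rewrite divr_gt0// mulr_gt0).
have nx0 : \forall y \near x, y != 0.
  have : enorm y @[y --> x] --> enorm x by exact: continuous_enorm.
  move=> /cvgrPdist_lt/(_ (enorm x)); rewrite enorm_gt0 => /(_ x0) h.
  near=> y; have : `|enorm x - enorm y| < enorm x by near: y.
  apply: contraTneq => ->.
  by rewrite enorm0 subr0 ger0_norm ?ltxx// enorm_ge0.
move/cvgrPdist_lt : cn => /(_ _ d0) cn.
near=> y.
have uy : enorm ((enorm y)^-1 *: y) = 1 by apply: unit; near: y.
have xy : `|(enorm x)^-1 *: x - (enorm y)^-1 *: y| < d by near: y.
have h1 := hd _ _ ux uy xy.
rewrite distrC in xy; have h2 := hd _ _ uy ux xy.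
have h3 u : enorm u = 1 -> e / (2 * M) * g u < e.
  move=> /gM uM; rewrite (@le_lt_trans _ _ (e / (2 * M) * M))//.
    by rewrite ler_pM2l// divr_gt0// mulr_gt0.
  rewrite (_ : e / (2 * M) * M = e / 2); last by field; rewrite gt_eqF.
  by rewrite ltr_pdivrMr// ltr_pMr// ltr1n.
have := h3 _ ux; have := h3 _ uy; move: h1 h2; rewrite !mulrDl !mul1r.
move: (g _) (g _) (_ * g _) (_ * g _) => a b c f.
by rewrite ltr_norml; lra.
Unshelve. all: by end_near.
Qed.

End gauges.

Section star_bodies.
Context {R : realType}.

Definition gbody m (g : 'rV[R]_m -> R) : set 'rV[R]_m := [set x | g x <= 1].

Lemma exists_unit m : (0 < m)%N -> exists u : 'rV[R]_m, enorm u = 1.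
Proof.
move=> m0; pose x : 'rV[R]_m := const_mx 1.
have x0 : enorm x != 0.
  rewrite enorm_eq0; apply/eqP => /rowP/(_ (Ordinal m0)); rewrite !mxE.
  by move/eqP; rewrite oner_eq0.
exists ((enorm x)^-1 *: x).
by rewrite enormZ ?invr_ge0 ?enorm_ge0// mulVf.
Qed.

Lemma closed_gbody m (g : 'rV[R]_m -> R) : gauge g -> closed (gbody g).
Proof.
by case=> /continuous_closedP h _ _; exact: (h _ (@closed_le _ 1)).
Qed.

Lemma compact_gbody m (g : 'rV[R]_m -> R) : gauge g -> compact (gbody g).
Proof.
move=> gg; have [a a0 ag] := gauge_norm_ge gg.
apply: (subclosed_compact (closed_gbody gg) (compact_mx_norm_ball (m := m) (r := a^-1))).
move=> x gx /=; rewrite -(ler_pM2l a0) mulfV ?gt_eqF//.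
exact: le_trans (ag x) gx.
Qed.

Lemma radial_gbody m (g : 'rV[R]_m -> R) u : gauge g ->
  radial (gbody g) u = (g u)^-1.
Proof.
move=> gg; have [_ hom pos] := gg; rewrite /radial.
have [->|u0] := eqVneq u 0.
  rewrite (gauge0 gg) invr0 sup_out// => -[_ [b bub]].
  suff : `|b| + 1 <= b by rewrite leNgt (le_lt_trans (ler_norm _))// ltrDl.
  by apply: bub; rewrite /= scaler0 /gbody/= (gauge0 gg) ler01 addr_ge0.
rewrite (_ : [set _ | _] = `[0, (g u)^-1]%classic) ?sup_itvcc//.
  by rewrite invr_ge0 gauge_ge0.
apply/seteqP; split=> l /=; rewrite /gbody/= in_itv/=.
  by move=> [l0]; rewrite hom// -ler_pdivlMr ?pos// div1r => ->; rewrite l0.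
by move=> /andP[l0]; rewrite hom// -[(g u)^-1]div1r ler_pdivlMr ?pos.
Qed.

Lemma star_body_gbody m (g : 'rV[R]_m -> R) : gauge g -> star_body (gbody g).
Proof.
move=> gg; have [cg hom pos] := gg; split.
- exact: compact_gbody.
- move=> x t gx /andP[t0 t1]; rewrite /gbody/= hom//.
  by rewrite (le_trans (ler_wpM2l t0 gx))// mulr1.
- by move=> u u0; rewrite radial_gbody// invr_gt0 pos.
- move=> u u0; rewrite (_ : radial _ = fun u => (g u)^-1); last first.
    by apply/funext => v; exact: radial_gbody.
  by apply: continuousV; [rewrite gt_eqF// pos|exact: cg].
Qed.

Lemma body_of_radialE m (r g : 'rV[R]_m -> R) : (0 < m)%N -> gauge g ->
  (forall u, enorm u = 1 -> r u = (g u)^-1) -> body_of_radial r = gbody g.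
Proof.
move=> m0 gg rg; have [_ hom pos] := gg; apply/seteqP; split=> [_ [u [l [u1 /andP[l0 lr] ->]]]|x gx].
  have u0 : u != 0 by rewrite -enorm_eq0 u1 oner_eq0.
  rewrite /gbody/= hom//; move: lr; rewrite rg// -[(g u)^-1]div1r ler_pdivlMr ?pos//.
have [->|x0] := eqVneq x 0.
  have [u u1] := exists_unit m0; exists u, 0; split=> //; last by rewrite scale0r.
  by rewrite lexx rg// invr_ge0 gauge_ge0.
have x1 : enorm ((enorm x)^-1 *: x) = 1.
  by rewrite enormZ ?invr_ge0 ?enorm_ge0// mulVf// enorm_eq0.
exists ((enorm x)^-1 *: x), (enorm x); split=> //.
  rewrite enorm_ge0 rg// hom ?invr_ge0 ?enorm_ge0// invfM invrK.
  by rewrite ler_pMr ?enorm_gt0// invf_ge1 ?pos.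
by rewrite scalerA mulfV ?scale1r// enorm_eq0.
Qed.

(** Star-shapedness makes the scalars [l] with [l *: x] in [K] an interval starting at 0, and
    closedness puts its end point in the interval; hence [K] is the sublevel set of the reciprocal
    of its radial function. Continuity of the gauge at 0 follows from homogeneity and a bound on the
    unit sphere of the sup norm. *)
Lemma star_body_gauge m (K : set 'rV[R]_m) : (0 < m)%N -> star_body K ->
  exists2 g, gauge g & K = gbody g.
Proof.
move=> m0 [cK sK pos crad].
have K0 : K 0.
  have [u u1] := exists_unit m0.
  have u0 : u != 0 by rewrite -enorm_eq0 u1 oner_eq0.
  have [|/nonemptyPn S0] := pselect ([set l : R | 0 <= l /\ K (l *: u)] !=set0).
    by move=> [l [l0 Kl]]; rewrite -(scale0r (l *: u)); apply: sK; rewrite ?lexx ?ler01.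
  by have := pos _ u0; rewrite /radial S0 sup0 ltxx.
have clK : closed K by apply: compact_closed => //; exact: norm_hausdorff.
have [M M0 KM] : exists2 M, 0 < M & forall x, K x -> `|x| < M.
  by have /ex_strict_bound_gt0[M M0 KM] := compact_bounded cK; exists M.
pose S x := [set l : R | 0 <= l /\ K (l *: x)].
have supS x : x != 0 -> has_sup (S x).
  move=> x0; split; first by exists 0; split=> //; rewrite scale0r.
  exists (M / `|x|) => l [l0 /KM]; rewrite normrZ ger0_norm// => /ltW.
  by rewrite -ler_pdivlMr// normr_gt0.
have Sle x a b : S x b -> 0 <= a -> a <= b -> S x a.
  move=> [b0 Kb] a0 ab; split=> //; move: ab; rewrite le_eqVlt => /orP[/eqP->//|ab].
  have b1 : 0 < b by exact: le_lt_trans ab.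
  rewrite (_ : a *: x = (a / b) *: (b *: x)).
    by apply: sK => //; rewrite divr_ge0//= ler_pdivrMr// mul1r ltW.
  by rewrite scalerA mulfVK ?gt_eqF.
have KE x : x != 0 -> K x <-> 1 <= radial K x.
  move=> x0; split=> [Kx|rx].
    by apply: (sup_upper_bound (supS _ x0)); split; rewrite ?scale1r.
  have cl : l *: x @[l --> (1 : R)] --> x.
    by rewrite -[X in _ --> X]scale1r; apply: cvgZ; [exact: cvg_id|exact: cvg_cst].
  apply: clK => B Bx; have /nbhs_ballP[r/= r0 rB] := cl _ Bx.
  (* Slightly below 1, hence strictly below [radial K x], so that [l *: x] lies in [K]; the points
     [l *: x] approach [x]. *)
  pose l := Num.max (1 - r / 2) 0.
  have r2 : 0 < r / 2 by rewrite divr_gt0.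
  exists (l *: x); split; last first.
    apply: rB; rewrite /ball/= ltr_distlC.
    rewrite (_ : l < 1 + r); last by rewrite /l gt_max; apply/andP; split; lra.
    by rewrite /l lt_max; apply/andP; split=> //; apply/orP; left; lra.
  suff : S x l by case.
  have l1 : l < radial K x.
    by apply: lt_le_trans rx; rewrite /l gt_max ltr01 andbT; lra.
  have [b Sb lb] := sup_gt (proj1 (supS _ x0)) l1.
  by apply: Sle Sb _ (ltW lb); rewrite /l le_max lexx orbT.
have homr x a : x != 0 -> 0 < a -> radial K (a *: x) = a^-1 * radial K x.
  have le y c : y != 0 -> 0 < c -> radial K (c *: y) <= c^-1 * radial K y.
    move=> y0 c0; apply: ge_sup.
      by have [] := supS (c *: y); rewrite ?scaler_eq0 ?negb_or ?y0 ?(gt_eqF c0).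
    move=> l [l0]; rewrite scalerA => Kl.
    rewrite ler_pdivlMl// mulrC; apply: (sup_upper_bound (supS _ y0)).
    by split=> //; rewrite mulr_ge0// ltW.
  move=> x0 a0; apply/eqP; rewrite eq_le le//= ler_pdivrMl//.
  rewrite -[X in X <= _](_ : radial K (a^-1 *: (a *: x)) = _); last first.
    by rewrite scalerA mulVf ?gt_eqF// scale1r.
  rewrite (le_trans (le _ _ _ _)) ?invr_gt0 ?invrK//.
  by rewrite scaler_eq0 negb_or x0 gt_eqF.
have r0 : radial K 0 = 0.
  rewrite /radial sup_out// => -[_ [b bub]].
  suff : `|b| + 1 <= b by rewrite leNgt (le_lt_trans (ler_norm _))// ltrDl.
  by apply: bub; rewrite /= scaler0 addr_ge0.
pose g x := (radial K x)^-1.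
have hom a x : 0 <= a -> g (a *: x) = a * g x.
  rewrite le_eqVlt => /orP[/eqP<-|a0]; first by rewrite scale0r /g r0 invr0 mul0r.
  have [->|x0] := eqVneq x 0; first by rewrite scaler0 /g r0 invr0 mulr0.
  by rewrite /g homr// invfM invrK.
have gpos x : x != 0 -> 0 < g x by move=> x0; rewrite invr_gt0 pos.
have g0 : g 0 = 0 by rewrite /g r0 invr0.
have gge x : 0 <= g x by have [->|/gpos/ltW//] := eqVneq x 0; rewrite g0.
have cg x : x != 0 -> {for x, continuous g}.
  by move=> x0; apply: continuousV; [rewrite gt_eqF// pos|exact: crad].
have [M' gM'] : exists M', forall u, `|u| = 1 -> g u <= M'.
  have [S0|S0] := pselect ([set x : 'rV[R]_m | `|x| = 1] !=set0); last first.
    by exists 0 => u u1; case: S0; exists u.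
  have [c c1 cmax] : exists2 c, c \in [set x : 'rV[R]_m | `|x| = 1] &
      forall t, t \in [set x : 'rV[R]_m | `|x| = 1] -> g t <= g c.
    apply: EVT_max_rV => //; first exact: compact_mx_norm_sphere.
    apply: continuous_in_subspaceT => x; rewrite inE/= => x1; apply: cg.
    by rewrite -normr_eq0 x1 oner_eq0.
  by exists (g c) => u u1; apply: cmax; rewrite inE.
exists g; last first.
  apply/seteqP; split=> x; rewrite /gbody/=.
    have [->|x0] := eqVneq x 0; first by rewrite g0.
    by rewrite /g invf_le1 ?pos// => /KE; exact.
  have [->//|x0] := eqVneq x 0.
  by rewrite /g invf_le1 ?pos// => /KE; exact.
split=> // x; have [->|/cg//] := eqVneq x 0.
have M0' : 0 < `|M'| + 1 by rewrite ltr_wpDl.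
apply/(@cvgrPdist_lt _ _ _ (nbhs (0 : 'rV[R]_m)) (nbhs_filter _)) => e e0; rewrite g0; near=> y.
rewrite sub0r normrN ger0_norm// (hom_normalize y hom).
have [->|y0] := eqVneq y 0; first by rewrite normr0 mul0r.
apply: (@le_lt_trans _ _ (`|y| * (`|M'| + 1))).
  apply: ler_wpM2l => //; apply: (@le_trans _ _ M').
    by apply: gM'; rewrite normrZ normfV normr_id mulVf// normr_eq0.
  by rewrite (le_trans (ler_norm M'))// lerDl.
rewrite -ltr_pdivlMr//; near: y.
have e2 : 0 < e / (`|M'| + 1) by rewrite divr_gt0.
have /cvgrPdist_lt/(_ _ e2) := @norm_continuous _ 'rV[R]_m 0.
move=> h; near=> y; have : `| `|0 : 'rV[R]_m| - `|y| | < e / (`|M'| + 1) by near: y.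
by rewrite normr0 sub0r normrN normr_id.
Unshelve. all: by end_near.
Qed.

End star_bodies.

(** * Volume in polar coordinates *)

Section polar.
Context {R : realType}.
Local Notation mu := (@lebesgue_measure R).
Local Notation mR := (measurableTypeR R).

Lemma measurable_gauge m (g : 'rV[R]_m -> R) : gauge g -> measurable_fun setT g.
Proof. by case=> cg _ _; exact: continuous_measurable_rV. Qed.

Lemma measurable_gbody m (g : 'rV[R]_m -> R) : gauge g -> measurable (gbody g).
Proof. by move=> gg; apply: closed_measurable_rV; exact: closed_gbody. Qed.

Lemma measurable_gaugeV m (g : 'rV[R]_m -> R) : gauge g ->
  measurable_fun setT (fun x => (g x)^-1).
Proof.
move=> gg; rewrite (_ : (fun _ => _) = fun x => g x `^ (-1)); last first.
  by apply/funext => x; rewrite powR_inv1// gauge_ge0.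
exact: (measurableT_comp (measurable_powR (-1)) (measurable_gauge gg)).
Qed.

Lemma measurable_affine_R (a b : R) :
  measurable_fun setT (fun x : mR => a * x + b : mR).
Proof. by apply: measurable_funD => //; exact: measurable_funM. Qed.

Lemma set0_cube m : [set (0 : 'rV[R]_m)] = [set v | forall i, 0 <= v 0 i <= 0].
Proof.
apply/seteqP; split=> [v -> i|v h]; first by rewrite mxE lexx.
by apply/rowP => i; apply/eqP; rewrite mxE eq_le andbC; exact: h.
Qed.

Lemma leb_set0 m : leb m.+1 [set (0 : 'rV[R]_m.+1)] = 0%E.
Proof. by rewrite set0_cube leb_cube// subrr expr0n. Qed.

Local Open Scope ereal_scope.

(** This is [ln 2], the mass of [[1/2, 1]] for [ds / s]; [power_mass k] is [1 / (k + 1)]. Both enter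
    as constant factors, and [radial_mass] is finally cancelled, being positive and finite. *)
Definition radial_mass : \bar R :=
  \int[mu]_s (if [&& 0 < s, s <= 1 & 1 <= 2 * s]%R then (s `^ (-1))%:E else 0).

Definition power_mass (k : nat) : \bar R :=
  \int[mu]_s (if (0 < s <= 1)%R then (s ^+ k)%:E else 0).

(** Scale invariance of [ds / s]. *)
Lemma radial_mass_scale (r : R) : (0 < r)%R ->
  \int[mu]_s (if [&& 0 < s, s <= r & r <= 2 * s]%R then (s `^ (-1))%:E else 0)
  = radial_mass.
Proof.
move=> r0.
have mf (q : R) : measurable_fun setT (fun s : R =>
    if [&& 0 < s, s <= q & q <= 2 * s]%R then (s `^ (-1))%:E else 0).
  apply: measurable_fun_ifT => //.
    apply: measurable_and; first exact: measurable_fun_ltr.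
    apply: measurable_and; first exact: measurable_fun_ler.
    by apply: measurable_fun_ler => //; exact: measurable_funM.
  by apply/measurable_EFinP; exact: measurable_powR.
rewrite -[LHS](integral_lebesgue_affine 0%R r0); last 2 first.
- exact: mf.
- by move=> s; case: ifP => // _; rewrite lee_fin powR_ge0.
rewrite -ge0_integralZl//; last 3 first.
- exact: (measurableT_comp (mf r) (measurable_affine_R _ _)).
- by move=> s _; case: ifP => // _; rewrite lee_fin powR_ge0.
- by rewrite lee_fin ltW.
apply: eq_integral => s _; rewrite addr0 pmulr_rgt0// ger_pMr// mulrCA ler_pMr//.
case: ifP => [/andP[s0 _]|_]; last by rewrite mule0.
by rewrite -EFinM powRM ?ltW// mulrA (powR_inv1 (ltW r0)) mulfV ?gt_eqF// mul1r.
Qed.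

Lemma power_mass_scale k (r : R) : (0 < r)%R ->
  \int[mu]_s (if (0 < s)%R && (s * r <= 1)%R then (s ^+ k)%:E else 0)
  = power_mass k * (r^-1 ^+ k.+1)%:E.
Proof.
move=> r0.
have mf (q : R) : measurable_fun setT (fun s : R =>
    if (0 < s)%R && (s * q <= 1)%R then (s ^+ k)%:E else 0).
  apply: measurable_fun_ifT => //.
    apply: measurable_and; first exact: measurable_fun_ltr.
    by apply: measurable_fun_ler => //; exact: measurable_funM.
  by apply/measurable_EFinP; exact: measurable_funX.
have r0' : (0 < r^-1)%R by rewrite invr_gt0.
rewrite -[LHS](integral_lebesgue_affine 0%R r0'); last 2 first.
- exact: mf.
- by move=> s; case: ifP => // /andP[s0 _]; rewrite lee_fin exprn_ge0// ltW.
rewrite exprS EFinM [RHS]muleC -muleA; congr (_ * _).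
rewrite /power_mass -ge0_integralZl//; last 3 first.
- apply: measurable_fun_ifT => //; last first.
    by apply/measurable_EFinP; exact: measurable_funX.
  apply: measurable_and; first exact: measurable_fun_ltr.
  exact: measurable_fun_ler.
- by move=> s _; case: ifP => // /andP[s0 _]; rewrite lee_fin exprn_ge0// ltW.
- by rewrite lee_fin exprn_ge0// ltW.
apply: eq_integral => s _; rewrite addr0 pmulr_rgt0// mulrAC mulVf ?gt_eqF// mul1r.
by case: ifP => _; rewrite ?mule0// exprMn EFinM.
Qed.

Lemma integral_indic_itv (a b c : R) : (a <= b)%R ->
  \int[mu]_s (if (a <= s <= b)%R then c%:E else 0) = (c * (b - a))%:E.
Proof.
move=> ab; transitivity (\int[mu]_(s in `[a, b]%classic) c%:E).
  rewrite [RHS]integral_mkcond; apply: eq_integral => s _; rewrite patchE.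
  by rewrite mem_setE in_itv.
rewrite integral_cst//= lebesgue_measure_itv/= lte_fin.
case: ltgtP ab => // -> _.
by rewrite subrr mulr0 mule0.
Qed.

Lemma measurable_if_itv (a b c : R) :
  measurable_fun setT (fun s : R => if (a <= s <= b)%R then c%:E else 0).
Proof.
by apply: measurable_fun_ifT => //; apply: measurable_and; exact: measurable_fun_ler.
Qed.

Lemma measurable_radial_mass : measurable_fun setT (fun s : R =>
  if [&& 0 < s, s <= 1 & 1 <= 2 * s]%R then (s `^ (-1))%:E else 0).
Proof.
apply: measurable_fun_ifT => //.
  apply: measurable_and; first exact: measurable_fun_ltr.
  apply: measurable_and; first exact: measurable_fun_ler.
  by apply: measurable_fun_ler => //; exact: measurable_funM.
by apply/measurable_EFinP; exact: measurable_powR.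
Qed.

Lemma measurable_power_mass k : measurable_fun setT (fun s : R =>
  if (0 < s <= 1)%R then (s ^+ k)%:E else 0).
Proof.
apply: measurable_fun_ifT => //; last first.
  by apply/measurable_EFinP; exact: measurable_funX.
apply: measurable_and; first exact: measurable_fun_ltr.
exact: measurable_fun_ler.
Qed.

Lemma radial_mass_gt0 : 0 < radial_mass.
Proof.
apply: (@lt_le_trans _ _ (\int[mu]_s (if (2^-1 <= s <= 1)%R then 1%:E else 0))).
  by rewrite integral_indic_itv ?lte_fin; lra.
apply: ge0_le_integral => //.
- by move=> s _; case: ifP => // _; rewrite lee_fin.
- exact: measurable_if_itv.
- exact: measurable_radial_mass.
- move=> s _; case: ifPn => [/andP[s1 s2]|_]; last first.
    by case: ifP => // _; rewrite lee_fin powR_ge0.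
  rewrite ifT; last by apply/and3P; split=> //; lra.
  by rewrite lee_fin powR_inv1 ?invf_ge1//; lra.
Qed.

Lemma radial_mass_lty : radial_mass < +oo.
Proof.
apply: (@le_lt_trans _ _ (\int[mu]_s (if (0 <= s <= 1)%R then 2%:E else 0))).
  apply: ge0_le_integral => //.
  - by move=> s _; case: ifP => // _; rewrite lee_fin powR_ge0.
  - exact: measurable_radial_mass.
  - exact: measurable_if_itv.
  - move=> s _; case: ifPn => [/and3P[s0 s1 s2]|_]; last first.
      by case: ifP => // _; rewrite lee_fin.
    rewrite ifT; last by apply/andP; split=> //; lra.
    rewrite lee_fin (powR_inv1 (ltW s0)) -[X in (_ <= X)%R]invrK lef_pV2 ?posrE ?invr_gt0//; lra.
by rewrite integral_indic_itv ?ltry//; lra.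
Qed.

Lemma power_mass_gt0 k : 0 < power_mass k.
Proof.
apply: (@lt_le_trans _ _ (\int[mu]_s (if (2^-1 <= s <= 1)%R then (2^-1 ^+ k)%:E else 0))).
  rewrite integral_indic_itv ?lte_fin; last lra.
  by apply: mulr_gt0; [apply: exprn_gt0|]; lra.
apply: ge0_le_integral => //.
- by move=> s _; case: ifP => // _; rewrite lee_fin exprn_ge0.
- exact: measurable_if_itv.
- exact: measurable_power_mass.
- move=> s _; case: ifPn => [/andP[s1 s2]|_]; last first.
    by case: ifP => // /andP[s0 _]; rewrite lee_fin exprn_ge0// ltW.
  rewrite ifT; last by apply/andP; split=> //; lra.
  by rewrite lee_fin lerXn2r// nnegrE; lra.
Qed.

(* Polar coordinates without spherical measure: integrate [s^-1] over the pairs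
   [(s, x)] with [g x <= 1] and [s <= |x| <= 2 s], once in [s] for fixed [x], and
   once in [x = s y], where the annulus [1 <= |y| <= 2] replaces the sphere. *)
Lemma gbody_polar k (g : 'rV[R]_k.+1 -> R) : gauge g ->
  radial_mass * leb k.+1 (gbody g) = power_mass k *
    \int[leb k.+1]_x (if (1 <= enorm x <= 2)%R then ((g x)^-1 ^+ k.+1)%:E else 0).
Proof.
move=> gg; have [_ hom pos] := gg.
have mg1 : measurable_fun setT (fun p : mR * 'rV[R]_k.+1 => g p.2).
  exact: (measurableT_comp (measurable_gauge gg) measurable_snd).
have mn1 : measurable_fun setT (fun p : mR * 'rV[R]_k.+1 => enorm p.2).
  exact: (measurableT_comp (@measurable_enorm R k.+1) measurable_snd).
have mf1 : measurable_fun setT (fun p : mR * 'rV[R]_k.+1 => p.1 : R).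
  exact: measurable_fst.
have mpos1 : measurable_fun setT (fun p : mR * 'rV[R]_k.+1 => 0 < p.1)%R.
  exact: measurable_fun_ltr.
pose F (p : mR * 'rV[R]_k.+1) : \bar R :=
  if (g p.2 <= 1)%R && [&& 0 < p.1, p.1 <= enorm p.2 & enorm p.2 <= 2 * p.1]%R
  then (p.1 `^ (-1))%:E else 0.
have mF : measurable_fun setT F.
  apply: measurable_fun_ifT => //; last first.
    by apply/measurable_EFinP; exact: (measurableT_comp (measurable_powR (-1)%R) mf1).
  apply: measurable_and; first exact: measurable_fun_ler.
  apply: measurable_and => //.
  apply: measurable_and; first exact: measurable_fun_ler.
  by apply: measurable_fun_ler => //; exact: measurable_funM.
have F0 p : 0 <= F p by rewrite /F; case: ifP => // _; rewrite lee_fin powR_ge0.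
pose G (p : mR * 'rV[R]_k.+1) : \bar R :=
  if (1 <= enorm p.2 <= 2)%R && ((0 < p.1)%R && (p.1 * g p.2 <= 1)%R)
  then (p.1 ^+ k)%:E else 0.
have mG : measurable_fun setT G.
  apply: measurable_fun_ifT => //; last first.
    by apply/measurable_EFinP; exact: measurable_funX.
  apply: measurable_and; first by apply: measurable_and; exact: measurable_fun_ler.
  by apply: measurable_and => //; apply: measurable_fun_ler => //; exact: measurable_funM.
have G0 p : 0 <= G p.
  by rewrite /G; case: ifP => // /and3P[_ p0 _]; rewrite lee_fin exprn_ge0// ltW.
transitivity (\int[leb k.+1]_x \int[mu]_s F (s, x)).
  rewrite leb_integral_indic; last exact: measurable_gbody.
  rewrite -ge0_integralZl//; last 2 first.
  - by apply/measurable_EFinP; apply: measurable_indic; exact: measurable_gbody.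
  - exact/ltW/radial_mass_gt0.
  apply: ge0_ae_eq_integral => //.
  - apply: measurable_funeM; apply/measurable_EFinP; apply: measurable_indic.
    exact: measurable_gbody.
  - exact: (measurable_fun_fubini_tonelli_G (m1 := mu) F).
  - by move=> x _; rewrite mule_ge0// ?lee_fin// ltW// radial_mass_gt0.
  - by move=> x _; exact: integral_ge0.
  (* At the origin no [s > 0] satisfies [s <= enorm x], and the two integrands differ; the dimension
     [k.+1] is positive, so a point is a null set. *)
  exists [set 0%R]; split; [|exact: leb_set0|].
    by rewrite set0_cube; exact: measurable_cube.
  move=> x /= h; apply: contrapT => /eqP x0; apply: h => _.
  have nx : (0 < enorm x)%R by rewrite enorm_gt0.
  rewrite indicE; case: (boolP (x \in gbody g)) => gx.
    rewrite mule1 -(radial_mass_scale nx); apply: eq_integral => s _.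
    by rewrite /F/=; move: gx; rewrite inE /gbody/= => ->.
  rewrite mule0 integral0_eq// => s _.
  by rewrite /F/= ifF//; apply/negbTE; rewrite negb_and; apply/orP; left;
    apply: contra gx => gx; rewrite inE.
transitivity (\int[leb k.+1]_x \int[mu]_s G (s, x)); last first.
  rewrite -ge0_integralZl//; last 3 first.
  - apply: measurable_fun_ifT => //; last first.
      by apply/measurable_EFinP; apply: measurable_funX; exact: measurable_gaugeV.
    by apply: measurable_and; apply: measurable_fun_ler => //; exact: measurable_enorm.
  - by move=> x _; case: ifP => // _; rewrite lee_fin exprn_ge0// invr_ge0 gauge_ge0.
  - exact/ltW/power_mass_gt0.
  apply: eq_integral => x _; case: ifPn => [x12|nx12]; last first.
    by rewrite mule0 integral0_eq// => s _; rewrite /G/= (negbTE nx12).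
  have gx : (0 < g x)%R.
    apply: pos; rewrite -enorm_gt0; apply: lt_le_trans ltr01 _.
    by case/andP: x12.
  rewrite -power_mass_scale//; apply: eq_integral => s _.
  by rewrite /G/= x12.
rewrite -(fubini_tonelli (m1 := mu) (m2 := leb k.+1) F mF F0).
rewrite -(fubini_tonelli (m1 := mu) (m2 := leb k.+1) G mG G0).
apply: eq_integral => s _.
have [s0|s0] := leP s 0%R.
  rewrite !integral0_eq// => x _.
    by rewrite /G ifF//= [(0 < s)%R]ltNge s0 /= andbF.
  by rewrite /F ifF//= [(0 < s)%R]ltNge s0 /= andbF.
(* Substitution [x = s y] for fixed [s]: the Jacobian [s ^+ k.+1] and the weight [s^-1] combine to
   [s ^+ k]. *)
rewrite -[LHS](integral_leb_affine (m := k.+1) 0%R s0); last 2 first.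
- exact: (measurableT_comp mF (measurable_pair1 s)).
- by move=> x; exact: F0.
rewrite -ge0_integralZl//; last 2 first.
- apply: (measurableT_comp (measurableT_comp mF (measurable_pair1 s))).
  exact: measurable_affine_rV.
- by rewrite lee_fin exprn_ge0// ltW.
apply: eq_integral => x _; rewrite /F /G/= addr0 (hom _ _ (ltW s0)) (enormZ _ (ltW s0)) s0/=.
rewrite [(s <= _)%R]ler_pMr// [(2 * s)%R]mulrC ler_pM2l// [in LHS]andbC.
case: ifPn => _; last by rewrite mule0.
by rewrite -EFinM (powR_inv1 (ltW s0)) exprSr mulfK// gt_eqF.
Qed.

End polar.

(** * Volume of thin cylinders *)

Section cylinders.
Context {R : realType}.

Lemma gauge_mulmx i m (g : 'rV[R]_m -> R) (E : 'M[R]_(i, m)) : gauge g ->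
  E *m E^T = 1%:M -> gauge (fun t => g (t *m E)).
Proof.
move=> gg EE; have [cg hom pos] := gg; split.
- move=> t; apply: (@continuous_comp _ _ _ (fun t : 'rV[R]_i => t *m E) g); last exact: cg.
  apply/(@cvgrPdist_lt _ _ _ (nbhs t) (nbhs_filter _)) => e e0.
  have i0 : 0 < i.+1%:R :> R by [].
  near=> y; rewrite -mulmxBl (le_lt_trans (mx_norm_le_enorm _))//.
  rewrite enorm_isom// (le_lt_trans (enorm_le_mx_norm _))//.
  have : `|t - y| < e / i.+1%:R.
    near: y; apply: (@cvgr_dist_lt _ _ _ (nbhs t) _ id) => //.
    by rewrite divr_gt0.
  rewrite ltr_pdivlMr// mulrC; apply: le_lt_trans.
  by rewrite ler_wpM2r// ler_nat.
- by move=> a t a0; rewrite -scalemxAl hom.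
- move=> t t0; apply: pos; rewrite -enorm_eq0 enorm_isom// enorm_eq0//.
Unshelve. all: by end_near.
Qed.

Lemma gbody_sub_eball m (g : 'rV[R]_m -> R) : gauge g ->
  exists2 r, 0 < r & gbody g `<=` eball r.
Proof.
move=> gg; have [a a0 ag] := gauge_norm_ge gg.
exists (m.+1%:R * a^-1) => [|x gx]; first by rewrite mulr_gt0// invr_gt0.
rewrite /eball/= (le_trans (enorm_le_mx_norm _))//.
apply: ler_pM => //; first by rewrite ler_nat.
rewrite -(ler_pM2l a0) mulfV ?gt_eqF//.
exact: le_trans (ag x) gx.
Qed.

Lemma eball_sub_gbody m (g : 'rV[R]_m -> R) : gauge g ->
  exists2 r, 0 < r & eball r `<=` gbody g.
Proof.
move=> gg; have [b b0 gb] := gauge_norm_le gg.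
exists b^-1 => [|x]; first by rewrite invr_gt0.
rewrite /eball/gbody/= => xb; rewrite (le_trans (gb _))//.
rewrite -(mulfV (lt0r_neq0 b0)) ler_pM2l//.
exact: le_trans (mx_norm_le_enorm _) xb.
Qed.

Lemma leb_gbody_lty m (g : 'rV[R]_m -> R) : gauge g ->
  (leb m (gbody g) < +oo)%E.
Proof.
move=> gg; have [r r0 gr] := gbody_sub_eball gg.
apply: le_lt_trans (leb_eball_lty m r); apply: le_measure; rewrite ?inE//.
  exact: measurable_gbody.
exact: measurable_eball.
Qed.

Lemma leb_gbody_gt0 m (g : 'rV[R]_m -> R) : gauge g ->
  (0 < leb m (gbody g))%E.
Proof.
move=> gg; have [r r0 gr] := eball_sub_gbody gg.
apply: lt_le_trans (leb_eball_gt0 m r0) _; apply: le_measure; rewrite ?inE//.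
  exact: measurable_eball.
exact: measurable_gbody.
Qed.

Lemma fin_num_leb_gbody m (g : 'rV[R]_m -> R) : gauge g ->
  leb m (gbody g) \is a fin_num.
Proof. by move=> gg; rewrite ge0_fin_numE// leb_gbody_lty. Qed.

Lemma measurable_gauge_le m (g : 'rV[R]_m -> R) (c : R) : gauge g ->
  measurable [set x | g x <= c].
Proof.
case=> /continuous_closedP h _ _; apply: closed_measurable_rV.
exact: (h _ (@closed_le _ c)).
Qed.

Lemma leb_gauge_le m (g : 'rV[R]_m -> R) (c : R) : gauge g -> 0 < c ->
  leb m [set x | g x <= c] = ((c ^+ m)%:E * leb m (gbody g))%E.
Proof.
move=> gg c0; have [cg hom pos] := gg.
have mc := measurable_gauge_le c gg.
rewrite -(leb_affine 0 c0 mc); congr (_ * leb m _)%E.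
by apply/seteqP; split=> x /=; rewrite addr0 hom ?(ltW c0)// /gbody/= ger_pMr.
Qed.

(** For [W = cline u] and [h] the support function of [C], these are the points of the body at which
    the support function of [C u] is at most [s]. *)
Definition cyl N d (g : 'rV[R]_N -> R) (h : 'rV[R]_d -> R) (W : 'M[R]_(d, N)) (s : R) :
  set 'rV[R]_N := [set x | g x <= 1 /\ h (x *m W^T) <= s].

Lemma measurable_cyl N d g h (W : 'M[R]_(d, N)) s : gauge g -> gauge h ->
  measurable (cyl g h W s).
Proof.
move=> gg gh.
have mh := measurableT_comp (measurable_gauge gh) (measurable_mulmxr W^T).
rewrite (_ : cyl g h W s = gbody g `&`
    (setT `&` (h \o (fun x : 'rV[R]_N => x *m W^T)) @^-1` `]-oo, s]%classic)).
  apply: measurableI; first exact: measurable_gbody.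
  by apply: mh => //; exact: measurable_itv.
by rewrite setTI; apply/seteqP; split=> x /=; rewrite in_itv.
Qed.

Definition perp i d N (W : 'M[R]_(d, N)) (E : 'M[R]_(i, N)) : Prop :=
  [/\ W *m W^T = 1%:M, E *m E^T = 1%:M & W *m E^T = 0].

Section cyl_slice.
Variables (i d N : nat) (g : 'rV[R]_N -> R) (h : 'rV[R]_d -> R).
Hypotheses (diN : (d + i)%N = N) (gg : gauge g) (gh : gauge h).

Let slice (W : 'M[R]_(d, N)) (E : 'M[R]_(i, N)) (z : 'rV[R]_d) :=
  [set t : 'rV[R]_i | g (z *m W + t *m E) <= 1].

Let measurable_slice W E z : measurable (slice W E z).
Proof.
rewrite -[X in measurable X]setTI.
have m1 : measurable_fun setT (fun t : 'rV[R]_i => z *m W + t *m E).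
  by apply: measurable_addrV; [exact: measurable_cst|exact: measurable_mulmxr].
have mh := measurableT_comp (measurable_gauge gg) m1.
rewrite (_ : slice W E z = (g \o (fun t : 'rV[R]_i => z *m W + t *m E)) @^-1` `]-oo, 1]%classic).
  by apply: mh => //; exact: measurable_itv.
by apply/seteqP; split=> x /=; rewrite in_itv.
Qed.

Let measurable_leb_slice W E :
  measurable_fun setT (fun z : 'rV[R]_d => leb i (slice W E z)).
Proof.
have m1 : measurable_fun setT
    (fun p : 'rV[R]_d * 'rV[R]_i => p.1 *m W + p.2 *m E).
  apply: measurable_addrV.
    exact: (measurableT_comp (measurable_mulmxr W) measurable_fst).
  exact: (measurableT_comp (measurable_mulmxr E) measurable_snd).
pose S := [set p : 'rV[R]_d * 'rV[R]_i | g (p.1 *m W + p.2 *m E) <= 1].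
have mS : measurable S.
  rewrite (_ : S = setT `&` (fun p : 'rV[R]_d * 'rV[R]_i => p.1 *m W + p.2 *m E) @^-1` gbody g).
    by apply: m1 => //; exact: measurable_gbody.
  by rewrite setTI.
rewrite (_ : (fun _ => _) = fun z => (\int[leb i]_t (\1_S (z, t))%:E)%E); last first.
  apply/funext => z; rewrite (leb_integral_indic (measurable_slice W E z)).
  apply: eq_integral => t _.
  by rewrite !indicE; congr (_%:R%:E); congr nat_of_bool; apply/idP/idP; rewrite !inE.
apply: (measurable_integral_leb (f := fun z t => (\1_S (z, t))%:E)).
  rewrite (_ : (fun _ => _) = fun p => (\1_S p)%:E); last by apply/funext; case.
  by apply/measurable_EFinP; exact: measurable_indic.
by move=> z t; rewrite lee_fin.
Qed.

Let leb_cyl W E s : perp W E ->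
  leb N (cyl g h W s) =
  (\int[leb d]_z (if (h z <= s)%R then leb i (slice W E z) else 0))%E.
Proof.
move=> [WW EE WE]; have mc := measurable_cyl W s gg gh.
rewrite leb_integral_indic// (integral_leb_slice diN WW EE WE); last 2 first.
- by apply/measurable_EFinP; exact: measurable_indic.
- by move=> x; rewrite lee_fin.
apply: eq_integral => z _.
have EW : E *m W^T = 0 by rewrite -[E]trmxK -trmx_mul WE trmx0.
have cE t : ((z *m W + t *m E) \in cyl g h W s) = (h z <= s) && (t \in slice W E z).
  apply/idP/idP; rewrite inE /cyl/= mulmxDl -!mulmxA WW EW mulmx1 mulmx0 addr0.
    by move=> [? ->]; rewrite inE.
  by move=> /andP[-> ]; rewrite inE.
under eq_integral do rewrite indicE cE.
case: ifPn => hz; last by under eq_integral do rewrite /=; rewrite integral0.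
by rewrite leb_integral_indic//; apply: eq_integral => t _; rewrite /= indicE.
Qed.

(** The slice at [z] is cut by the central subspace translated by [z *m W], a vector controlled by
    [h z]; by [gauge_perturb] the slice and the central section are nested up to dilation by
    [1 + e]. The threshold [d0] is chosen before [W] and [E], which is where uniformity in [u]
    originates. *)
Let slice_bounds (e : R) : 0 < e ->
  exists2 d0, 0 < d0 & forall W E z, perp W E -> h z <= d0 ->
    (leb i (slice W E z) <= ((1 + e) ^+ i)%:E * leb i (gbody (fun t => g (t *m E))))%E /\
    (leb i (gbody (fun t => g (t *m E))) <= ((1 + e) ^+ i)%:E * leb i (slice W E z))%E.
Proof.
move=> e0; have e20 : 0 < e / 2 by rewrite divr_gt0.
have [D D0 gD] := gauge_perturb gg e20; have [a a0 ah] := gauge_norm_ge gh.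
have e1 : 0 < 1 + e by rewrite addr_gt0.
(* Chosen to give [D * |z *m W| <= e / 2 / (1 + e)]. The lower bound needs exactly this, since [(1 +
   e / 2) / (1 + e) + e / 2 / (1 + e) = 1]. *)
pose d0 := a * (e / 2 / (1 + e)) / (D * d.+1%:R).
have d00 : 0 < d0 by rewrite divr_gt0// mulr_gt0// divr_gt0.
exists d0 => // W E z [WW EE WE] hz.
have gE := gauge_mulmx gg EE.
have zW : D * `|z *m W| <= e / 2 / (1 + e).
  rewrite (@le_trans _ _ (D * (d.+1%:R * (d0 / a))))//; last first.
    rewrite /d0 le_eqVlt; apply/orP; left; apply/eqP; field.
    by rewrite !gt_eqF//= pnatr_eq0.
  rewrite ler_pM2l// (le_trans (mx_norm_le_enorm _))// enorm_isom//.
  rewrite (le_trans (enorm_le_mx_norm _))// ler_pM// ?ler_nat//.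
  by rewrite ler_pdivlMr// mulrC (le_trans (ah z)).
have e3 : e / 2 / (1 + e) <= e / 2.
  by rewrite ler_pdivrMr// ler_peMr ?ltW// ltrDl.
have [cg hom pos] := gg.
split.
  rewrite -leb_gauge_le//; apply: le_measure; rewrite ?inE//.
    exact: measurable_gauge_le.
  move=> t; rewrite /slice/= => gt.
  have := gD (z *m W + t *m E) (t *m E); rewrite addrK => /le_trans; apply.
  rewrite (@le_trans _ _ ((1 + e / 2) * 1 + e / 2))//; last by rewrite mulr1; lra.
  rewrite lerD//; last exact: le_trans zW e3.
  by rewrite ler_pM2l// addr_gt0.
have e1' : 0 < (1 + e)^-1 by rewrite invr_gt0.
have cc : (((1 + e) ^+ i)%:E * ((1 + e)^-1 ^+ i)%:E = 1)%E.
  by rewrite -EFinM -exprMn mulfV ?expr1n// gt_eqF.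
rewrite -[X in (X <= _)%E]mul1e -cc -muleA -leb_gauge_le//.
apply: lee_wpmul2l; first by rewrite lee_fin exprn_ge0// ltW.
apply: le_measure; rewrite ?inE//; first exact: measurable_gauge_le.
move=> t; rewrite /slice/= => gt.
have := gD (t *m E) (z *m W + t *m E); rewrite distrC addrK => /le_trans; apply.
rewrite (@le_trans _ _ ((1 + e / 2) * (1 + e)^-1 + e / 2 / (1 + e)))//.
  by rewrite lerD// ler_pM2l// addr_gt0.
rewrite -mulrDl ler_pdivrMr// mul1r; lra.
Qed.

(** Fubini over the base [{h <= s}], of volume [s ^+ d] times that of [{h <= 1}]: over it each slice
    has the volume of the central section up to the factor [(1 + e) ^+ i]. *)
Lemma cyl_bounds (e : R) : 0 < e ->
  exists2 d0, 0 < d0 & forall W E s, perp W E -> 0 < s <= d0 ->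
    (leb N (cyl g h W s) <= ((1 + e) ^+ i * s ^+ d)%:E *
      (leb d (gbody h) * leb i (gbody (fun t => g (t *m E)))))%E /\
    ((s ^+ d)%:E * (leb d (gbody h) * leb i (gbody (fun t => g (t *m E)))) <=
      ((1 + e) ^+ i)%:E * leb N (cyl g h W s))%E.
Proof.
move=> e0; have [d0 d00 sb] := slice_bounds e0.
exists d0 => // W E s WE /andP[s0 sd].
have gE : gauge (fun t => g (t *m E)) by case: WE => _ EE _; exact: gauge_mulmx.
have e1 : 0 < 1 + e by rewrite addr_gt0.
pose A := fine (leb i (gbody (fun t => g (t *m E)))).
have AE : leb i (gbody (fun t => g (t *m E))) = A%:E.
  by rewrite fineK// fin_num_leb_gbody.
have A0 : 0 <= A by exact/fine_ge0/measure_ge0.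
pose c := (1 + e) ^+ i.
have c0 : 0 < c by rewrite exprn_gt0.
have mind : measurable_fun setT (fun z : 'rV[R]_d => h z <= s).
  by apply: measurable_fun_ler => //; exact: measurable_gauge.
have int_le (b : R) : 0 <= b ->
    (\int[leb d]_z (if (h z <= s)%R then b%:E else 0) =
     b%:E * ((s ^+ d)%:E * leb d (gbody h)))%E.
  move=> b0; rewrite -leb_gauge_le// leb_integral_indic; last exact: measurable_gauge_le.
  rewrite -ge0_integralZl//; last first.
    by apply/measurable_EFinP; apply: measurable_indic; exact: measurable_gauge_le.
  apply: eq_integral => z _; rewrite indicE; case: ifPn => hz.
    by rewrite mem_set// mule1.
  by rewrite memNset ?mule0//=; exact/negP.
have mslice : measurable_fun setT (fun z => if h z <= s then leb i (slice W E z) else 0%E).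
  by apply: measurable_fun_ifT => //; exact: measurable_leb_slice.
rewrite AE (leb_cyl s WE); split.
  rewrite (_ : _ * _ = (c * A)%:E * ((s ^+ d)%:E * leb d (gbody h)))%E; last first.
    by rewrite !EFinM [in RHS]muleAC -!muleA; congr (_ * _)%E; rewrite muleCA muleC -!muleA.
  rewrite -int_le; last by rewrite mulr_ge0// ltW.
  apply: ge0_le_integral => //.
  - by move=> z _; case: ifP.
  - by apply: measurable_fun_ifT.
  move=> z _; case: ifP => // hz.
  have [+ _] := sb W E z WE (le_trans hz sd).
  by rewrite AE -EFinM.
rewrite -ge0_integralZl//; last 2 first.
- by move=> z _; case: ifP.
- by rewrite lee_fin ltW.
rewrite [X in (X <= _)%E](_ : _ = A%:E * ((s ^+ d)%:E * leb d (gbody h)))%E; last first.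
  by rewrite muleA muleC.
rewrite -int_le//; apply: ge0_le_integral => //.
- by move=> z _; case: ifP.
- by apply: measurable_fun_ifT.
- exact: measurable_funeM.
move=> z _; case: ifP => // hz; last by rewrite mule0.
have [_] := sb W E z WE (le_trans hz sd).
by rewrite AE.
Qed.

End cyl_slice.

Lemma pow_near1 (k : nat) (e : R) : 0 < e -> exists2 d, 0 < d & (1 + d) ^+ k <= 1 + e.
Proof.
elim: k e => [|k IH] e e0; first by exists 1 => //; rewrite expr0 lerDl ltW.
(* The new factor is at most [1 + e / 2], and [(1 + e / 2) * (1 + e / 2 / (1 + e)) <= 1 + e]. *)
have [|d d0 hd] := IH (e / (2 * (1 + e))); first by rewrite divr_gt0// mulr_gt0// addr_gt0.
exists (Num.min d (e / 2)) => [|]; first by rewrite lt_min d0 divr_gt0.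
set m := Num.min _ _.
have m0 : 0 < m by rewrite lt_min d0 divr_gt0.
have [md me] : m <= d /\ m <= e / 2 by rewrite !ge_min !lexx orbT.
rewrite exprS (@le_trans _ _ ((1 + e / 2) * (1 + e / (2 * (1 + e)))))//.
  apply: ler_pM; [lra|by apply: exprn_ge0; lra|lra|].
  by apply: le_trans hd; apply: lerXn2r; rewrite ?nnegrE; lra.
have e1 : 0 < 1 + e by lra.
have -> : e / (2 * (1 + e)) = e / 2 / (1 + e) by field; lra.
have h : e / 2 / (1 + e) * (1 + e) = e / 2 by rewrite mulfVK// gt_eqF.
have h0 : 0 <= e / 2 / (1 + e) by rewrite !divr_ge0// ltW.
set y := e / 2 / (1 + e) in h h0 *; nra.
Qed.

Section comparison.
Variables (i d N : nat) (g : 'rV[R]_N -> R) (h : 'rV[R]_d -> R).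
Hypotheses (diN : (d + i)%N = N) (gg : gauge g) (gh : gauge h).

(** The cylinder of [W] lies in the dilate by [1 + e] of the cylinder of [W']. *)
Lemma cyl_perturb (e s : R) : 0 < e -> 0 < s ->
  exists2 c, 0 < c & forall W W' : 'M[R]_(d, N),
    (forall x : 'rV[R]_N, `|x *m W^T - x *m W'^T| <= c * `|x|) ->
    (leb N (cyl g h W s) <= ((1 + e) ^+ N)%:E * leb N (cyl g h W' s))%E.
Proof.
move=> e0 s0; have e20 : 0 < e / 2 by rewrite divr_gt0.
have [D D0 hD] := gauge_perturb gh e20; have [a a0 ag] := gauge_norm_ge gg.
have e1 : 0 < 1 + e by rewrite addr_gt0.
(* On the body [a * |x| <= 1], so the error [D * (c * |x|)] in [h] is at most [e / 2 * s]. *)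
exists (e / 2 * s * a / D) => [|W W' WW']; first by rewrite divr_gt0// !mulr_gt0.
have mc := measurable_cyl W' s gg gh.
have [[_ homg _] [_ homh _]] := (gg, gh).
pose B := [set x | cyl g h W' s ((1 + e)^-1 *: x + 0)].
have mB : measurable B.
  rewrite (_ : B = setT `&` (fun x : 'rV[R]_N => (1 + e)^-1 *: x + 0) @^-1` cyl g h W' s).
    exact: measurable_affine_rV.
  by rewrite setTI.
have e1' : 0 < (1 + e)^-1 by rewrite invr_gt0.
rewrite -(leb_affine 0 e1' mc) muleA -EFinM -exprMn mulfV ?gt_eqF// expr1n mul1e.
apply: le_measure; rewrite ?inE//; first exact: measurable_cyl.
move=> x [gx hx]; rewrite /B/cyl/= addr0 (homg _ _ (ltW e1')); split.
  by rewrite mulrC ler_pdivrMr// mul1r (le_trans gx)// lerDl ltW.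
rewrite -scalemxAl (homh _ _ (ltW e1')) mulrC ler_pdivrMr//.
have := hD (x *m W^T) (x *m W'^T) => /le_trans; apply.
apply: (@le_trans _ _ ((1 + e / 2) * s + e / 2 * s)); last lra.
apply: lerD; first by rewrite ler_pM2l// addr_gt0.
apply: (@le_trans _ _ (D * (e / 2 * s * a / D * `|x|))); first by rewrite ler_pM2l.
rewrite (_ : D * _ = e / 2 * s * (a * `|x|)); last by field; rewrite gt_eqF.
rewrite ler_piMr ?(le_trans (ag x))//.
by rewrite ltW// mulr_gt0.
Qed.

(** No closeness of the frames [E] and [E'] is asked for: each section is compared with its cylinder
    of one fixed height [s], and the cylinders with each other through [W] and [W']. The three
    comparisons lose the powers [i], [N] and [i] of [1 + f]. *)
Lemma section_perturb (e : R) : 0 < e ->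
  exists2 c, 0 < c & forall (W W' : 'M[R]_(d, N)) (E E' : 'M[R]_(i, N)),
    perp W E -> perp W' E' ->
    (forall x : 'rV[R]_N, `|x *m W^T - x *m W'^T| <= c * `|x|) ->
    (leb i (gbody (fun t => g (t *m E))) <=
      (1 + e)%:E * leb i (gbody (fun t => g (t *m E'))))%E.
Proof.
move=> e0; have [f f0 fe] := pow_near1 (i + (N + i)) e0.
have [s s0 sb] := cyl_bounds diN gg gh f0.
have [c c0 cp] := cyl_perturb f0 s0.
exists c => // W W' E E' WE WE' WW'.
have gE : gauge (fun t => g (t *m E)) by case: WE => _ EE _; exact: gauge_mulmx.
have gE' : gauge (fun t => g (t *m E')) by case: WE' => _ EE _; exact: gauge_mulmx.
have f1 : 0 <= 1 + f by rewrite addr_ge0// ltW.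
have [_ h1] := sb W E s WE ltac:(by rewrite s0 lexx).
have h2 := cp _ _ WW'.
have [h3 _] := sb W' E' s WE' ltac:(by rewrite s0 lexx).
have e3 : (0%:E <= ((1 + f) ^+ i)%:E)%E by rewrite lee_fin exprn_ge0.
have e4 : (0%:E <= ((1 + f) ^+ N)%:E)%E by rewrite lee_fin exprn_ge0.
have := le_trans h1 (lee_wpmul2l e3 (le_trans h2 (lee_wpmul2l e4 h3))).
have V0 := leb_gbody_gt0 gh; have Voo := fin_num_leb_gbody gh.
rewrite -(fineK Voo) lte_fin in V0 *.
rewrite -(fineK (fin_num_leb_gbody gE)) -(fineK (fin_num_leb_gbody gE')).
move: V0; set V := fine _; set A := fine _; set A' := fine _ => V0.
rewrite -!EFinM !lee_fin => h4.
have sd : 0 < s ^+ d by rewrite exprn_gt0.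
rewrite -(ler_pM2l (mulr_gt0 sd V0)) -[leLHS]mulrA (le_trans h4)//.
rewrite (_ : _ * (_ * _) = (1 + f) ^+ (i + (N + i)) * (s ^+ d * V * A')); last first.
  by rewrite !exprD; ring.
rewrite [leRHS]mulrCA ler_wpM2r// mulr_ge0// ?(ltW (mulr_gt0 _ _))//.
by rewrite fine_ge0.
Qed.

End comparison.

End cylinders.

(** * Power integrals and the Gamma function near [0] *)

Section power_integrals.
Context {R : realType}.
Local Notation mu := (@lebesgue_measure R).

Lemma continuous_powRl (r x : R) : 0 < x -> {for x, continuous (fun y => y `^ r)}.
Proof.
move=> x0; apply/differentiable_continuous/derivable1_diffP.
by have [] := is_derive1_powR r x0.
Qed.

Lemma integral_powR_itv (r a b : R) : r != 0 -> 0 < a -> a < b ->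
  (\int[mu]_(s in `[a, b]) (s `^ (r - 1))%:E = ((b `^ r - a `^ r) / r)%:E)%E.
Proof.
move=> r0 a0 ab.
rewrite (@continuous_FTC2 _ _ (fun s => r^-1 * s `^ r))//.
- by rewrite -EFinB -mulrBr mulrC.
- apply: continuous_in_subspaceT => x; rewrite inE/= in_itv/= => /andP[ax _].
  exact/continuous_powRl/(lt_le_trans a0).
- split.
  + move=> x; rewrite in_itv/= => /andP[ax _].
    by have := is_derive1_powR r (lt_trans a0 ax) => ?; exact: ex_derive.
  + apply: cvg_at_right_filter; apply: cvgM; first exact: cvg_cst.
    exact: continuous_powRl.
  + apply: cvg_at_left_filter; apply: cvgM; first exact: cvg_cst.
    exact/continuous_powRl/(lt_trans a0).
- move=> x; rewrite in_itv/= => /andP[ax _].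
  have x0 := lt_trans a0 ax.
  have dx := is_derive1_powR r x0.
  rewrite derive1E derive_val /GRing.scale/=.
  by rewrite mulrA mulVf ?mul1r//.
Qed.

Lemma cvg_powR_pinfty (r : R) : r < 0 -> x `^ r @[x --> +oo] --> (0 : R).
Proof.
move=> r0; apply/cvgrPdist_lt => e e0; near=> x.
have x0 : 0 < x by near: x; exact: nbhs_pinfty_gt.
have eb : e^-1 `^ (- r)^-1 < x by near: x; exact: nbhs_pinfty_gt.
rewrite sub0r normrN ger0_norm ?powR_ge0//.
have r1 : 0 < - r by rewrite oppr_gt0.
rewrite -[r]opprK powRN invf_plt ?posrE ?powR_gt0//.
have := gt0_ltr_powR r1 _ _ eb; rewrite !nnegrE powR_ge0 ltW// => /(_ isT isT).
by rewrite -powRrM mulVf ?gt_eqF// powRr1// invr_ge0 ltW.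
Unshelve. all: by end_near.
Qed.

Lemma integral_powR_tail (p a : R) : p < 0 -> 0 < a ->
  (\int[mu]_(s in `[a, +oo[) ((- p) * s `^ (p - 1))%:E = (a `^ p)%:E)%E.
Proof.
move=> p0 a0.
rewrite (@ge0_continuous_FTC2y _ _ (fun s => - s `^ p) _ 0)//.
- by rewrite EFinN oppeK add0e.
- by move=> x ax; rewrite mulr_ge0 ?powR_ge0// oppr_ge0 ltW.
- apply: continuous_in_subspaceT => x; rewrite inE/= in_itv/= andbT => ax.
  apply: cvgM; first exact: cvg_cst.
  exact/continuous_powRl/(lt_le_trans a0).
- by rewrite -oppr0; apply: cvgN; exact: cvg_powR_pinfty.
- move=> x ax; have dx := is_derive1_powR p (lt_trans a0 ax).
  exact: ex_derive.
- by apply: cvg_at_right_filter; apply: cvgN; exact: continuous_powRl.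
- move=> x; rewrite in_itv/= andbT => ax.
  have dx := is_derive1_powR p (lt_trans a0 ax).
  by rewrite derive1E derive_val mulNr.
Qed.

Lemma integral_powR_head (q d : R) : 0 < q -> 0 < d ->
  (\int[mu]_(s in `]0%R, d]) (s `^ (q - 1))%:E = (d `^ q / q)%:E)%E.
Proof.
move=> q0 d0.
(* The integrand may blow up at 0, so its integral is the monotone limit over these intervals;
   [k.+2] keeps the left end strictly below [d]. *)
pose F (k : nat) := `[d / k.+2%:R, d]%classic.
have FE : `]0, d]%classic = \bigcup_k F k.
  apply/seteqP; split=> [x|x [k _]]; rewrite /F/= !in_itv/=; last first.
    by move=> /andP[h ->]; rewrite (lt_le_trans _ h)// divr_gt0.
  move=> /andP[x0 xd]; exists (Num.truncn (d / x)) => //=; rewrite in_itv/= xd andbT.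
  rewrite ler_pdivrMr// mulrC -ler_pdivrMr// ltW// (lt_trans (truncnS_gt _))//.
  by rewrite ltr_nat.
have h : (\int[mu]_(s in F k) (s `^ (q - 1))%:E)%E @[k --> \oo] -->
    (\int[mu]_(s in `]0%R, d]) (s `^ (q - 1))%:E)%E.
  rewrite FE; apply: ge0_nondecreasing_set_cvg_integral.
  - apply/nondecreasing_seqP => k; rewrite subsetEset => x; rewrite /F/= !in_itv/=.
    move=> /andP[h ->]; rewrite andbT (le_trans _ h)//.
    by rewrite ler_pM2l// lef_pV2 ?posrE// ler_nat.
  - by move=> k; exact: measurable_itv.
  - move=> k; apply/measurable_EFinP; apply: measurable_funTS.
    exact: measurable_powR.
  - by move=> k x _; rewrite lee_fin powR_ge0.
have lim1 : (\int[mu]_(s in F k) (s `^ (q - 1))%:E)%E @[k --> \oo] --> (d `^ q / q)%:E.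
  rewrite (_ : (fun k => _) = fun k => ((d `^ q - d `^ q * k.+2%:R `^ (- q)) / q)%:E); last first.
    apply/funext => k; rewrite /F integral_powR_itv ?gt_eqF ?divr_gt0//; last first.
      by rewrite ltr_pdivrMr// ltr_pMr// ltr1n.
    by rewrite powRM ?(ltW d0) ?invr_ge0// -powR_inv1// -powRrM mulN1r.
  apply: cvg_EFin; first by near=> k.
  rewrite -[X in _ --> X](_ : (d `^ q - d `^ q * 0) / q = _); last by rewrite mulr0 subr0.
  apply: cvgM; last exact: cvg_cst.
  apply: cvgB; first exact: cvg_cst.
  apply: cvgM; first exact: cvg_cst.
  apply: (@cvg_comp _ _ _ (fun k : nat => k.+2%:R : R) (fun x => x `^ (- q)) _ +oo%R); last first.
    by apply: cvg_powR_pinfty; rewrite oppr_lt0.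
  apply/cvgryPge => A; near=> k.
  have : A <= k%:R by near: k; exact: nbhs_infty_ger.
  by move/le_trans; apply; rewrite ler_nat -addn2 leq_addr.
exact: cvg_unique h lim1.
Unshelve. all: by end_near.
Qed.

End power_integrals.

Section Gamma.
Context {R : realType}.
Local Notation mu := (@lebesgue_measure R).

Let Gf (q t : R) : R := t `^ (q - 1) * expR (- t).

Let Gf_ge0 q t : 0 <= Gf q t.
Proof. by rewrite mulr_ge0 ?powR_ge0 ?expR_ge0. Qed.

Let measurable_Gf q : measurable_fun setT (Gf q).
Proof.
apply: measurable_funM; first exact: measurable_powR.
by apply: measurableT_comp; [exact: measurable_expR|exact: oppr_measurable].
Qed.

(** On []0, 1]] the inequalities [1 - t <= expR (- t) <= 1] put the integral between
    [1 / q - 1 / (q + 1)] and [1 / q]. On []1, +oo[] the power is at most 1, and what remains is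
    bounded by the total mass 1 of the exponential density. *)
Lemma Gamma_bounds (q : R) : 0 < q -> q < 1 ->
  (q + 1)^-1 <= q * Gamma q /\ q * Gamma q <= 1 + q.
Proof.
move=> q0 q1.
pose J := (\int[mu]_(t in `]0%R, 1%R]) (Gf q t)%:E)%E.
pose T := (\int[mu]_(t in `]1%R, +oo[) (Gf q t)%:E)%E.
have GE : (\int[mu]_(t in `]0%R, +oo[) (Gf q t)%:E = J + T)%E.
  rewrite (_ : `]0%R, +oo[%classic = `]0%R, 1%R] `|` `]1%R, +oo[)%classic; last first.
    by rewrite -itv_bndbnd_setU// bnd_simp.
  rewrite ge0_integral_setU//.
  - by apply/measurable_EFinP; apply: measurable_funTS; exact: measurable_Gf.
  - by move=> x _; rewrite lee_fin.
  - apply/disj_setPS => x [] /=; rewrite !in_itv/= andbT => /andP[_ x1].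
    by rewrite ltNge x1.
have Jle : (J <= (q^-1)%:E)%E.
  have h1 := integral_powR_head q0 (@ltr01 R).
  rewrite powR1 mul1r in h1; rewrite -h1.
  apply: ge0_le_integral => //.
  - by move=> x _; rewrite lee_fin.
  - by apply/measurable_EFinP; apply: measurable_funTS; exact: measurable_Gf.
  - by apply/measurable_EFinP; apply: measurable_funTS; exact: measurable_powR.
  move=> t; rewrite /= in_itv/= => /andP[t0 _].
  by rewrite lee_fin ler_piMr ?powR_ge0// expR_le1 oppr_le0 ltW.
have Tle : (T <= 1%:E)%E.
  rewrite -(integral_exponential_pdf (@ltr01 R)).
  apply: (@le_trans _ _ (\int[mu]_(t in `]1%R, +oo[) (exponential_pdf 1 t)%:E)%E).
    apply: ge0_le_integral => //.
    - by move=> x _; rewrite lee_fin.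
    - by apply/measurable_EFinP; apply: measurable_funTS; exact: measurable_Gf.
    - apply/measurable_EFinP; apply: measurable_funTS.
      by apply: measurable_exponential_pdf.
    move=> t; rewrite /= in_itv/= andbT => t1; have t0 := lt_trans ltr01 t1.
    rewrite lee_fin (exponential_pdfE _ (ltW t0)) mul1r mulN1r ler_piMl ?expR_ge0//.
    rewrite -[q - 1]opprK opprB powRN invf_le1 ?powR_gt0//.
    by rewrite -[X in X <= _](powRr0 t) ler_powR ?(ltW t1)// subr_ge0 ltW.
  apply: ge0_subset_integral => //.
  - by apply/measurable_EFinP; apply: measurable_exponential_pdf.
  - by move=> x _; rewrite lee_fin exponential_pdf_ge0.
have Jge : ((q^-1)%:E <= J + ((q + 1)^-1)%:E)%E.
  have q1' : 0 < q + 1 by rewrite addr_gt0.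
  have h1 := integral_powR_head q0 (@ltr01 R).
  have h2 := integral_powR_head q1' (@ltr01 R).
  rewrite powR1 mul1r in h1; rewrite powR1 mul1r addrK in h2.
  rewrite -h1 -h2 -ge0_integralD//; last 4 first.
  - by move=> x _; rewrite lee_fin.
  - by apply/measurable_EFinP; apply: measurable_funTS; exact: measurable_Gf.
  - by move=> x _; rewrite lee_fin powR_ge0.
  - by apply/measurable_EFinP; apply: measurable_funTS; exact: measurable_powR.
  apply: ge0_le_integral => //.
  - by move=> x _; rewrite lee_fin powR_ge0.
  - by apply/measurable_EFinP; apply: measurable_funTS; exact: measurable_powR.
  - apply: emeasurable_funD; apply/measurable_EFinP; apply: measurable_funTS.
      exact: measurable_Gf.
    exact: measurable_powR.
  move=> t; rewrite /= in_itv/= => /andP[t0 _].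
  rewrite lee_fin /Gf.
  have -> : t `^ q = t `^ (q - 1) * t.
    rewrite -[X in _ = _ * X](powRr1 (ltW t0)) -powRD ?subrK//.
    by rewrite gt_eqF// implybT.
  rewrite -mulrDr ler_peMr ?powR_ge0//.
  by have := expR_ge1Dx (- t); lra.
have [J0 T0] : (0 <= J)%E /\ (0 <= T)%E.
  by split; apply: integral_ge0 => x _; rewrite lee_fin.
have Jfin : J \is a fin_num by rewrite ge0_fin_numE// (le_lt_trans Jle)// ltry.
have Tfin : T \is a fin_num by rewrite ge0_fin_numE// (le_lt_trans Tle)// ltry.
have -> : Gamma q = fine J + fine T by rewrite /Gamma /Rintegral GE fineD.
move: Jle Tle Jge J0 T0; rewrite -(fineK Jfin) -(fineK Tfin) -EFinD !lee_fin /=.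
move: (fine J) (fine T) => a b aq b1 qa a0 b0.
have qq : q * q^-1 = 1 by rewrite mulfV// gt_eqF.
have qq1 : (q + 1)^-1 = 1 - q * (q + 1)^-1.
  by field; rewrite gt_eqF// addr_gt0.
split.
  have h : q * q^-1 <= q * (a + (q + 1)^-1) by rewrite ler_pM2l.
  have h2 : 0 <= q * b by rewrite mulr_ge0// ltW.
  by rewrite qq1 mulrDr; move: h; rewrite qq mulrDr; lra.
by rewrite mulrDr lerD//; [rewrite -qq ler_pM2l|rewrite -[leRHS]mulr1 ler_pM2l].
Qed.

Lemma Gamma_gt0 (q : R) : 0 < q -> q < 1 -> 0 < Gamma q.
Proof.
move=> q0 q1; have [h _] := Gamma_bounds q0 q1.
by rewrite -(pmulr_rgt0 _ q0) (lt_le_trans _ h)// invr_gt0 addr_gt0.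
Qed.

End Gamma.

(** * Integrals of negative powers from the growth of sublevel sets *)

Section layer_cake.
Context d (T : measurableType d) (R : realType).
Variable m : {sigma_finite_measure set T -> \bar R}.
Local Notation mu := (@lebesgue_measure R).
Local Notation mR := (measurableTypeR R).
Local Open Scope ereal_scope.

Lemma measurable_lt_le (f : T -> R) (D : set T) : measurable D ->
  measurable_fun setT f ->
  measurable [set p : mR * T | D p.2 /\ (0 < f p.2 <= p.1)%R].
Proof.
move=> mD mf.
have mf2 : measurable_fun setT (fun p : mR * T => f p.2).
  exact: (measurableT_comp mf measurable_snd).
have mf1 : measurable_fun setT (fun p : mR * T => p.1 : R) by exact: measurable_fst.
have mb : measurable_fun setT (fun p : mR * T => 0 < f p.2 <= p.1)%R.
  by apply: measurable_and; [exact: measurable_fun_ltr|exact: measurable_fun_ler].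
have := mb measurableT [set true] Logic.I.
rewrite setTI => mb'; apply: measurableI; last exact: mb'.
by rewrite -[X in measurable X]setTI; exact: measurable_snd.
Qed.

(** Where [f x > 0], the value [f x]^ p[is the integral of]- p * s [^ (p - 1)] over [s >= f x], as
    [p < 0]; Tonelli then exchanges the integrals. *)
Lemma layer_cake (D : set T) (f : T -> R) (p : R) : measurable D ->
  measurable_fun setT f -> (forall x, 0 <= f x)%R -> (p < 0)%R ->
  \int[m]_(x in D) (f x `^ p)%:E =
  \int[mu]_(s in `]0%R, +oo[)
    ((- p * s `^ (p - 1))%:E * m (D `&` [set x | (0 < f x <= s)%R])).
Proof.
move=> mD mf f0 p0.
pose S := [set q : mR * T | D q.2 /\ (0 < f q.2 <= q.1)%R].
have mS : measurable S by exact: measurable_lt_le.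
pose k (s : R) : R := (- p * s `^ (p - 1))%R.
have k0 s : (0 <= k s)%R by rewrite mulr_ge0 ?powR_ge0// oppr_ge0 ltW.
have mk : measurable_fun setT k by apply: measurable_funM => //; exact: measurable_powR.
pose K (q : mR * T) := (\1_S q * k q.1)%:E.
have mK : measurable_fun setT K.
  apply/measurable_EFinP; apply: measurable_funM; first exact: measurable_indic.
  exact: (measurableT_comp mk measurable_fst).
have K0 q : 0 <= K q by rewrite lee_fin mulr_ge0.
transitivity (\int[m]_x \int[mu]_s K (s, x)).
  rewrite integral_mkcond; apply: eq_integral => x _; rewrite patchE.
  case: ifPn => [|nDx]; last first.
    rewrite integral0_eq// => s _; rewrite /K indicE memNset ?mul0r//.
    by move=> [/= Dx _]; move: nDx; rewrite mem_set.
  rewrite inE => Dx; have [fx0|fx0] := eqVneq (f x) 0%R.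
    rewrite fx0 powR0 ?lt_eqF// integral0_eq// => s _.
    by rewrite /K indicE memNset ?mul0r// /S/= fx0 ltxx => -[].
  have fx : (0 < f x)%R by rewrite lt0r fx0 f0.
  rewrite -integral_powR_tail// integral_mkcond; apply: eq_integral => s _.
  rewrite patchE /K indicE mem_setE in_itv/= andbT; case: ifPn => fs.
    by rewrite mem_set ?mul1r// /S/= fx fs.
  by rewrite memNset ?mul0r// /S/= => -[_ /andP[_]]; apply/negP.
rewrite -(fubini_tonelli (m1 := mu) (m2 := m) K mK K0).
rewrite [RHS]integral_mkcond; apply: eq_integral => s _; rewrite patchE.
have mSs : measurable (D `&` [set x | (0 < f x <= s)%R]).
  rewrite -[X in measurable X]setTI.
  exact: (measurable_pair1 s measurableT mS).
case: ifPn; rewrite mem_setE in_itv/= andbT => s0; last first.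
  rewrite integral0_eq// => x _; rewrite /K indicE memNset ?mul0r// /S/=.
  by move=> [_ /andP[fx /(lt_le_trans fx)]]; exact/negP.
transitivity (\int[m]_x ((k s)%:E * (\1_(D `&` [set x | (0 < f x <= s)%R]) x)%:E)).
  by apply: eq_integral => x _; rewrite -EFinM mulrC.
rewrite ge0_integralZl//; last 2 first.
- by apply/measurable_EFinP; exact: measurable_indic.
- by rewrite lee_fin k0.
by rewrite integral_indic// setIT.
Qed.

Lemma measurable_sublevel (D : set T) (f : T -> R) : measurable D ->
  measurable_fun setT f ->
  measurable_fun setT (fun s : R => m (D `&` [set x | (0 < f x <= s)%R])).
Proof.
move=> mD mf.
have := measurable_fun_xsection m (measurable_lt_le mD mf).
rewrite (_ : (fun s : R => _) = (m \o xsection [set p : mR * T | D p.2 /\ (0 < f p.2 <= p.1)%R]))//.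
by apply/funext => s /=; congr (m _); apply/seteqP; split=> x; rewrite /xsection/= inE.
Qed.

Section power_bounds.
Variables (D : set T) (f : T -> R) (c L M d0 : R).
Hypotheses (mD : measurable D) (mf : measurable_fun setT f).
Hypotheses (f0 : forall x, (0 <= f x)%R).
Hypotheses (c0 : (0 < c)%R) (L0 : (0 <= L)%R) (d00 : (0 < d0)%R).
Hypothesis DM : m D <= M%:E.
Hypothesis upper : forall s, (0 < s <= d0)%R ->
  m (D `&` [set x | (f x <= s)%R]) <= (c * s ^+ 2 * L)%:E.
Hypothesis lower : forall s, (0 < s <= d0)%R ->
  (s ^+ 2 * L)%:E <= c%:E * m (D `&` [set x | (f x <= s)%R]).

Let measurable_le s : measurable (D `&` [set x | (f x <= s)%R]).
Proof.
apply: measurableI => //; rewrite -[X in measurable X]setTI.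
rewrite (_ : [set x | (f x <= s)%R] = f @^-1` `]-oo, s]%classic).
  by apply: mf => //; exact: measurable_itv.
by apply/seteqP; split=> x /=; rewrite in_itv.
Qed.

Let measurable_lt0_le s : measurable (D `&` [set x | (0 < f x <= s)%R]).
Proof.
rewrite -[X in measurable X]setTI.
exact: (measurable_pair1 (s : mR) measurableT (measurable_lt_le mD mf)).
Qed.

(* With the junk value [0 `^ p = 0], the layer cake formula sees only the points
   where [f > 0]; the growth bound makes the zero set of [f] null. *)
Let null0 : m (D `&` [set x | (f x <= 0)%R]) = 0.
Proof.
apply/eqP; rewrite eq_le measure_ge0 andbT; apply/lee_addgt0Pr => e e0.
rewrite add0e.
(* With this [s] the bound [c * s ^+ 2 * L] is at most [s * (c * d0 * L)], hence at most [e]; the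
   summand 1 covers [L = 0]. *)
pose s := Num.min d0 (e / (c * d0 * L + 1))%R.
have cL : (0 < c * d0 * L + 1)%R by rewrite ltr_wpDl// !mulr_ge0// ltW.
have s0 : (0 < s)%R by rewrite lt_min d00 divr_gt0.
have [sd se] : (s <= d0 /\ s <= e / (c * d0 * L + 1))%R by rewrite !ge_min !lexx orbT.
apply: (@le_trans _ _ (m (D `&` [set x | (f x <= s)%R]))).
  by apply: le_measure; rewrite ?inE// => x [Dx /= fx]; split=> //=; exact: le_trans (ltW s0).
apply: (le_trans (upper _)); first by rewrite s0.
rewrite ler_pdivlMr// in se; rewrite lee_fin; apply: le_trans se.
rewrite expr2 (_ : c * (s * s) * L = s * (c * s * L))%R; last by ring.
rewrite ler_pM2l// (@le_trans _ _ (c * d0 * L)%R)//; last by rewrite lerDl.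
by rewrite ler_wpM2r// ler_pM2l.
Qed.

Let GE s : (0 < s)%R -> m (D `&` [set x | (0 < f x <= s)%R]) = m (D `&` [set x | (f x <= s)%R]).
Proof.
move=> s0; apply/eqP; rewrite eq_le; apply/andP; split.
  by apply: le_measure; rewrite ?inE// => x [Dx /= /andP[_ fx]]; split.
rewrite -[leRHS]adde0 -null0.
apply: (le_trans _ (measureU2 _ _ _)) => //.
apply: le_measure; rewrite ?inE//; first exact: measurableU.
move=> x [Dx /= fx]; by have [fx0|fx0] := leP (f x) 0%R; [right|left].
Qed.

Variable p : R.
Hypotheses (p2 : (-2 < p)%R) (p1 : (p < -1)%R).
Let p0 : (p < 0)%R. Proof. by apply: lt_trans p1 _; rewrite oppr_lt0. Qed.
Let q0 : (0 < p + 2)%R. Proof. by rewrite -ltrBlDr sub0r. Qed.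

Let k (s : R) : R := (- p * s `^ (p - 1))%R.
Let k0 s : (0 <= k s)%R.
Proof. by rewrite mulr_ge0 ?powR_ge0// oppr_ge0 ltW. Qed.

Let measurable_k : measurable_fun setT k.
Proof. by apply: measurable_funM => //; exact: measurable_powR. Qed.

Let kE s : (0 < s)%R -> (k s * s ^+ 2 = - p * s `^ (p + 2 - 1))%R.
Proof.
move=> s0; rewrite /k -mulrA; congr (_ * _)%R.
rewrite -[(s ^+ 2)%R]powR_mulrn ?(ltW s0)// -powRD ?(gt_eqF s0) ?implybT//.
by congr (_ `^ _)%R; ring.
Qed.

Let G (s : R) := (k s)%:E * m (D `&` [set x | (0 < f x <= s)%R]).
Let G0 s : 0 <= G s.
Proof. by rewrite mule_ge0// lee_fin. Qed.
Let measurable_G : measurable_fun setT G.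
Proof.
apply: emeasurable_funM; last exact: measurable_sublevel.
exact/measurable_EFinP.
Qed.

Lemma power_integral_upper :
  \int[m]_(x in D) (f x `^ p)%:E <=
  (c * L * (- p) * (d0 `^ (p + 2) / (p + 2)) + M * d0 `^ p)%:E.
Proof.
rewrite layer_cake// -/G.
rewrite (_ : `]0%R, +oo[%classic = `]0%R, d0] `|` `]d0, +oo[)%classic; last first.
  by rewrite -itv_bndbnd_setU// bnd_simp// ltW.
rewrite ge0_integral_setU//; last 3 first.
- exact: (measurable_funTS measurable_G).
- by move=> x _; exact: G0.
- apply/disj_setPS => x [] /=; rewrite !in_itv/= andbT => /andP[_ x1].
  by rewrite ltNge x1.
rewrite EFinD leeD//.
  rewrite EFinM -integral_powR_head// -ge0_integralZl//; last 3 first.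
  - by apply/measurable_EFinP; apply: measurable_funTS; exact: measurable_powR.
  - by move=> x _; rewrite lee_fin powR_ge0.
  - by rewrite lee_fin !mulr_ge0 ?(ltW c0) ?oppr_ge0// ltW.
  apply: ge0_le_integral => //.
  - by move=> x _; exact: G0.
  - exact: (measurable_funTS measurable_G).
  - apply: measurable_funeM; apply/measurable_EFinP; apply: measurable_funTS.
    exact: measurable_powR.
  move=> s; rewrite /= in_itv/= => /andP[s0 sd]; rewrite /G GE//.
  apply: (@le_trans _ _ ((k s)%:E * (c * s ^+ 2 * L)%:E)).
    by apply: lee_wpmul2l; rewrite ?lee_fin// upper// s0.
  rewrite -!EFinM lee_fin le_eqVlt; apply/orP; left; apply/eqP.
  rewrite (_ : k s * _ = k s * s ^+ 2 * (c * L))%R; last by ring.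
  by rewrite kE//; ring.
apply: (@le_trans _ _ (\int[mu]_(s in `[d0, +oo[) (M%:E * (k s)%:E))).
  apply: (@le_trans _ _ (\int[mu]_(s in `]d0, +oo[) (M%:E * (k s)%:E))).
    apply: ge0_le_integral => //.
    - by move=> x _; exact: G0.
    - exact: (measurable_funTS measurable_G).
    - by apply: measurable_funeM; apply/measurable_EFinP; exact: measurable_funTS.
    move=> s _; rewrite /G muleC; apply: lee_wpmul2r; first by rewrite lee_fin.
    by apply: le_trans DM; apply: le_measure; rewrite ?inE.
  apply: ge0_subset_integral => //.
  - by apply: measurable_funeM; apply/measurable_EFinP; exact: measurable_funTS.
  - move=> s _; rewrite mule_ge0 ?lee_fin//.
    by rewrite -lee_fin (le_trans _ DM).
  - by apply: subset_itvr; rewrite bnd_simp.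
rewrite ge0_integralZl//.
- by rewrite integral_powR_tail.
- by apply/measurable_EFinP; exact: measurable_funTS.
- by move=> x _; rewrite lee_fin.
- by rewrite (le_trans _ DM).
Qed.

(** The integral over [s > d0] is nonnegative and is dropped; the part below [d0] already contains
    the pole. *)
Lemma power_integral_lower :
  (L * (- p) * (d0 `^ (p + 2) / (p + 2)))%:E <=
  c%:E * \int[m]_(x in D) (f x `^ p)%:E.
Proof.
rewrite layer_cake// -/G EFinM -integral_powR_head// -ge0_integralZl//; last 3 first.
- by apply/measurable_EFinP; apply: measurable_funTS; exact: measurable_powR.
- by move=> x _; rewrite lee_fin powR_ge0.
- by rewrite lee_fin mulr_ge0// oppr_ge0 ltW.
rewrite -ge0_integralZl//; last 3 first.
- exact: (measurable_funTS measurable_G).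
- by move=> x _; exact: G0.
- by rewrite lee_fin ltW.
apply: (@le_trans _ _ (\int[mu]_(s in `]0%R, d0]) (c%:E * G s))); last first.
  apply: ge0_subset_integral => //.
  - by apply: measurable_funeM; exact: (measurable_funTS measurable_G).
  - by move=> s _; rewrite mule_ge0// lee_fin ltW.
  - by apply: subset_itvl; rewrite bnd_simp.
apply: ge0_le_integral => //.
- move=> s _; rewrite mule_ge0 ?lee_fin ?powR_ge0//.
  by rewrite mulr_ge0// oppr_ge0 ltW.
- apply: measurable_funeM; apply/measurable_EFinP; apply: measurable_funTS.
  exact: measurable_powR.
- by apply: measurable_funeM; exact: (measurable_funTS measurable_G).
move=> s; rewrite /= in_itv/= => /andP[s0 sd]; rewrite /G GE// muleCA.
apply: (@le_trans _ _ ((k s)%:E * (s ^+ 2 * L)%:E)); last first.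
  by apply: lee_wpmul2l; rewrite ?lee_fin// lower// s0.
rewrite -!EFinM lee_fin le_eqVlt; apply/orP; left; apply/eqP.
by rewrite [RHS]mulrA kE//; ring.
Qed.

End power_bounds.

End layer_cake.

(** * Complex lines and their orthogonal complements *)

Lemma dim_split n : (0 < n)%N -> (1 + 1 + (2 * n - 2) = n + n)%N.
Proof. by case: n => // n _; rewrite subnKC ?mul2n ?addnn// -addnn addSn addnS. Qed.

Section complex_lines.
Context {R : realType}.
Variable n : nat.
Implicit Types (x y u : 'rV[R]_(n + n)) (c : R[i]).

(** Right multiplication of a row by this matrix is multiplication by [i]; the rows of [cline u]
    below are thus [u] and [i u]. *)
Definition Jmx : 'M[R]_(n + n) := block_mx 0 1%:M (- 1%:M) 0.

Lemma mul_Jmx x : x *m Jmx = row_mx (- rsubmx x) (lsubmx x).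
Proof.
rewrite -{1}(hsubmxK x) mul_row_block !mulmx0 mulmx1 mulmxN mulmx1.
by rewrite add0r addr0.
Qed.

Lemma tr_Jmx : Jmx^T = - Jmx.
Proof.
by rewrite /Jmx tr_block_mx opp_block_mx !trmx0 raddfN/= trmx1 !oppr0 opprK.
Qed.

Lemma Jmx_sqr : Jmx *m Jmx = - 1%:M.
Proof.
rewrite /Jmx mulmx_block !mulmx0 !mul0mx mulmx1 mulmxN mulmx1.
by rewrite !add0r !addr0 [in RHS]scalar_mx_block opp_block_mx !oppr0.
Qed.

Lemma cmulE c x : cmul c x = complex.Re c *: x + complex.Im c *: (x *m Jmx).
Proof. by rewrite mul_Jmx. Qed.

Lemma dotNr x y : dot x (- y) = - dot x y.
Proof. by rewrite -[- y]scaleN1r dotZr mulN1r. Qed.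

Lemma dot_Jmx x y : dot (x *m Jmx) y = - dot x (y *m Jmx).
Proof. by rewrite dot_mulmx tr_Jmx mulmxN dotNr. Qed.

Lemma dot_JJ x y : dot (x *m Jmx) (y *m Jmx) = dot x y.
Proof.
by rewrite dot_Jmx -mulmxA Jmx_sqr mulmxN mulmx1 dotNr opprK.
Qed.

Lemma dot_J0 x : dot x (x *m Jmx) = 0.
Proof.
have : dot x (x *m Jmx) = - dot x (x *m Jmx) by rewrite -dot_Jmx dotC.
by move/eqP; rewrite -addr_eq0 -mulr2n mulrn_eq0 => /eqP.
Qed.

Definition cline u : 'M[R]_(1 + 1, n + n) := col_mx u (u *m Jmx).

Lemma mul_cline (z : 'rV[R]_(1 + 1)) u :
  z *m cline u = cmul (lsubmx z 0 0 +i* rsubmx z 0 0) u.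
Proof.
rewrite cmulE /cline -{1}(hsubmxK z) mul_row_col/=.
by rewrite {1}(mx11_scalar (lsubmx z)) {1}(mx11_scalar (rsubmx z)) !mul_scalar_mx.
Qed.

Lemma mul_tr_cline x u :
  x *m (cline u)^T = row_mx (dot x u)%:M (dot x (u *m Jmx))%:M.
Proof.
by rewrite /cline tr_col_mx mul_mx_row [x *m u^T]mx11_scalar
  [x *m (u *m Jmx)^T]mx11_scalar.
Qed.

Lemma cline_unit u : enorm u = 1 -> cline u *m (cline u)^T = 1%:M.
Proof.
move=> u1; have uu : dot u u = 1 by rewrite -enorm_sqr u1 expr1n.
rewrite /cline tr_col_mx mul_col_row [RHS]scalar_mx_block; congr block_mx.
- by rewrite [LHS]mx11_scalar -/(dot u u) uu.
- by rewrite [LHS]mx11_scalar -/(dot u (u *m Jmx)) dot_J0 raddf0.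
- by rewrite [LHS]mx11_scalar -/(dot (u *m Jmx) u) dotC dot_J0 raddf0.
- by rewrite [LHS]mx11_scalar -/(dot (u *m Jmx) (u *m Jmx)) dot_JJ uu.
Qed.

Lemma cspanE u : cspan u = [set x | exists z, x = z *m cline u].
Proof.
apply/seteqP; split=> x [].
  move=> c _ <-; exists (vec_of_complex c).
  rewrite mul_cline /vec_of_complex row_mxKl row_mxKr !mxE eqxx !mulr1n.
  by case: c.
by move=> z ->; rewrite mul_cline; eexists.
Qed.

(** As [i] acts by an antisymmetric matrix, the imaginary part of [cdot x u] is [dot x (u *m Jmx)]:
    complex orthogonality to [u] is real orthogonality to [u] and [i u]. *)
Lemma cperpE u : cperp u = [set x | x *m (cline u)^T = 0].
Proof.
apply/seteqP; split=> x; rewrite /cperp/= /cdot mul_tr_cline cmulE/=.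
  rewrite oppr0 scale0r add0r dotZl mulN1r dot_Jmx opprK => -[-> ->].
  by rewrite raddf0 row_mx0.
rewrite oppr0 scale0r add0r dotZl mulN1r dot_Jmx opprK.
rewrite -[0 in X in X -> _]row_mx0 => /eq_row_mx[/matrixP/(_ 0 0) + /matrixP/(_ 0 0)].
by rewrite !mxE !mulr1n => -> ->.
Qed.

Lemma dot_cmul x u c : dot x (cmul c u) = dot (x *m (cline u)^T) (vec_of_complex c).
Proof.
rewrite cmulE dotDr !dotZr mul_tr_cline /vec_of_complex.
rewrite [RHS]/dot tr_row_mx mul_row_col mxE !tr_scalar_mx -!scalar_mxM !mxE.
by rewrite !mulr1n mulrC [X in _ + X]mulrC.
Qed.

Lemma cmul_mulmx c x : cmul c x = x *m ((complex.Re c)%:M + complex.Im c *: Jmx).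
Proof. by rewrite cmulE mulmxDr mul_mx_scalar scalemxAr. Qed.

Lemma cmul1 x : cmul 1 x = x.
Proof. by rewrite cmulE scale1r scale0r addr0. Qed.

Lemma cmulA c d x : cmul c (cmul d x) = cmul (c * d) x.
Proof.
rewrite !cmulE mulmxDl -!scalemxAl -mulmxA Jmx_sqr mulmxN mulmx1.
case: c d => a b [e f] /=; move: (x *m Jmx) => y.
by apply/rowP => j; rewrite !mxE; ring.
Qed.

Lemma enorm_cmul c x : enorm (cmul c x) = Num.sqrt (complex.Re c ^+ 2 + complex.Im c ^+ 2) * enorm x.
Proof.
rewrite -[LHS]/(Num.sqrt (dot _ _)) cmulE dotDr !dotDl !dotZl !dotZr dot_JJ dot_J0.
rewrite [dot (x *m Jmx) x]dotC dot_J0 !mulr0 addr0 add0r !mulrA -mulrDl -!expr2.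
by rewrite sqrtrM ?addr_ge0 ?sqr_ge0.
Qed.

End complex_lines.

(** * Support functions as gauges *)

Section support_gauge.
Context {R : realType}.

(** Boundedness of [L] makes the supremum finite and Lipschitz in [x]. For positivity, [L] contains
    a small positive multiple of [x] itself. *)
Lemma gauge_supportf m (L : set 'rV[R]_m) : compact L -> L° 0 -> gauge (supportf L).
Proof.
move=> cL L0; have L0' : L 0 by exact: interior_subset.
have [M M0 LM] : exists2 M, 0 < M & forall x, L x -> `|x| < M.
  by have /ex_strict_bound_gt0[M M0 LM] := compact_bounded cL; exists M.
have dL x y : L y -> dot x y <= m%:R * `|x| * M.
  move=> Ly; rewrite (le_trans (ler_norm _))// (le_trans (norm_dot_le _ _))//.
  by rewrite ler_wpM2l ?mulr_ge0// ltW// LM.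
have ne x : [set dot x y | y in L] !=set0 by exists (dot x 0), 0.
have hs x : has_sup [set dot x y | y in L].
  by split=> //; exists (m%:R * `|x| * M) => _ [y Ly <-]; exact: dL.
have le x y : L y -> dot x y <= supportf L x.
  by move=> Ly; apply: (sup_upper_bound (hs x)); exists y.
have ge0 x : 0 <= supportf L x.
  by apply: le_trans (le _ _ L0'); rewrite /dot trmx0 mulmx0 mxE.
have homle a x : 0 <= a -> supportf L (a *: x) <= a * supportf L x.
  move=> a0; apply: ge_sup => // _ [y Ly <-].
  by rewrite dotZl ler_wpM2l// le.
have tri x y : supportf L x <= supportf L y + m%:R * M * `|x - y|.
  apply: ge_sup => // _ [z Lz <-].
  rewrite -[x in dot x z](subrK y) addrC dotDl lerD ?le// (le_trans (dL _ _ Lz))//.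
  by rewrite mulrAC.
split.
- move=> x; apply/(@cvgrPdist_lt _ _ _ (nbhs x) (nbhs_filter _)) => e e0; near=> y.
  apply: (@le_lt_trans _ _ (m%:R * M * `|x - y|)).
    have h1 := tri x y; have h2 := tri y x; rewrite distrC in h2.
    by rewrite ler_norml; apply/andP; split; lra.
  apply: (@le_lt_trans _ _ (m.+1%:R * M * `|x - y|)).
    by rewrite ler_wpM2r// ler_wpM2r ?(ltW M0)// ler_nat.
  rewrite mulrC -ltr_pdivlMr ?mulr_gt0//; near: y.
  apply: (@cvgr_dist_lt _ _ _ (nbhs x) _ id) => //.
  by rewrite divr_gt0// mulr_gt0.
- move=> a x; rewrite le_eqVlt => /orP[/eqP<-|a0].
    by apply/eqP; rewrite mul0r eq_le ge0 andbT (le_trans (homle _ _ _))// mul0r.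
  apply/eqP; rewrite eq_le homle ?(ltW a0)//= -ler_pdivlMl//.
  by rewrite -{1}[x](scalerKV (a := a)) ?gt_eqF// scalerA mulrC -scalerA homle ?invr_ge0 ?(ltW a0).
- move=> x x0; move: L0; rewrite /interior => /nbhs_ballP[r/= r0 rL].
  have nx : 0 < `|x| by rewrite normr_gt0.
  apply: (@lt_le_trans _ _ (dot x ((r / 2 / `|x|) *: x))).
    rewrite dotZr -enorm_sqr mulr_gt0 ?divr_gt0// exprn_gt0// enorm_gt0//.
  apply/le/rL; rewrite -ball_normE/= sub0r normrN normrZ gtr0_norm ?divr_gt0//.
  by rewrite mulfVK ?gt_eqF// ltr_pdivrMr// ltr_pMr// ltr1n.
Unshelve. all: by end_near.
Qed.

(** Pairing [x] with [c u] sees only the coordinates of [x] along [u] and [i u], and is then the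
    pairing in the plane with [c]. *)
Lemma supportf_cmul n (C : set R[i]) (u x : 'rV[R]_(n + n)) :
  supportf [set cmul c u | c in C] x =
  supportf (vec_of_complex @` C) (x *m (cline u)^T).
Proof.
rewrite /supportf; congr sup; apply/seteqP; split=> _ [_ [c Cc <-] <-].
  by exists (vec_of_complex c); [exists c|rewrite dot_cmul].
by exists (cmul c u); [exists c|rewrite dot_cmul].
Qed.

End support_gauge.

(** * Sections by complex hyperplanes and by complex lines *)

Section section_volumes.
Context {R : realType}.
Variable n : nat.
Implicit Types (x y u : 'rV[R]_(n + n)) (c : R[i]) (g : 'rV[R]_(n + n) -> R).

Lemma exists_perp u : (0 < n)%N -> enorm u = 1 ->
  exists E : 'M[R]_(2 * n - 2, n + n), perp (cline u) E.
Proof.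
move=> n0 u1; have WW := cline_unit u1.
have nn := dim_split n0.
by have [E [EE WE]] := orthonormal_complement nn WW; exists E.
Qed.

Lemma vol_section i g u (E : 'M[R]_(i, n + n)) : (1 + 1 + i = n + n)%N ->
  gauge g -> perp (cline u) E ->
  vol i (gbody g `&` cperp u) = leb i (gbody (fun t => g (t *m E))).
Proof.
move=> iN gg [WW EE WE]; have gE := gauge_mulmx gg EE.
have EW : E *m (cline u)^T = 0 by rewrite -[E]trmxK -trmx_mul WE trmx0.
have AE : [set t | (gbody g `&` cperp u) (t *m E)] = gbody (fun t => g (t *m E)).
  apply/seteqP; split=> t; first by case.
  by move=> gt; split=> //; rewrite cperpE/= -mulmxA EW mulmx0.
rewrite (vol_frame (E0 := E)) ?AE//; last exact: measurable_gbody.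
- move=> x [_]; rewrite cperpE/= => xW; rewrite (frame_decomp x iN WW EE WE) xW mul0mx add0r.
  exact: submxMl.
- move=> _ /submxP[t ->]; have [r r0 rg] := eball_sub_gbody gE.
  have [t0|t0] := eqVneq t 0.
    exists 1; rewrite ?oner_eq0// scale1r t0 mul0mx; split.
      by rewrite /gbody/= (gauge0 gg).
    by rewrite cperpE/= mul0mx.
  exists (r / enorm t); first by rewrite gt_eqF// divr_gt0// enorm_gt0.
  split; last by rewrite cperpE/= -!scalemxAl -mulmxA EW mulmx0 scaler0.
  rewrite scalemxAl; apply: rg; rewrite /eball/= enormZ ?divr_ge0 ?enorm_ge0 ?(ltW r0)//.
  by rewrite mulfVK// enorm_eq0.
Qed.

Lemma normc_eq1 c : (`|c| == 1) = (Num.sqrt (complex.Re c ^+ 2 + complex.Im c ^+ 2) == 1).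
Proof. by case: c => a b; rewrite normc_def/=; apply/eqP/eqP => [[]//|->]. Qed.

(** Invariance of the body gives one inequality for every unit scalar; the other one is the same for
    [c^-1]. *)
Lemma circle_invariant_gauge g c x : gauge g -> circle_invariant (gbody g) ->
  `|c| = 1 -> g (cmul c x) = g x.
Proof.
move=> gg inv.
have le d y : `|d| = 1 -> g (cmul d y) <= g y.
  move=> d1; have [_ hom pos] := gg.
  have [->|y0] := eqVneq y 0; first by rewrite cmulE mul0mx !scaler0 addr0.
  have gy := pos _ y0.
  have : gbody g (cmul d ((g y)^-1 *: y)).
    rewrite -(inv _ d1); exists ((g y)^-1 *: y) => //.
    by rewrite /gbody/= hom ?invr_ge0 ?(ltW gy)// mulVf// gt_eqF.
  rewrite cmul_mulmx -scalemxAl -cmul_mulmx /gbody/= hom ?invr_ge0 ?(ltW gy)//.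
  by rewrite ler_pdivrMl// mulr1.
move=> c1; apply/eqP; rewrite eq_le le//=.
have c0 : c != 0 by rewrite -normr_eq0 c1 oner_eq0.
rewrite -[X in g X <= _]cmul1 -(mulVf c0) -cmulA; apply: le.
by rewrite normfV c1 invr1.
Qed.

(** On the complex line through [u] an invariant gauge is [g u] times the Euclidean norm, so the
    section is a disc of radius [(g u)^-1]. *)
Lemma vol_line g u : gauge g -> circle_invariant (gbody g) -> enorm u = 1 ->
  vol 2 (gbody g `&` cspan u) = (((g u)^-1 ^+ 2)%:E * leb 2 (gbody (@enorm R 2)))%E.
Proof.
move=> gg inv u1; have WW := cline_unit u1.
have [_ hom pos] := gg.
have gu : 0 < g u by rewrite pos// -enorm_eq0 u1 oner_eq0.
have gz (z : 'rV[R]_(1 + 1)) : g (z *m cline u) = enorm z * g u.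
  have [->|z0] := eqVneq z 0; first by rewrite mul0mx (gauge0 gg) enorm0 mul0r.
  have nz : 0 < enorm z by rewrite enorm_gt0.
  rewrite -{1}[z](scalerKV (a := enorm z)) ?gt_eqF// -scalemxAl hom ?(ltW nz)//.
  rewrite mul_cline circle_invariant_gauge//; apply/eqP; rewrite normc_eq1 /=.
  set y := _ *: z; have -> : lsubmx y 0 0 ^+ 2 + rsubmx y 0 0 ^+ 2 = dot y y.
    by rewrite dotE big_split_ord !big_ord1 !mxE -!expr2.
  by rewrite -/(enorm y) /y enormZ ?invr_ge0 ?(ltW nz)// mulVf// gt_eqF.
have AE : [set z : 'rV[R]_2 | (gbody g `&` cspan u) (z *m cline u)] =
    [set z | enorm z <= (g u)^-1].
  apply/seteqP; split=> z /=.
    by move=> [+ _]; rewrite /gbody/= gz -ler_pdivlMr// div1r.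
  move=> zu; split; last by rewrite cspanE; exists z.
  by rewrite /gbody/= gz -ler_pdivlMr// div1r.
have mE : measurable [set z : 'rV[R]_2 | enorm z <= (g u)^-1].
  by apply: measurable_gauge_le; exact: gauge_enorm.
rewrite (vol_frame (E0 := cline u)) ?AE//.
- by rewrite leb_gauge_le ?invr_gt0//; exact: gauge_enorm.
- by move=> x [_]; rewrite cspanE => -[z ->]; exact: submxMl.
- move=> _ /submxP[z ->].
  have [z0|z0] := eqVneq z 0.
    exists 1; rewrite ?oner_eq0// scale1r z0 mul0mx; split.
      by rewrite /gbody/= (gauge0 gg).
    by rewrite cspanE; exists 0; rewrite mul0mx.
  have nz : 0 < enorm z by rewrite enorm_gt0.
  exists ((enorm z * g u)^-1); first by rewrite gt_eqF// invr_gt0 mulr_gt0.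
  split; last by rewrite cspanE; exists ((enorm z * g u)^-1 *: z); rewrite scalemxAl.
  rewrite /gbody/= hom ?invr_ge0 ?mulr_ge0 ?enorm_ge0 ?(ltW gu)// gz mulVf//.
  by rewrite gt_eqF// mulr_gt0.
Qed.

End section_volumes.

(** * Circle averages *)

Section circle_mean.
Context {R : realType}.
Local Notation mu := (@lebesgue_measure R).
Variable k : nat.
Hypothesis k0 : (0 < k)%N.

(* With [phi t = g (e^(it) x)], [mean_inv] is [1 / radial] of the circle average
   of [gbody g] at [x]. *)
Definition mean_power (phi : R -> R) : R :=
  (2 * pi)^-1 * \int[mu]_(t in `[0, 2 * pi]) ((phi t)^-1 ^+ k).

Definition mean_inv (phi : R -> R) : R := mean_power phi `^ (- k%:R^-1).

Let pi2 : 0 < 2 * pi :> R. Proof. by rewrite mulr_gt0// pi_gt0. Qed.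

Lemma integrable_inv_pow (phi : R -> R) : continuous phi -> (forall t, 0 < phi t) ->
  mu.-integrable `[0, 2 * pi] (EFin \o (fun t => (phi t)^-1 ^+ k)).
Proof.
move=> cphi phi0; apply: continuous_compact_integrable; first exact: segment_compact.
apply: continuous_subspaceT => t.
apply: (@continuous_comp _ _ _ (fun t => (phi t)^-1) (fun x => x ^+ k)).
  by apply: continuousV; [rewrite gt_eqF|exact: cphi].
exact: exprn_continuous.
Qed.

Lemma mean_power_le (phi psi : R -> R) (l : R) : 0 < l ->
  continuous phi -> (forall t, 0 < phi t) ->
  continuous psi -> (forall t, 0 < psi t) ->
  (forall t, phi t <= l * psi t) -> mean_power psi <= l ^+ k * mean_power phi.
Proof.
move=> l0 cphi phi0 cpsi psi0 le; rewrite /mean_power mulrCA ler_pM2l ?invr_gt0//.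
rewrite -RintegralZl//; last exact: integrable_inv_pow.
apply: le_Rintegral => //.
- exact: integrable_inv_pow.
- rewrite (_ : EFin \o _ = (fun t => (l ^+ k)%:E * ((phi t)^-1 ^+ k)%:E)%E)//.
  by apply: integrableZl => //; exact: integrable_inv_pow.
move=> t _; rewrite -exprMn lerXn2r// ?nnegrE ?mulr_ge0 ?invr_ge0 ?(ltW (phi0 t)) ?(ltW (psi0 t)) ?(ltW l0)//.
by rewrite -ler_pdivrMl// -invfM lef_pV2 ?posrE ?mulr_gt0.
Qed.

Lemma mean_power_cst1 : mean_power (fun=> 1) = 1.
Proof.
rewrite /mean_power Rintegral_cst//= lebesgue_measure_itv/= lte_fin pi2/=.
by rewrite invr1 expr1n mul1r subr0 mulVf// gt_eqF.
Qed.

Lemma mean_power_gt0 (phi : R -> R) (b : R) : continuous phi ->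
  (forall t, 0 < phi t) -> (forall t, phi t <= b) -> 0 < mean_power phi.
Proof.
move=> cphi phi0 phib; have b0 : 0 < b by exact: lt_le_trans (phi0 0) (phib 0).
have c1 : continuous ((fun=> 1) : R -> R) by move=> t; exact: cvg_cst.
have phib1 t : phi t <= b * 1 by rewrite mulr1.
have := mean_power_le b0 cphi phi0 c1 (fun=> ltr01) phib1.
rewrite mean_power_cst1 => h.
by rewrite -(pmulr_rgt0 _ (exprn_gt0 k b0)) (lt_le_trans ltr01).
Qed.

(** One comparison yields all that makes the average a gauge: homogeneity with [l] the scalar, the
    bound on the sphere with [psi = 1], and multiplicative continuity with [l = 1 + e]. *)
Lemma mean_inv_le (phi psi : R -> R) (l b : R) : 0 < l ->
  continuous phi -> (forall t, 0 < phi t) ->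
  continuous psi -> (forall t, 0 < psi t) -> (forall t, psi t <= b) ->
  (forall t, phi t <= l * psi t) -> mean_inv phi <= l * mean_inv psi.
Proof.
move=> l0 cphi phi0 cpsi psi0 psib le.
have h := mean_power_le l0 cphi phi0 cpsi psi0 le.
have p1 := mean_power_gt0 cpsi psi0 psib.
have kr : 0 < (k%:R : R)^-1 by rewrite invr_gt0 ltr0n.
have lk : (l ^+ k) `^ k%:R^-1 = l.
  by rewrite -powR_mulrn ?(ltW l0)// -powRrM mulfV ?gt_eqF ?ltr0n// powRr1// ltW.
have p2 : 0 < mean_power phi.
  by rewrite -(pmulr_rgt0 _ (exprn_gt0 k l0)) (lt_le_trans p1).
rewrite /mean_inv !powRN -ler_pdivrMl// -invfM lef_pV2 ?posrE ?mulr_gt0 ?powR_gt0//.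
rewrite -{1}lk -powRM ?exprn_ge0 ?(ltW l0) ?(ltW p2)//.
by apply: ge0_ler_powR; rewrite ?nnegrE ?(ltW kr) ?(ltW p1)// mulr_ge0 ?exprn_ge0 ?(ltW l0) ?(ltW p2).
Qed.

Lemma mean_inv_cst1 : mean_inv (fun=> 1) = 1.
Proof. by rewrite /mean_inv mean_power_cst1 powR1. Qed.

(** Two default values combine, [0^-1 = 0] in the integrand and the vanishing of a negative power of
    0, so that the averaged gauge is 0 at the origin as it must be. *)
Lemma mean_inv0 : mean_inv (fun=> 0) = 0.
Proof.
rewrite /mean_inv /mean_power Rintegral_cst//= invr0 expr0n gtn_eqF//= mul0r mulr0.
by rewrite powR0// oppr_eq0 invr_eq0 pnatr_eq0 -lt0n.
Qed.

End circle_mean.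

Section circle_averages.
Context {R : realType}.
Local Notation mu := (@lebesgue_measure R).
Variables (n k : nat).
Hypothesis k0 : (0 < k)%N.
Variable g : 'rV[R]_(n + n) -> R.
Hypothesis gg : gauge g.

Definition orbit (x : 'rV[R]_(n + n)) (t : R) : R := g (cmul (cexp t) x).

Definition avg_gauge (x : 'rV[R]_(n + n)) : R := mean_inv k (orbit x).

Lemma enorm_cexp t (x : 'rV[R]_(n + n)) : enorm (cmul (cexp t) x) = enorm x.
Proof. by rewrite enorm_cmul /= cos2Dsin2 sqrtr1 mul1r. Qed.

Lemma continuous_orbit x : continuous (orbit x).
Proof.
move=> t; apply: (@continuous_comp _ _ _ (fun t : R => cmul (cexp t) x) g); last first.
  by case: gg => cg _ _; exact: cg.
rewrite [X in {for _, continuous X}](_ : _ = fun t => cos t *: x + sin t *: (x *m Jmx n)); last first.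
  by apply/funext => s; rewrite cmulE.
apply: cvgD; apply: cvgZ; try exact: cvg_cst.
- exact: continuous_cos.
- exact: continuous_sin.
Qed.

Lemma orbit_gt0 x t : x != 0 -> 0 < orbit x t.
Proof.
move=> x0; case: gg => _ _ pos; apply: pos.
by rewrite -enorm_eq0 enorm_cexp enorm_eq0.
Qed.

Lemma orbit_le : exists2 b, 0 < b & forall x t, orbit x t <= b * enorm x.
Proof.
have [b b0 gb] := gauge_norm_le gg; exists b => // x t.
by rewrite (le_trans (gb _))// ler_pM2l// -(enorm_cexp t) mx_norm_le_enorm.
Qed.

Lemma gauge_avg : gauge avg_gauge.
Proof.
have [b b0 ob] := orbit_le; have [cg hom pos] := gg.
have orbZ a x t : 0 <= a -> orbit (a *: x) t = a * orbit x t.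
  by move=> a0; rewrite /orbit !cmul_mulmx -scalemxAl hom.
have avg0 : avg_gauge 0 = 0.
  rewrite /avg_gauge (_ : orbit 0 = fun=> 0) ?mean_inv0//.
  by apply/funext => t; rewrite /orbit cmul_mulmx mul0mx (gauge0 gg).
apply: (@gauge_mult _ _ _ b).
- have le a x : 0 < a -> avg_gauge (a *: x) <= a * avg_gauge x.
    move=> a0; have [->|x0] := eqVneq x 0; first by rewrite scaler0 avg0 mulr0.
    have ax0 : a *: x != 0 by rewrite scaler_eq0 negb_or x0 gt_eqF.
    apply: (mean_inv_le k0 (b := b * enorm x)) => //; try exact: continuous_orbit.
    + by move=> t; exact: orbit_gt0.
    + by move=> t; exact: orbit_gt0.
    + by move=> t; rewrite orbZ// ltW.
  move=> a x; rewrite le_eqVlt => /orP[/eqP<-|a0]; first by rewrite scale0r avg0 mul0r.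
  apply/eqP; rewrite eq_le le//= -ler_pdivlMl//.
  rewrite -{1}[x](scalerK (a := a)) ?gt_eqF// le// invr_gt0//.
- move=> x x0; apply: powR_gt0; apply: (mean_power_gt0 k (b := b * enorm x)) => //.
  + exact: continuous_orbit.
  + by move=> t; exact: orbit_gt0.
- move=> u u1; have u0 : u != 0 by rewrite -enorm_eq0 u1 oner_eq0.
  rewrite -[leRHS]mulr1 -(mean_inv_cst1 k).
  apply: (mean_inv_le k0 (b := 1)) => //.
  + exact: continuous_orbit.
  + by move=> t; exact: orbit_gt0.
  + by move=> t; exact: cvg_cst.
  + by move=> t; rewrite mulr1 (le_trans (ob _ _))// u1 mulr1.
- move=> e e0; have e20 : 0 < e / 2 by rewrite divr_gt0.
  have [D D0 gD] := gauge_perturb gg e20; have [a a0 ag] := gauge_norm_ge gg.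
  pose m : R := (n + n).+1%:R.
  have m0 : 0 < m by rewrite ltr0n.
  have me (x : 'rV[R]_(n + n)) : enorm x <= m * `|x|.
    by rewrite (le_trans (enorm_le_mx_norm _))// ler_wpM2r// ler_nat.
  (* On the Euclidean sphere [g >= a / m]; the error [D * (m * |u - v|)] has to stay below
     [e / 2 * (a / m)] to be absorbed as a relative one. *)
  exists (e / 2 * a / (D * m * m)); first by rewrite divr_gt0 ?mulr_gt0.
  move=> u v u1 v1 uv.
  have u0 : u != 0 by rewrite -enorm_eq0 u1 oner_eq0.
  have v0 : v != 0 by rewrite -enorm_eq0 v1 oner_eq0.
  apply: (mean_inv_le k0 (b := b)); try exact: continuous_orbit.
  + by rewrite addr_gt0.
  + by move=> t; exact: orbit_gt0.
  + by move=> t; exact: orbit_gt0.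
  + by move=> t; rewrite (le_trans (ob _ _))// u1 mulr1.
  move=> t; apply: (le_trans (gD (cmul (cexp t) u) _)).
  rewrite (_ : 1 + e = 1 + e / 2 + e / 2); last by field.
  rewrite [leRHS]mulrDl lerD2l.
  apply: (@le_trans _ _ (e / 2 * (a * m^-1))); last first.
    rewrite ler_pM2l// (le_trans _ (ag _))// ler_pM2l//.
    by rewrite -(ler_pM2l m0) mulfV ?gt_eqF// -u1 -(enorm_cexp t u).
  rewrite !cmul_mulmx -mulmxBl -cmul_mulmx.
  apply: (@le_trans _ _ (D * (m * `|u - v|))).
    rewrite ler_pM2l// (le_trans (mx_norm_le_enorm _))// enorm_cexp//.
  rewrite [leLHS]mulrA -ler_pdivlMl ?mulr_gt0// (le_trans (ltW uv))//.
  by rewrite le_eqVlt; apply/orP; left; apply/eqP; field; rewrite !gt_eqF.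
Qed.

End circle_averages.

Section average_sections.
Context {R : realType}.
Local Notation mu := (@lebesgue_measure R).
Local Notation mR := (measurableTypeR R).
Variable n : nat.
Variable g : 'rV[R]_(n + n) -> R.
Hypothesis gg : gauge g.

Lemma circle_averageE : (1 < n)%N ->
  circle_average (gbody g) = gbody (avg_gauge (2 * n - 2) g).
Proof.
move=> n1.
have k0 : (0 < 2 * n - 2)%N by rewrite subn_gt0 -[X in (X < _)%N]muln1 ltn_pmul2l.
apply: body_of_radialE; first by rewrite addn_gt0 (ltn_trans _ n1).
  exact: gauge_avg.
move=> u u1; rewrite /avg_gauge /mean_inv powRN invrK /mean_power.
by congr ((_ * _) `^ _); apply: eq_Rintegral => t _; rewrite radial_gbody.
Qed.

Definition rotmx (t : R) : 'M[R]_(n + n) := (cos t)%:M + sin t *: Jmx n.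

Lemma cmul_cexp t (x : 'rV[R]_(n + n)) : cmul (cexp t) x = x *m rotmx t.
Proof. by rewrite cmul_mulmx. Qed.

Lemma rotmx_orthogonal t : rotmx t *m (rotmx t)^T = 1%:M.
Proof.
have -> : (rotmx t)^T = (cos t)%:M - sin t *: Jmx n.
  by rewrite /rotmx linearD linearZ/= tr_scalar_mx tr_Jmx scalerN.
rewrite mulmxBr mulmxDl [X in _ - X]mulmxDl -scalar_mxM mul_mx_scalar mul_scalar_mx.
rewrite -scalemxAl -scalemxAr Jmx_sqr !scalerN opprD opprK addrA addrK.
by rewrite scalerA scalemx1 -raddfD/= -!expr2 cos2Dsin2.
Qed.

(** The complement of a complex line is stable under multiplication by [i], hence under rotation by
    unit scalars, which also preserves orthonormality. *)
Lemma perp_rotmx i (u : 'rV[R]_(n + n)) (E : 'M[R]_(i, n + n)) t :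
  perp (cline u) E -> perp (cline u) (E *m rotmx t).
Proof.
move=> [WW EE WE]; split=> //.
  by rewrite trmx_mul mulmxA -(mulmxA E) rotmx_orthogonal mulmx1.
have uE : u *m E^T = 0.
  by have := congr1 usubmx WE; rewrite /cline mul_col_mx col_mxKu raddf0.
have uJE : u *m Jmx n *m E^T = 0.
  by have := congr1 dsubmx WE; rewrite /cline mul_col_mx col_mxKd raddf0.
rewrite trmx_mul mulmxA /cline.
have -> : (rotmx t)^T = (cos t)%:M - sin t *: Jmx n.
  by rewrite /rotmx linearD linearZ/= tr_scalar_mx tr_Jmx scalerN.
rewrite mul_col_mx mul_col_mx !mulmxBr !mul_mx_scalar -!scalemxAr -mulmxA Jmx_sqr.
rewrite mulmxN mulmx1 !mulmxBl -!scalemxAl mulNmx uE uJE oppr0 !scaler0 subr0.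
by rewrite col_mx0.
Qed.

Local Open Scope ereal_scope.

(* [cexp t] maps the complex hyperplane spanned by [E] isometrically to itself, so
   all the rotated sections have the same volume; polar coordinates turn the average
   of these volumes into the volume of the averaged section. *)
Let avg_sectionS k (u : 'rV[R]_(n + n)) (E : 'M[R]_(k.+1, n + n)) :
  (1 + 1 + k.+1 = n + n)%N -> perp (cline u) E ->
  leb k.+1 (gbody (fun t => avg_gauge k.+1 g (t *m E)%R)) =
  leb k.+1 (gbody (fun t => g (t *m E)%R)).
Proof.
move=> kn WE; have EE : (E *m E^T = 1%:M)%R by case: WE.
have ga := gauge_avg (ltn0Sn k) gg.
have gaE := gauge_mulmx ga EE.
set A := leb k.+1 (gbody (fun t => g (t *m E)%R)).
have AE t : leb k.+1 (gbody (fun x => g (x *m (E *m rotmx t))%R)) = A.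
  by rewrite -(vol_section kn gg (perp_rotmx t WE)) (vol_section kn gg WE).
pose H (p : mR * 'rV[R]_k.+1) : \bar R :=
  if ((0 <= p.1 <= 2 * pi) && (1 <= enorm p.2 <= 2))%R
  then ((g (cmul (cexp p.1) (p.2 *m E)%R))^-1 ^+ k.+1)%:E else 0.
have H0 p : 0 <= H p.
  by rewrite /H; case: ifP => // _; rewrite lee_fin exprn_ge0// invr_ge0 gauge_ge0.
have mf1 : measurable_fun setT (fun p : mR * 'rV[R]_k.+1 => p.1 : R).
  exact: measurable_fst.
have mn1 : measurable_fun setT (fun p : mR * 'rV[R]_k.+1 => enorm p.2).
  exact: (measurableT_comp (@measurable_enorm R k.+1) measurable_snd).
have mH : measurable_fun setT H.
  apply: measurable_fun_ifT => //.
    by apply: measurable_and; apply: measurable_and; exact: measurable_fun_ler.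
  apply/measurable_EFinP; apply: measurable_funX.
  apply: (measurableT_comp (measurable_gaugeV gg)).
  rewrite (_ : (fun _ => _) = fun p : mR * 'rV[R]_k.+1 =>
    (cos p.1 *: (p.2 *m E) + sin p.1 *: (p.2 *m (E *m Jmx n)))%R); last first.
    by apply/funext => p; rewrite cmulE mulmxA.
  apply: measurable_addrV; apply: measurable_scalerV.
  - apply: (measurableT_comp _ mf1); apply: continuous_measurable_fun.
    exact: continuous_cos.
  - exact: (measurableT_comp (measurable_mulmxr E) measurable_snd).
  - apply: (measurableT_comp _ mf1); apply: continuous_measurable_fun.
    exact: continuous_sin.
  - exact: (measurableT_comp (measurable_mulmxr _) measurable_snd).
have pi2 : (0 < 2 * pi :> R)%R by rewrite mulr_gt0// pi_gt0.
have pi2' : (0 <= (2 * pi)^-1 :> R)%R by rewrite invr_ge0 ltW.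
(* The exponent of the average equals the dimension of the section, so the polar integrand of the
   averaged gauge is exactly the circle mean of the integrands of the rotated gauges. *)
have LE : @radial_mass R * leb k.+1 (gbody (fun t => avg_gauge k.+1 g (t *m E)%R)) =
    @power_mass R k * (((2 * pi)^-1)%:E * \int[leb k.+1]_x \int[mu]_t H (t, x)).
  rewrite (gbody_polar gaE); congr (_ * _).
  rewrite -ge0_integralZl//; last 2 first.
  - exact: (measurable_fun_fubini_tonelli_G (m1 := mu) H).
  - by move=> x _; exact: integral_ge0.
  apply: eq_integral => x _.
  case: ifPn => [x12|x12]; last first.
    rewrite integral0_eq ?mule0// => t _; rewrite /H/= (negbTE x12) andbF//.
  have xE0 : (x *m E)%R != 0%R.
    rewrite -enorm_gt0 enorm_isom//; case/andP: x12 => + _.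
    exact: lt_le_trans.
  rewrite /avg_gauge /mean_inv powRN invrK.
  have [b b0 ob] := orbit_le gg.
  have corb : continuous (orbit g (x *m E)%R) by exact: continuous_orbit.
  have orb0 t := orbit_gt0 gg t xE0.
  have J0 := mean_power_gt0 k.+1 corb orb0 (fun t => ob (x *m E)%R t).
  rewrite -powR_mulrn ?powR_ge0// -powRrM mulVf ?pnatr_eq0// powRr1 ?(ltW J0)//.
  rewrite /mean_power EFinM; congr (_ * _).
  rewrite /Rintegral fineK; last first.
    exact: integrable_fin_num (integrable_inv_pow k.+1 corb orb0).
  rewrite integral_mkcond; apply: eq_integral => t _.
  by rewrite patchE mem_setE in_itv/= /H/= x12 andbT.
(* With the integrals exchanged, each fixed [t] gives the polar formula for the section read through
   the rotated frame, whose volume is [A] by [AE]. *)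
have RE : @radial_mass R * A =
    @power_mass R k * (((2 * pi)^-1)%:E * \int[leb k.+1]_x \int[mu]_t H (t, x)).
  rewrite -(fubini_tonelli (m1 := mu) (m2 := leb k.+1) H mH H0).
  rewrite [RHS]muleCA -[X in _ = _ * X]ge0_integralZl//; last 3 first.
  - exact: (measurable_fun_fubini_tonelli_F (m2 := leb k.+1) H).
  - by move=> t _; exact: integral_ge0.
  - exact/ltW/power_mass_gt0.
  transitivity (((2 * pi)^-1)%:E * \int[mu]_(t in `[0%R, (2 * pi)%R]) (@radial_mass R * A)).
    rewrite integral_cst//= lebesgue_measure_itv/= lte_fin pi2.
    rewrite muleCA oppr0 adde0 -EFinM mulVf ?gt_eqF// mule1//.
  congr (_ * _); rewrite [LHS]integral_mkcond; apply: eq_integral => t _.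
  rewrite patchE mem_setE in_itv/=; case: ifPn => t2; last first.
    by rewrite integral0_eq ?mule0// => x _; rewrite /H/= (negbTE t2).
  have gr : gauge (fun x => g (x *m (E *m rotmx t))%R).
    by apply: gauge_mulmx => //; case: (perp_rotmx t WE).
  rewrite -(AE t) (gbody_polar gr); congr (_ * _); apply: eq_integral => x _.
  by rewrite /H/= t2/= cmul_cexp mulmxA.
have Rfin : @radial_mass R \is a fin_num.
  by rewrite ge0_fin_numE ?radial_mass_lty// ltW// radial_mass_gt0.
have R0 : (fine (@radial_mass R) != 0)%R.
  by rewrite gt_eqF// fine_gt0// radial_mass_gt0 radial_mass_lty.
have := LE; rewrite -RE -(fineK Rfin) => /(congr1 (fun z => ((fine (@radial_mass R))^-1)%:E * z)).
by rewrite !muleA -EFinM mulVf// !mul1e.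
Qed.

Lemma avg_section m (u : 'rV[R]_(n + n)) (E : 'M[R]_(m, n + n)) : (0 < m)%N ->
  (1 + 1 + m = n + n)%N -> perp (cline u) E ->
  leb m (gbody (fun t => avg_gauge m g (t *m E)%R)) =
  leb m (gbody (fun t => g (t *m E)%R)).
Proof. by case: m E => // k E _; exact: avg_sectionS. Qed.

End average_sections.

(** * The complex intersection body *)

Section radial_dilate.
Context {R : realType}.

Lemma radial_dilate_body m (r : 'rV[R]_m -> R) (t : R) (u : 'rV[R]_m) :
  0 < t -> enorm u = 1 -> 0 <= r u ->
  radial (dilate t (body_of_radial r)) u = t * r u.
Proof.
move=> t0 u1 ru; rewrite /radial (_ : [set _ | _] = `[0, t * r u]%classic).
  by rewrite sup_itvcc// mulr_ge0// ltW.
apply/seteqP; split=> l /=; rewrite in_itv/=.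
  move=> [l0 [_ [v [a [v1 /andP[a0 ar] ->]]] E]]; rewrite l0/=.
  have /(congr1 (@enorm R m)) := E.
  rewrite !enormZ ?(ltW t0)// u1 v1 !mulr1 => lE.
  (* For [a = 0] the point is the origin and does not determine its direction [v]. *)
  have [a00|a00] := eqVneq a 0; first by rewrite -lE a00 mulr0 mulr_ge0// ltW.
  suff uv : v = u by rewrite -lE -uv ler_pM2l.
  have ta : t * a != 0 by rewrite mulf_neq0// gt_eqF.
  by apply: (scalerI ta); rewrite -scalerA E -lE.
move=> /andP[l0 lr]; split=> //; exists ((l / t) *: u).
  exists u, (l / t); split=> //.
  by rewrite divr_ge0 ?(ltW t0)//= ler_pdivrMr// mulrC.
by rewrite scalerA mulrC mulfVK// gt_eqF.
Qed.

Lemma radial_dilate_gbody m (g : 'rV[R]_m -> R) (t : R) (u : 'rV[R]_m) :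
  (0 < m)%N -> gauge g -> 0 < t -> enorm u = 1 ->
  radial (dilate t (gbody g)) u = t * (g u)^-1.
Proof.
move=> m0 gg t0 u1; rewrite -(body_of_radialE (r := fun x => (g x)^-1) m0 gg)//.
by rewrite radial_dilate_body// invr_ge0 gauge_ge0.
Qed.

End radial_dilate.

Section intersection_body.
Context {R : realType}.
Variable n : nat.
Hypothesis n1 : (1 < n)%N.
Let N := (n + n)%N.
Let i := (2 * n - 2)%N.

Let i0 : (0 < i)%N.
Proof. by rewrite subn_gt0 -[X in (X < _)%N]muln1 ltn_pmul2l. Qed.

Let iN : (1 + 1 + i = n + n)%N.
Proof. by apply: dim_split; exact: ltnW. Qed.

Let n0 : (0 < n)%N. Proof. exact: ltnW. Qed.
Let N0 : (0 < n + n)%N. Proof. by rewrite addn_gt0 n0. Qed.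

Variable g : 'rV[R]_(n + n) -> R.
Hypothesis gg : gauge g.

Let kappa : R := fine (leb 2 (gbody (@enorm R 2))).
Let kappa0 : 0 < kappa.
Proof.
by rewrite /kappa fine_gt0// leb_gbody_gt0 ?leb_gbody_lty//; exact: gauge_enorm.
Qed.
Let kappaE : leb 2 (gbody (@enorm R 2)) = kappa%:E.
Proof. by rewrite fineK// fin_num_leb_gbody//; exact: gauge_enorm. Qed.

(* Also the volume of the section of [gbody g] itself; see [section_volumeE]. *)
Definition section_volume (u : 'rV[R]_(n + n)) : R :=
  fine (vol (2 * n - 2) (circle_average (gbody g) `&` cperp u)).

Lemma section_volumeE u (E : 'M[R]_(2 * n - 2, n + n)) : perp (cline u) E ->
  leb (2 * n - 2) (gbody (fun t => g (t *m E))) = (section_volume u)%:E.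
Proof.
rewrite /section_volume circle_averageE// -/i => WE.
rewrite (vol_section iN _ WE); last exact: gauge_avg.
have EE : E *m E^T = 1%:M by case: WE.
rewrite (avg_section gg i0 iN WE).
by rewrite fineK// fin_num_leb_gbody//; exact: gauge_mulmx.
Qed.

Lemma vol_section_volume u : enorm u = 1 ->
  vol (2 * n - 2) (circle_average (gbody g) `&` cperp u) = (section_volume u)%:E.
Proof.
move=> u1; rewrite /section_volume fineK// circle_averageE//.
have [E WE] := exists_perp n0 u1; have EE : E *m E^T = 1%:M by case: WE.
rewrite (vol_section iN _ WE); last exact: gauge_avg.
by apply: fin_num_leb_gbody; apply: gauge_mulmx => //; exact: gauge_avg.
Qed.

Lemma cperp_cmul c (x : 'rV[R]_(n + n)) : c != 0 -> cperp (cmul c x) = cperp x.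
Proof.
have sub d (y : 'rV[R]_(n + n)) : cperp y `<=` cperp (cmul d y).
  move=> z; rewrite !cperpE/= !mul_tr_cline -[0]row_mx0.
  move=> /eq_row_mx[/matrixP/(_ 0 0) + /matrixP/(_ 0 0)].
  rewrite !mxE !mulr1n => zy zyJ.
  rewrite cmulE mulmxDl -!scalemxAl -mulmxA Jmx_sqr mulmxN mulmx1.
  by rewrite !dotDr !dotZr dotNr zy zyJ !(mulr0, oppr0, addr0) raddf0.
move=> c0; apply/seteqP; split; last exact: sub.
by rewrite -[X in _ `<=` cperp X]cmul1 -(mulVf c0) -cmulA; exact: sub.
Qed.

Lemma section_volumeZ a (x : 'rV[R]_(n + n)) : a != 0 ->
  section_volume (a *: x) = section_volume x.
Proof.
move=> a0; rewrite /section_volume -(@cperp_cmul (a +i* 0) x).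
  by rewrite cmulE/= scale0r addr0.
by apply: contra a0 => /eqP[->].
Qed.

Lemma section_volume_ge : exists2 a, 0 < a & forall u, enorm u = 1 -> a <= section_volume u.
Proof.
have [b b0 gb] := gauge_norm_le gg.
have b1 : 0 < b^-1 by rewrite invr_gt0.
have fb : leb i (@eball R i b^-1) \is a fin_num by rewrite ge0_fin_numE// leb_eball_lty.
exists (fine (leb i (@eball R i b^-1))).
  by rewrite fine_gt0// leb_eball_gt0 ?leb_eball_lty.
move=> u u1; have [E WE] := exists_perp n0 u1.
have EE : E *m E^T = 1%:M by case: WE.
rewrite -lee_fin (fineK fb) -(section_volumeE WE); apply: le_measure; rewrite ?inE.
- exact: measurable_eball.
- by apply: measurable_gbody; exact: gauge_mulmx.
move=> t; rewrite /eball/gbody/= => tb.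
rewrite (le_trans (gb _))// (le_trans (ler_wpM2l (ltW b0) (mx_norm_le_enorm _)))//.
by rewrite enorm_isom// -(mulfV (lt0r_neq0 b0)) ler_pM2l.
Qed.

Lemma section_volume_le : exists b, forall u, enorm u = 1 -> section_volume u <= b.
Proof.
have [r r0 gr] := gbody_sub_eball gg.
have fb : leb i (@eball R i r) \is a fin_num by rewrite ge0_fin_numE// leb_eball_lty.
exists (fine (leb i (@eball R i r))).
move=> u u1; have [E WE] := exists_perp n0 u1.
have EE : E *m E^T = 1%:M by case: WE.
rewrite -lee_fin (fineK fb) -(section_volumeE WE); apply: le_measure; rewrite ?inE.
- by apply: measurable_gbody; exact: gauge_mulmx.
- exact: measurable_eball.
by move=> t /gr; rewrite /eball/= enorm_isom.
Qed.

(** The frames of the two hyperplanes are arbitrary; only the closeness of [cline u] and [cline v]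
    enters, with the Euclidean norm of the plane as the auxiliary gauge of the cylinders. *)
Lemma section_volume_perturb (e : R) : 0 < e ->
  exists2 d, 0 < d & forall u v, enorm u = 1 -> enorm v = 1 -> `|u - v| < d ->
    section_volume u <= (1 + e) * section_volume v.
Proof.
move=> e0; have [c c0 hc] := section_perturb iN gg (gauge_enorm 2) e0.
pose m : R := (n + n).+1%:R.
have m0 : 0 < m by rewrite ltr0n.
(* One factor [m] comes from bounding [dot] by sup norms, the other from comparing the norms of
   [i u - i v] and [u - v]. *)
exists (c / (m * m)); first by rewrite divr_gt0// mulr_gt0.
move=> u v u1 v1 uv.
have [E WE] := exists_perp n0 u1; have [F WF] := exists_perp n0 v1.
rewrite -lee_fin EFinM -(section_volumeE WE) -(section_volumeE WF).
apply: (hc _ _ _ _ WE WF) => x; rewrite !mul_tr_cline opp_row_mx add_row_mx -!raddfB/=.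
have dotB (y z : 'rV[R]_(n + n)) : dot x y - dot x z = dot x (y - z).
  by rewrite dotDr dotNr.
have bound (y : 'rV[R]_(n + n)) : `|y| <= m * `|u - v| -> `|dot x y| <= c * `|x|.
  move=> yuv; rewrite (le_trans (norm_dot_le _ _))// mulrAC ler_wpM2r//.
  apply: (@le_trans _ _ (m * (m * `|u - v|))); first by rewrite ler_pM// ler_nat.
  by rewrite mulrA mulrC -ler_pdivlMr ?mulr_gt0// ltW.
have me (y : 'rV[R]_(n + n)) : enorm y <= m * `|y|.
  by rewrite (le_trans (enorm_le_mx_norm _))// ler_wpM2r// ler_nat.
apply: mx_norm_leP; first by rewrite mulr_ge0// ltW.
move=> j; rewrite !dotB; case: (split_ordP j) => a ->.
  rewrite row_mxEl mxE (ord1 a) eqxx mulr1n; apply: bound.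
  by rewrite ler_peMl// ler1n.
rewrite row_mxEr mxE (ord1 a) eqxx mulr1n; apply: bound.
rewrite -mulmxBl (le_trans (mx_norm_le_enorm _))//.
by rewrite /enorm dot_JJ; exact: me.
Qed.

(** A circle invariant body of radial function [rho] meets the complex line through [u] in area
    [kappa * rho u ^+ 2]; this solves for [1 / rho] on the sphere and extends it homogeneously, as
    [section_volume] is invariant under nonzero scaling. *)
Definition intersection_gauge (x : 'rV[R]_(n + n)) : R :=
  enorm x * (Num.sqrt (section_volume x / kappa))^-1.

Let unit (x : 'rV[R]_(n + n)) : x != 0 -> enorm ((enorm x)^-1 *: x) = 1.
Proof.
by move=> x0; rewrite enormZ ?invr_ge0 ?enorm_ge0// mulVf// enorm_eq0.
Qed.

Lemma section_volume_gt0 x : x != 0 -> 0 < section_volume x.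
Proof.
move=> x0; have [a a0 ha] := section_volume_ge.
rewrite -(@section_volumeZ (enorm x)^-1); last by rewrite invr_eq0 enorm_eq0.
by rewrite (lt_le_trans a0)// ha// unit.
Qed.

Lemma gauge_intersection : gauge intersection_gauge.
Proof.
have [a a0 ha] := section_volume_ge.
apply: (@gauge_mult _ _ _ (Num.sqrt (a / kappa))^-1).
- move=> b x; rewrite le_eqVlt => /orP[/eqP<-|b0].
    by rewrite /intersection_gauge scale0r enorm0 !mul0r.
  by rewrite /intersection_gauge section_volumeZ ?gt_eqF// enormZ ?(ltW b0)// mulrA.
- move=> x x0; rewrite mulr_gt0 ?enorm_gt0// invr_gt0 sqrtr_gt0.
  by rewrite divr_gt0// section_volume_gt0.
- move=> u u1; rewrite /intersection_gauge u1 mul1r lef_pV2; last 2 first.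
  + by rewrite posrE sqrtr_gt0 divr_gt0// (lt_le_trans a0)// ha.
  + by rewrite posrE sqrtr_gt0 divr_gt0.
  by rewrite ler_wsqrtr// ler_pM2r ?invr_gt0// ha.
- move=> e e0; have [d d0 hd] := section_volume_perturb e0.
  exists d => // u v u1 v1 uv; rewrite /intersection_gauge u1 v1 !mul1r.
  have pos w : enorm w = 1 -> 0 < Num.sqrt (section_volume w / kappa).
    by move=> w1; rewrite sqrtr_gt0 divr_gt0// (lt_le_trans a0)// ha.
  have e1 : 0 < 1 + e by rewrite addr_gt0.
  rewrite -ler_pdivrMl// -invfM lef_pV2 ?posrE ?mulr_gt0 ?pos//.
  apply: (@le_trans _ _ (Num.sqrt ((1 + e) * (section_volume v / kappa)))).
    by rewrite ler_wsqrtr// mulrA ler_pM2r ?invr_gt0// hd.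
  rewrite sqrtrM ?(ltW e1)// ler_wpM2r ?sqrtr_ge0//.
  rewrite -[leRHS](gtr0_norm e1) -sqrtr_sqr.
  by rewrite ler_wsqrtr// expr2 ler_peMl ?(ltW e1)// lerDl ltW.
Qed.

Lemma is_intersection_gbody :
  is_complex_intersection_body (circle_average (gbody g)) (gbody intersection_gauge).
Proof.
have inv c x : `|c| = 1 -> intersection_gauge (cmul c x) = intersection_gauge x.
  move=> c1; have c0 : c != 0 by rewrite -normr_eq0 c1 oner_eq0.
  rewrite /intersection_gauge /section_volume cperp_cmul//; congr (_ * _).
  by rewrite enorm_cmul; move/eqP: c1; rewrite normc_eq1 => /eqP ->; rewrite mul1r.
have circ : circle_invariant (gbody intersection_gauge).
  move=> c c1; have c0 : c != 0 by rewrite -normr_eq0 c1 oner_eq0.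
  apply/seteqP; split=> [_ [x gx <-]|x gx]; first by rewrite /gbody/= inv.
  exists (cmul c^-1 x); first by rewrite /gbody/= inv// normfV c1 invr1.
  by rewrite cmulA mulfV// cmul1.
split=> //; first exact/star_body_gbody/gauge_intersection.
move=> u u1; rewrite vol_section_volume// vol_line//; last exact: gauge_intersection.
rewrite /intersection_gauge u1 mul1r invrK sqr_sqrtr; last first.
  by rewrite divr_ge0 ?(ltW kappa0)// ltW// section_volume_gt0// -enorm_eq0 u1 oner_eq0.
by rewrite kappaE -EFinM mulfVK// gt_eqF.
Qed.

(** Existence, witnessed by [intersection_gauge], ensures that [xget] returns a body with the
    defining property; its radial function is then read off the equation of areas. *)
Lemma complex_intersection_body_gauge : exists f : 'rV[R]_(n + n) -> R,
  [/\ gauge f, complex_intersection_body (circle_average (gbody g)) = gbody f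
    & forall u, enorm u = 1 -> (f u)^-1 = Num.sqrt (section_volume u / kappa)].
Proof.
have [sL cL vL] : is_complex_intersection_body (circle_average (gbody g))
    (complex_intersection_body (circle_average (gbody g))).
  by apply: xgetPex; exists (gbody intersection_gauge); exact: is_intersection_gbody.
move: sL cL vL; set L := complex_intersection_body _ => sL cL vL.
have [f gf LE] := star_body_gauge N0 sL; exists f; split=> // u u1.
have := vL u u1; rewrite LE vol_section_volume// vol_line//; last by rewrite -LE.
rewrite kappaE -EFinM => -[<-].
by rewrite mulfK ?gt_eqF// sqrtr_sqr ger0_norm// invr_ge0 gauge_ge0.
Qed.

End intersection_body.

(** * Asymptotics as [p] tends to [-2] *)

Section asymptotics.
Context {R : realType}.

Lemma continuous_powRr (a : R) : 0 < a -> continuous (fun p => a `^ p).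
Proof.
move=> a0; rewrite (_ : (fun p => _) = (@expR R) \o (fun p : R => p * ln a)); last first.
  by apply/funext => p; rewrite /powR gt_eqF.
move=> p; apply: continuous_comp; last exact: continuous_expR.
by apply: cvgM; [exact: cvg_id|exact: cvg_cst].
Qed.

Variables (N i : nat) (g : 'rV[R]_N -> R) (h : 'rV[R]_(1 + 1) -> R).
Hypotheses (iN : (1 + 1 + i)%N = N) (gg : gauge g) (gh : gauge h).

Let V := fine (leb (1 + 1) (gbody h)).
Let M := fine (leb N (gbody g)).
Let A (E : 'M[R]_(i, N)) := fine (leb i (gbody (fun t => g (t *m E)))).
Let Phi (p : R) (W : 'M[R]_(1 + 1, N)) : R :=
  \int[leb N]_(x in gbody g) (h (x *m W^T) `^ p).

Let V0 : 0 < V.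
Proof. by rewrite fine_gt0// leb_gbody_gt0 ?leb_gbody_lty. Qed.

Let Phi_bounds (e : R) : 0 < e ->
  exists2 s, 0 < s & forall p W E, -2 < p < -1 -> perp W E ->
    Phi p W <= (1 + e) ^+ i * (V * A E) * (- p) * (s `^ (p + 2) / (p + 2)) + M * s `^ p /\
    V * A E * (- p) * (s `^ (p + 2) / (p + 2)) <= (1 + e) ^+ i * Phi p W.
Proof.
move=> e0; have [s s0 sb] := cyl_bounds iN gg gh e0.
exists s => // p W E /andP[p2 p1] WE.
have c0 : 0 < (1 + e) ^+ i by rewrite exprn_gt0// addr_gt0.
have EE : E *m E^T = 1%:M by case: WE.
have AE : leb i (gbody (fun t => g (t *m E))) = (A E)%:E.
  by rewrite fineK// fin_num_leb_gbody//; exact: gauge_mulmx.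
have VE : leb (1 + 1) (gbody h) = V%:E by rewrite fineK// fin_num_leb_gbody.
have ME : leb N (gbody g) = M%:E by rewrite fineK// fin_num_leb_gbody.
have L0 : 0 <= V * A E by rewrite mulr_ge0 ?(ltW V0)// fine_ge0.
have mf : measurable_fun setT (fun x : 'rV[R]_N => h (x *m W^T)).
  exact: (measurableT_comp (measurable_gauge gh) (measurable_mulmxr W^T)).
have f0 (x : 'rV[R]_N) : 0 <= h (x *m W^T) by exact: gauge_ge0.
have mD := measurable_gbody gg.
have up : forall t, 0 < t <= s ->
    (leb N (gbody g `&` [set x | (h (x *m W^T) <= t)%R]) <=
     ((1 + e) ^+ i * t ^+ 2 * (V * A E))%:E)%E.
  move=> t t0s; have [+ _] := sb W E t WE t0s.
  by rewrite AE VE -!EFinM.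
have lo : forall t, 0 < t <= s ->
    ((t ^+ 2 * (V * A E))%:E <= ((1 + e) ^+ i)%:E *
      leb N (gbody g `&` [set x | (h (x *m W^T) <= t)%R]))%E.
  move=> t t0s; have [_] := sb W E t WE t0s.
  by rewrite AE VE -!EFinM.
have DM : (leb N (gbody g) <= M%:E)%E by rewrite ME.
have h1 := power_integral_upper mD mf f0 c0 L0 s0 DM up p2 p1.
have h2 := power_integral_lower mD mf f0 c0 L0 s0 up lo p2 p1.
have fin : (\int[leb N]_(x in gbody g) (h (x *m W^T) `^ p)%:E)%E \is a fin_num.
  rewrite ge0_fin_numE ?(le_lt_trans h1) ?ltry//.
  by apply: integral_ge0 => x _; rewrite lee_fin powR_ge0.
by move: h1 h2; rewrite -(fineK fin) -EFinM !lee_fin.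
Qed.

Let ratio (p : R) (W : 'M[R]_(1 + 1, N)) : R := (Gamma (p + 2))^-1 * Phi p W.

Lemma power_integral_asymptotics (e a : R) : 0 < e -> 0 < a ->
  \forall p \near (- 2 : R)^'+, forall W E, perp W E -> a <= A E ->
    ratio p W <= (1 + e) * (2 * (V * A E)) /\ 2 * (V * A E) <= (1 + e) * ratio p W.
Proof.
move=> e0 a0; have e20 : 0 < e / 2 by rewrite divr_gt0.
have [f f0 fe] := pow_near1 i e20.
have [s s0 sb] := Phi_bounds f0.
set c := (1 + f) ^+ i in fe sb.
have c0 : 0 < c by rewrite exprn_gt0// addr_gt0.
have L0 : 0 < V * a by rewrite mulr_gt0.
have M0 : 0 <= M by rewrite fine_ge0.
(* [R1 p] bounds the quotient of [ratio p W] by [V * A E] and tends to [2 * c]; [R2 p] bounds the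
   quotient of [2 * (V * A E)] by [ratio p W] and tends to [c]. Here [c <= 1 + e / 2], which leaves
   room below [1 + e]. *)
pose R1 (p : R) := (1 + (p + 2)) * (c * (- p) * s `^ (p + 2) + M / (V * a) * ((p + 2) * s `^ p)).
pose R2 (p : R) := 2 * (c * (1 + (p + 2))) * (- p * s `^ (p + 2))^-1.
have cs : continuous (fun p => s `^ p) by exact: continuous_powRr.
have cq : (p + 2) @[p --> (- 2 : R)] --> (0 : R).
  by rewrite -[X in _ --> X](addNr 2); apply: cvgD; [exact: cvg_id|exact: cvg_cst].
have csq : s `^ (p + 2) @[p --> (- 2 : R)] --> (1 : R).
  rewrite -[X in _ --> X](powRr0 s).
  exact: (cvg_comp _ (fun q => s `^ q) cq (cs 0)).
have cN : - p @[p --> (- 2 : R)] --> (2 : R).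
  by rewrite -[X in _ --> X]opprK; apply: cvgN; exact: cvg_id.
have c1 : 1 + (p + 2) @[p --> (- 2 : R)] --> (1 : R).
  by rewrite -[X in _ --> X]addr0; apply: cvgD; [exact: cvg_cst|exact: cq].
have R1l : R1 p @[p --> (- 2 : R)] --> 1 * (c * 2 * 1 + M / (V * a) * (0 * s `^ (- 2))).
  apply: cvgM => //; apply: cvgD.
    by apply: cvgM => //; apply: cvgM => //; exact: cvg_cst.
  apply: cvgM; first exact: cvg_cst.
  by apply: cvgM => //; exact: cs.
have R2l : R2 p @[p --> (- 2 : R)] --> 2 * (c * 1) * (2 * 1)^-1.
  apply: cvgM; first by apply: cvgM; [exact: cvg_cst|apply: cvgM => //; exact: cvg_cst].
  by apply: cvgV; [rewrite mulr1|exact: cvgM].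
have nR1 : \forall p \near (- 2 : R)^'+, R1 p < 2 * (1 + e).
  apply: (cvgr_lt _ (cvg_at_right_filter R1l)).
  by rewrite mul0r mulr0 addr0; lra.
have nR2 : \forall p \near (- 2 : R)^'+, R2 p < 1 + e.
  apply: (cvgr_lt _ (cvg_at_right_filter R2l)).
  by rewrite !mulr1 mulrC mulrA mulVf ?pnatr_eq0// mul1r; lra.
near=> p.
have p2 : -2 < p by near: p; exact: nbhs_right_gt.
have p1 : p < -1.
  by near: p; apply: nbhs_right_lt; rewrite ltrN2 ltr1n.
have hR1 : R1 p < 2 * (1 + e) by near: p.
have hR2 : R2 p < 1 + e by near: p.
move=> W E WE aA.
have [up lo] := sb p W E ltac:(by rewrite p2 p1) WE.
have q0 : 0 < p + 2 by rewrite -ltrBlDr sub0r.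
have q1 : p + 2 < 1 by lra.
have [G1 G2] := Gamma_bounds q0 q1.
have G0 := Gamma_gt0 q0 q1.
have P0 : 0 <= Phi p W by apply: Rintegral_ge0 => x _; rewrite powR_ge0.
have A0 : 0 < A E by exact: lt_le_trans aA.
have S0 : 0 < s `^ (p + 2) by rewrite powR_gt0.
have T0 : 0 <= s `^ p by rewrite powR_ge0.
move: hR1 hR2 up lo; rewrite /ratio /R1 /R2.
move: (p + 2) (s `^ _) (s `^ p) (Phi p W) (Gamma _) (A E) q0 q1 G1 G2 G0 P0 A0 S0 T0 aA.
move=> q S T P G B q0 q1 G1 G2 G0 P0 B0 S0 T0 aB hR1 hR2 up lo.
have np : 0 < - p by lra.
have VB : 0 < V * B by rewrite mulr_gt0.
split.
  have Gi : G^-1 <= (1 + q) * q.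
    rewrite -(ler_pM2r G0) mulVf ?gt_eqF// -mulrA -ler_pdivrMl ?addr_gt0//.
    by rewrite mulr1 addrC.
  apply: (@le_trans _ _ ((1 + q) * q * P)); first by rewrite ler_wpM2r.
  apply: (@le_trans _ _ ((1 + q) * (c * (- p) * S + M / (V * a) * (q * T)) * (V * B))).
    apply: (@le_trans _ _ ((1 + q) * q * (c * (V * B) * (- p) * (S / q) + M * T))).
      by rewrite ler_pM2l// mulr_gt0// addr_gt0.
    rewrite -!mulrA ler_pM2l ?addr_gt0//.
    have -> : q * (c * (V * (B * (- p * (S * q^-1)))) + M * T) =
        c * (- p) * S * (V * B) + M * (q * T) by field; rewrite gt_eqF.
    rewrite mulrDl !mulrA lerD2l -!mulrA ler_wpM2l//.
    rewrite ler_pdivlMl// [X in _ <= X]mulrA [X in _ <= X]mulrC.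
    by apply: ler_wpM2r; [rewrite mulr_ge0// ltW|rewrite ler_pM2l].
  by rewrite (_ : (1 + e) * _ = 2 * (1 + e) * (V * B)) ?ler_pM2r ?(ltW hR1)//; ring.
apply: (@le_trans _ _ (2 * (c * (1 + q)) * (- p * S)^-1 * (G^-1 * P))); last first.
  by apply: ler_wpM2r; [rewrite mulr_ge0// invr_ge0 ltW|exact: ltW].
have qG : q <= (1 + q) * G^-1 by rewrite ler_pdivlMr.
apply: (@le_trans _ _ (2 * (- p * S)^-1 * q * (c * P))).
  apply: (@le_trans _ _ (2 * (- p * S)^-1 * q * (V * B * - p * (S / q)))); last first.
    by rewrite ler_pM2l// !mulr_gt0 ?invr_gt0 ?mulr_gt0.
  have [pn Sn qn] : [/\ p != 0, S != 0 & q != 0] by rewrite lt_eqF ?gt_eqF//; lra.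
  by rewrite le_eqVlt; apply/orP; left; apply/eqP; field; rewrite pn Sn qn.
rewrite (_ : 2 * _ * q * _ = 2 * (- p * S)^-1 * c * P * q); last by ring.
rewrite (_ : 2 * (c * _) * _ * _ = 2 * (- p * S)^-1 * c * P * ((1 + q) * G^-1)); last by ring.
by rewrite ler_wpM2l// !mulr_ge0 ?invr_ge0 ?mulr_ge0 ?(ltW np) ?(ltW S0) ?(ltW c0).
Unshelve. all: by end_near.
Qed.

End asymptotics.

Section powR_limit.
Context {R : realType}.

Lemma powR_inv_near (c : R) : 0 < c ->
  c `^ (- p^-1 - 2^-1) @[p --> (- 2 : R)] --> (1 : R).
Proof.
move=> c0; rewrite -[X in _ --> X](powRr0 c).
have -> : (0 : R) = - (- 2)^-1 - 2^-1 by rewrite invrN opprK subrr.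
apply: (@continuous_cvg _ _ _ _ _ (fun p : R => - p^-1 - 2^-1) (fun t => c `^ t)).
  exact: continuous_powRr.
apply: cvgB; last exact: cvg_cst.
by apply: cvgN; apply: cvgV; [rewrite oppr_eq0 pnatr_eq0|exact: cvg_id].
Qed.

Lemma powR_half_squeeze (a b d : R) : 0 < a -> 0 < d ->
  exists2 e, 0 < e & \forall p \near (- 2 : R)^'+, forall X Y, 0 <= X ->
    a <= Y <= b -> X <= (1 + e) * Y -> Y <= (1 + e) * X ->
    `|Num.sqrt Y - X `^ (- p^-1)| < d.
Proof.
move=> a0 d0; pose A := Num.min a 1; pose B := Num.max b 1.
have A0 : 0 < A by rewrite lt_min a0 ltr01.
have B0 : 0 < B by rewrite lt_max ltr01 orbT.
pose s := Num.sqrt B; have s1 : 1 <= s.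
  by rewrite -sqrtr1 ler_wsqrtr// /B le_max lexx orbT.
have s0 : 0 < s by exact: lt_le_trans s1.
pose e := Num.min 1 (d / (13 * s)).
have e0 : 0 < e by rewrite lt_min ltr01/= divr_gt0// mulr_gt0.
have e1 : e <= 1 by rewrite ge_min lexx.
have es : 12 * e * s < d.
  have : e <= d / (13 * s) by rewrite ge_min lexx orbT.
  rewrite ler_pdivlMr ?mulr_gt0// => h; apply: lt_le_trans h.
  by rewrite mulrCA mulrA ltr_pM2r// ltr_pM2r// ltr_nat.
exists e => //.
have nA : \forall p \near (- 2 : R)^'+, (1 + e)^-1 < A `^ (- p^-1 - 2^-1).
  apply: (cvgr_gt _ (cvg_at_right_filter (powR_inv_near A0))).
  by rewrite invf_lt1 ?ltrDl ?addr_gt0.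
have nB : \forall p \near (- 2 : R)^'+, B `^ (- p^-1 - 2^-1) < 1 + e.
  apply: (cvgr_lt _ (cvg_at_right_filter (powR_inv_near B0))).
  by rewrite ltrDl.
near=> p.
have p2 : -2 < p by near: p; exact: nbhs_right_gt.
have p1 : p < -1.
  by near: p; apply: nbhs_right_lt; rewrite ltrN2 ltr1n.
have hA : (1 + e)^-1 < A `^ (- p^-1 - 2^-1) by near: p.
have hB : B `^ (- p^-1 - 2^-1) < 1 + e by near: p.
move=> X Y X0 /andP[aY Yb] XY YX.
have Y0 : 0 < Y by exact: lt_le_trans aY.
have e10 : 0 < 1 + e by rewrite addr_gt0.
move: hA hB; set q := - p^-1; have [q0 q1] : 2^-1 <= q /\ q <= 1.
  have p0 : 0 < - p by lra.
  rewrite /q -invrN; split; first by rewrite lef_pV2 ?posrE//; lra.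
  by rewrite invf_le1//; lra.
move=> hA hB; have q00 : 0 <= q by apply: le_trans q0; rewrite invr_ge0.
have sq : 0 <= q - 2^-1 by rewrite subr_ge0.
have Yq : Y `^ q = Y `^ (q - 2^-1) * Num.sqrt Y.
  by rewrite -powR12_sqrt ?(ltW Y0)// -powRD ?subrK// (gt_eqF Y0) implybT.
have AY : (1 + e)^-1 <= Y `^ (q - 2^-1).
  apply: (le_trans (ltW hA)); rewrite ge0_ler_powR// ?nnegrE ?(ltW A0) ?(ltW Y0)//.
  by rewrite /A ge_min aY.
have BY : Y `^ (q - 2^-1) <= 1 + e.
  apply: le_trans (ltW hB); rewrite ge0_ler_powR// ?nnegrE ?(ltW B0) ?(ltW Y0)//.
  by rewrite /B le_max Yb.
have eq : (1 + e) `^ q <= 1 + e.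
  rewrite -[X in _ <= X]powRr1 ?(ltW e10)//; apply: ler_powR => //.
  by rewrite lerDl ltW.
have r0 : 0 <= Num.sqrt Y by exact: sqrtr_ge0.
have rs : Num.sqrt Y <= s by rewrite ler_wsqrtr// /B le_max Yb.
have Zr : X `^ q <= (1 + e) * ((1 + e) * Num.sqrt Y).
  apply: (@le_trans _ _ (((1 + e) * Y) `^ q)).
    by rewrite ge0_ler_powR// nnegrE mulr_ge0// ltW.
  rewrite powRM ?(ltW e10) ?(ltW Y0)// Yq.
  by rewrite ler_pM ?powR_ge0 ?mulr_ge0 ?powR_ge0// ler_wpM2r.
have rZ : Num.sqrt Y <= (1 + e) * ((1 + e) * X `^ q).
  rewrite -ler_pdivrMl//; apply: (@le_trans _ _ (Y `^ q)).
    by rewrite Yq ler_wpM2r.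
  apply: (@le_trans _ _ (((1 + e) * X) `^ q)).
    by rewrite ge0_ler_powR// nnegrE ?mulr_ge0// ltW.
  by rewrite powRM ?(ltW e10)// ler_wpM2r ?powR_ge0.
have Z0 : 0 <= X `^ q by exact: powR_ge0.
move: (X `^ q) (Num.sqrt Y) Z0 r0 rs Zr rZ => Z r Z0 r0 rs Zr rZ.
rewrite ltr_norml; apply/andP; split; nra.
Unshelve. all: by end_near.
Qed.

End powR_limit.

(** Restates the entourage form of uniform convergence with [e], the form in which the estimates are
    available. *)
Lemma cvg_uniform (R : realType) (T : Type) (X : topologicalType) (A : set X)
    (F : set_system T) (FF : Filter F) (f : X -> R) (s : T -> X -> R) :
  (forall e, 0 < e -> \forall t \near F, forall x, A x -> `|f x - s t x| < e) ->
  {uniform A, s @ F --> f}.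
Proof.
move=> h P /uniform_nbhs[E [entE EP]].
have [e e0 eE] : exists2 e : R, 0 < e & forall x y : R, `|x - y| < e -> E (x, y).
  move: entE; rewrite -entourage_ballE => -[e /= e0 eE].
  by exists e => // x y xy; apply: eE.
by apply: filterS (h _ e0) => t st; apply: EP => x Ax /=; exact/eE/st.
Qed.

Theorem theorem1 (R : realType) (n : nat) (C : set R[i]) :
  (2 <= n)%N -> convex_body0 C ->
  exists k : R, 0 < k /\
    forall K : set 'rV[R]_(n + n), star_body K ->
      star_body (circle_average K) /\
      {uniform @usphere R (n + n),
        (fun p : R => radial (dilate ((Gamma (p + 2))^-1 `^ (- p^-1))
                                     (Lp_intersection_body C p K)))
          @ (- 2)^'+
        --> radial (dilate k (complex_intersection_body (circle_average K)))}.
Proof.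
move=> n1 [cC _ C0]; have n0 : (0 < n)%N by exact: ltnW.
have N0 : (0 < n + n)%N by rewrite addn_gt0 n0.
pose h := supportf (vec_of_complex @` C).
have gh : gauge h by exact: gauge_supportf.
have [V VE V0] : exists2 V, fine (leb (1 + 1) (gbody h)) = V & 0 < V.
  by eexists; [reflexivity|rewrite fine_gt0// leb_gbody_gt0 ?leb_gbody_lty].
have [kappa kappaE kappa0] : exists2 k : R, fine (leb 2 (gbody (@enorm R 2))) = k & 0 < k.
  by eexists; [reflexivity|rewrite fine_gt0// leb_gbody_gt0 ?leb_gbody_lty//; exact: gauge_enorm].
have Vk0 : 0 < 2 * V * kappa by rewrite !mulr_gt0.
(* The limit has radial function [sqrt (2 V A(u))] and the intersection body [sqrt (A(u) / kappa)];
   the quotient depends on [C] alone, through [V]. *)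
exists (Num.sqrt (2 * V * kappa)); split; first by rewrite sqrtr_gt0.
move=> K /(star_body_gauge N0)[g gg ->]; split.
  rewrite (circle_averageE gg n1); apply/star_body_gbody/gauge_avg => //.
  by rewrite subn_gt0 -[X in (X < _)%N]muln1 ltn_pmul2l.
have [f [gf -> fE]] := complex_intersection_body_gauge n1 gg.
rewrite kappaE in fE.
have [a a0 aS] := section_volume_ge n1 gg.
have [b Sb] := section_volume_le n1 gg.
apply: cvg_uniform => d d0.
have V20 : 0 < 2 * V by rewrite mulr_gt0.
have [e e0 sq] := powR_half_squeeze (2 * V * b) (mulr_gt0 V20 a0) d0.
pose X (p : R) (u : 'rV[R]_(n + n)) :=
  (Gamma (p + 2))^-1 * \int[leb (n + n)]_(x in gbody g) (h (x *m (cline u)^T) `^ p).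
have asy : \forall p \near (- 2 : R)^'+, forall u, enorm u = 1 ->
    X p u <= (1 + e) * (2 * V * section_volume g u) /\
    2 * V * section_volume g u <= (1 + e) * X p u.
  apply: filterS (power_integral_asymptotics (dim_split n0) gg gh e0 a0) => p H u u1.
  have [E WE] := exists_perp n0 u1.
  have := H _ _ WE; rewrite (section_volumeE n1 gg WE) VE/= !mulrA.
  by apply; exact: aS.
near=> p => u u1.
have p2 : -2 < p by near: p; exact: nbhs_right_gt.
have p1 : p < -1 by near: p; apply: nbhs_right_lt; rewrite ltrN2 ltr1n.
have G0 : 0 < Gamma (p + 2).
  by apply: Gamma_gt0; [rewrite -ltrBlDr sub0r|move: p1; clear; lra].
have I0 : 0 <= \int[leb (n + n)]_(x in gbody g) (h (x *m (cline u)^T) `^ p).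
  by apply: Rintegral_ge0 => x _; exact: powR_ge0.
have X0 : 0 <= X p u by rewrite /X mulr_ge0// invr_ge0 ltW.
have [up lo] : X p u <= (1 + e) * (2 * V * section_volume g u) /\
    2 * V * section_volume g u <= (1 + e) * X p u.
  by move: (u) u1; near: p.
rewrite radial_dilate_gbody ?sqrtr_gt0// fE//.
rewrite /Lp_intersection_body radial_dilate_body ?powR_ge0 ?powR_gt0 ?invr_gt0//.
under eq_Rintegral do rewrite supportf_cmul -/h.
(* The normalization and the integral carry the same exponent [- p^-1] and merge into a power of
   [X p u], the form in which [sq] compares it with a square root. *)
rewrite -powRM ?invr_ge0 ?(ltW G0)// -/(X p u).
rewrite -sqrtrM ?(ltW Vk0)// [_ / kappa]mulrC mulrA mulfK ?gt_eqF//.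
have SV : 2 * V * a <= 2 * V * section_volume g u <= 2 * V * b.
  by rewrite !ler_pM2l// aS// Sb.
move: X0 SV up lo; move: (X p u) (2 * V * section_volume g u).
by near: p.
Unshelve. all: by end_near.
Qed.
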